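(* Fix $r\in(0,\infty)$. Let $(s_n)$ be a sequence of integers with $1\le s_n\le n$ and $\eta_n=s_n/n\to0$ as $n\to\infty$. Let $\hat p_{\mathsf B}$ be the Bayes predictive density estimate based on the product bi-grid prior $\pi_{\mathsf B,n}(d\boldsymbol\theta)=\prod_{i=1}^n\pi_{\mathsf B}[\eta_n](d\theta_i)$. Then $$\max_{\boldsymbol\theta\in\Theta_n[s_n]}\rho(\boldsymbol\theta,\hat p_{\mathsf B})=R_N(\Theta_n[s_n])\,(1+o(1))\qquad\text{as }n\to\infty.$$
   Context: Model: $\boldsymbol X\sim N_n(\boldsymbol\theta,\boldsymbol I)$ and $\boldsymbol Y\sim N_n(\boldsymbol\theta,r\boldsymbol I)$ are independent given the unknown $\boldsymbol\theta\in\mathbb R^n$; $r>0$ is known and fixed. Put $v=(1+r^{-1})^{-1}=r/(1+r)$. Let $p(\boldsymbol x|\boldsymbol\theta,1)$ and $p(\boldsymbol y|\boldsymbol\theta,r)$ denote the Gaussian densities of $\boldsymbol X$ and $\boldsymbol Y$. A predictive density estimator $\hat p(\boldsymbol y|\boldsymbol x)$ is, for each $\boldsymbol x\in\mathbb R^n$, a probability density in $\boldsymbol y\in\mathbb R^n$ (jointly measurable). Its Kullback–Leibler loss is $L(\boldsymbol\theta,\hat p(\cdot|\boldsymbol x))=\int p(\boldsymbol y|\boldsymbol\theta,r)\log\frac{p(\boldsymbol y|\boldsymbol\theta,r)}{\hat p(\boldsymbol y|\boldsymbol x)}\,d\boldsymbol y$ and its risk is $\rho(\boldsymbol\theta,\hat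 p)=\int L(\boldsymbol\theta,\hat p(\cdot|\boldsymbol x))\,p(\boldsymbol x|\boldsymbol\theta,1)\,d\boldsymbol x$. For a prior $\pi$ on $\mathbb R^n$ the Bayes predictive density estimate is $\hat p_\pi(\boldsymbol y|\boldsymbol x)=\int p(\boldsymbol y|\boldsymbol\theta,r)\,\pi(d\boldsymbol\theta|\boldsymbol x)$, with $\pi(d\boldsymbol\theta|\boldsymbol x)$ the posterior given $\boldsymbol X=\boldsymbol x$. Let $\|\boldsymbol\theta\|_0=\#\{i:\theta_i\ne0\}$, $\Theta_n[s]=\{\boldsymbol\theta\in\mathbb R^n:\|\boldsymbol\theta\|_0\le s\}$, and $R_N(\Theta)=\inf_{\hat p}\sup_{\boldsymbol\theta\in\Theta}\rho(\boldsymbol\theta,\hat p)$, the infimum being over all predictive density estimators. ''$\max$'' denotes supremum. Bi-grid prior: let $b=\min\{4r(1+r)(1+2r)^{-1},1\}$ and $K=1+\lceil 2b^{-3/2}\rceil$. For $\eta\in(0,1)$ let $\lambda=\lambda(\eta)=\sqrt{2\log\eta^{-v}}$, $\nu_k=\lambda+(k-1)b\lambda$ for $k=1,\dots,K$, and $\mu_j=\nu_K+j\lambda$ for $j=1,2,\dots$. Let $$\nu_{\mathsf B}^+=c\Bigl[\sum_{k=1}^K\eta^{(k-1)vb^2}\delta_{\nu_k}+\eta^{(K-1)vb^2}\sum_{j=1}^\infty\eta^{jv}\delta_{\mu_j}\Bigr],$$ where $c=c(\eta)>0$ is the normalizing constant making $\nu_{\mathsf B}^+$ a probability measure and $\delta_a$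 is the unit point mass at $a$. Let $\nu_{\mathsf B}^-$ be the reflection of $\nu_{\mathsf B}^+$ about $0$ and $\pi_{\mathsf B}[\eta]=(1-\eta)\delta_0+\tfrac12\eta(\nu_{\mathsf B}^++\nu_{\mathsf B}^-)$. *)

(* Defs.v *)
From HB Require Import structures.
From mathcomp Require Import all_boot all_order all_algebra.
From mathcomp Require Import all_classical all_reals all_analysis.
From mathcomp Require Import measurable_realfun.

Set Implicit Arguments.
Unset Strict Implicit.
Unset Printing Implicit Defensive.

Import Order.TTheory GRing.Theory Num.Theory.
Import numFieldNormedType.Exports.

Local Open Scope classical_set_scope.
Local Open Scope ring_scope.

Section cons_measure.
Context d (T : measurableType d) (R : realType) (n : nat).
Variables (m1 : {sigma_finite_measure set T -> \bar R})
          (m2 : {sigma_finite_measure set (n.-tuple T) -> \bar R}).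
Local Open Scope ereal_scope.

Let consp (p : T * n.-tuple T) : n.+1.-tuple T := [tuple of p.1 :: p.2].

Let measurable_consp : measurable_fun [set: T * n.-tuple T] consp.
Proof. by apply: measurable_cons. Qed.

Definition cons_measure : set (n.+1.-tuple T) -> \bar R :=
  pushforward (m1 \x m2) (fun p => [tuple of p.1 :: p.2]).

Let cons_measure0 : cons_measure set0 = 0.
Proof. by rewrite /cons_measure /pushforward preimage_set0 measure0. Qed.

Let cons_measure_ge0 A : 0 <= cons_measure A.
Proof. exact: measure_ge0. Qed.

Let cons_measure_sigma_additive : semi_sigma_additive cons_measure.
Proof.
move=> F mF tF mUF; rewrite /cons_measure /pushforward preimage_bigcup.
have mC A : measurable A -> measurable (consp @^-1` A).
  by move=> mA; rewrite -[X in measurable X]setTI; exact: measurable_consp.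
apply: measure_semi_sigma_additive.
- by move=> i; exact: mC.
- apply/trivIsetP => /= i j _ _ ij; rewrite -preimage_setI.
  by move/trivIsetP : tF => /(_ _ _ _ _ ij) ->//; rewrite preimage_set0.
- by rewrite -preimage_bigcup; exact: mC.
Qed.

HB.instance Definition _ := isMeasure.Build _ _ _ cons_measure
  cons_measure0 cons_measure_ge0 cons_measure_sigma_additive.

Let cons_measure_sigma_finite : sigma_finite [set: n.+1.-tuple T] cons_measure.
Proof.
have /sigma_finiteP[F [TF ndF Foo]] := sigma_finiteT m1.
have /sigma_finiteP[G [TG ndG Goo]] := sigma_finiteT m2.
pose unc (t : n.+1.-tuple T) : T * n.-tuple T := (thead t, [tuple of behead t]).
have consK : cancel consp unc.
  by move=> [x t]; rewrite /unc/consp/=; congr pair; apply/val_inj.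
have munc : measurable_fun setT unc.
  apply/measurable_fun_pairP; split; first exact: measurable_tnth.
  exact: measurable_behead.
exists (fun i => unc @^-1` (F i `*` G i)).
  apply/seteqP; split => // t _.
  have [k _ Fk] : (\bigcup_i F i) (unc t).1 by rewrite -TF.
  have [l _ Gl] : (\bigcup_i G i) (unc t).2 by rewrite -TG.
  exists (maxn k l) => //; split => /=.
  - by move: Fk; exact/subsetPset/ndF/leq_maxl.
  - by move: Gl; exact/subsetPset/ndG/leq_maxr.
move=> i; have [mFi Fioo] := Foo i; have [mGi Gioo] := Goo i; split.
  by rewrite -[X in measurable X]setTI; apply: munc => //; exact: measurableX.
rewrite /cons_measure /pushforward.
rewrite (_ : _ @^-1` _ = (unc \o consp) @^-1` (F i `*` G i))//.
rewrite (_ : unc \o consp = id) ?preimage_id; last exact/funext.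
by rewrite product_measure1E// lte_mul_pinfty// ge0_fin_numE.
Qed.

HB.instance Definition _ := Measure_isSigmaFinite.Build _ _ _ cons_measure
  cons_measure_sigma_finite.

End cons_measure.

Section mpow.
Context d (T : measurableType d) (R : realType).
Variable mu : {sigma_finite_measure set T -> \bar R}.

(** The [n]-fold product of [mu] with itself, see [mpow_box]. *)
Fixpoint mpow (n : nat) : {sigma_finite_measure set (n.-tuple T) -> \bar R} :=
  match n with
  | 0 => \d_[tuple]
  | n'.+1 => cons_measure mu (mpow n')
  end.

End mpow.

Lemma mpow_box d (T : measurableType d) (R : realType)
    (mu : {sigma_finite_measure set T -> \bar R}) n (A : 'I_n -> set T) :
  (forall i, measurable (A i)) ->
  mpow mu n [set t | forall i, A i (tnth t i)] = (\prod_(i < n) mu (A i))%E.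
Proof.
elim: n A => [A _|n IH A mA]; first by rewrite big_ord0 /= diracE mem_set// => -[].
rewrite big_ord_recl /= /cons_measure /pushforward -(IH (A \o lift ord0))//; last first.
  by move=> i; exact: mA.
rewrite -product_measure1E//; last first.
  rewrite (_ : mkset _ = \bigcap_(i in [set: 'I_n])
      ((fun t : n.-tuple T => tnth t i) @^-1` A (lift ord0 i))); last first.
    by apply/seteqP; split => t h i => [_|]; [exact: h|exact: (h i I)].
  apply: fin_bigcap_measurable => //= i _.
  by rewrite -[X in measurable X]setTI; apply: measurable_tnth.
congr product_measure1; apply/seteqP; split => -[x t] /=.
- move=> h; split; first exact: (h ord0).
  by move=> i; have := h (lift ord0 i); rewrite tnthS.
- move=> [hx ht] i; case: (unliftP ord0 i) => [j ->|->//].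
  by rewrite tnthS; exact: ht.
Qed.

Notation "''R^[' R ]_ n" := (n.-tuple (measurableTypeR R))
  (at level 8, n at level 2, format "''R^[' R ]_ n") : type_scope.

Section predictive_model.
Context {R : realType} {n : nat}.
Implicit Types (theta x y : 'R^[R]_n) (p : 'R^[R]_n -> 'R^[R]_n -> R).

Definition leb : {sigma_finite_measure set 'R^[R]_n -> \bar R} :=
  mpow (@lebesgue_measure R) n.

(** Density of N_n(theta, s I); the second parameter of [normal_pdf] is a
    standard deviation, while [s] is a variance. *)
Definition gauss_pdf theta (s : R) x : R :=
  \prod_(i < n) normal_pdf (tnth theta i) (Num.sqrt s) (tnth x i).

Lemma gauss_pdf_ge0 theta s x : 0 <= gauss_pdf theta s x.
Proof. by apply: prodr_ge0 => i _; exact: normal_pdf_ge0. Qed.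

Lemma normal_pdfC (m s x : R) : s != 0 -> normal_pdf m s x = normal_pdf x s m.
Proof.
move=> s0; rewrite !normal_pdfE// /normal_fun.
by rewrite -(sqrrN (x - m)) opprB.
Qed.

Lemma gauss_pdfC theta s x : 0 < s -> gauss_pdf theta s x = gauss_pdf x s theta.
Proof.
move=> s0; apply: eq_bigr => i _.
by rewrite normal_pdfC// gt_eqF// sqrtr_gt0.
Qed.

Lemma measurable_gauss_pdf theta s : measurable_fun setT (gauss_pdf theta s).
Proof.
apply: measurable_prod => i _.
apply: (measurableT_comp (measurable_normal_pdf _ _)).
exact: measurable_tnth.
Qed.

(** The predictive density p(y|x) is written [p x y]. *)
Definition predictive_density p : Prop :=
  [/\ measurable_fun [set: 'R^[R]_n * 'R^[R]_n] (fun xy => p xy.1 xy.2),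
      forall x y, 0 <= p x y &
      forall x, (\int[leb]_y (p x y)%:E = 1)%E].

(** In [\bar R], [a / 0 = +oo] for [a > 0] and [lne +oo = +oo], so the loss is
    infinite when [q] vanishes on a set of positive measure. *)
Definition KL_loss (r : R) theta (q : 'R^[R]_n -> R) : \bar R :=
  (\int[leb]_y ((gauss_pdf theta r y)%:E
                * lne ((gauss_pdf theta r y)%:E / (q y)%:E)))%E.

Definition risk (r : R) theta p : \bar R :=
  (\int[leb]_x (KL_loss r theta (p x) * (gauss_pdf theta 1 x)%:E))%E.

Definition max_risk (r : R) (Theta : set 'R^[R]_n) p : \bar R :=
  ereal_sup [set risk r theta p | theta in Theta].

Definition minimax_risk (r : R) (Theta : set 'R^[R]_n) : \bar R :=
  ereal_inf [set max_risk r Theta p | p in predictive_density].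

Definition l0norm theta : nat := #|[set i | tnth theta i != 0]%SET|.

Definition sparse (s : nat) : set 'R^[R]_n := [set theta | (l0norm theta <= s)%N].

Section posterior.
Variables (prior : {measure set 'R^[R]_n -> \bar R}) (x : 'R^[R]_n).

Definition joint_measure (A : set 'R^[R]_n) : \bar R :=
  (\int[prior]_(theta in A) (gauss_pdf theta 1 x)%:E)%E.

Let joint0 : joint_measure set0 = 0%E.
Proof. exact: integral_set0. Qed.

Let joint_ge0 A : (0 <= joint_measure A)%E.
Proof. by apply: integral_ge0 => t _; rewrite lee_fin gauss_pdf_ge0. Qed.

Let joint_sigma_additive : semi_sigma_additive joint_measure.
Proof.
move=> F mF tF mUF.
have mf : measurable_fun setT (EFin \o (fun t : 'R^[R]_n => gauss_pdf t 1 x)).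
  apply/measurable_EFinP.
  rewrite (_ : (fun t => _) = gauss_pdf x 1); first exact: measurable_gauss_pdf.
  by apply/funext => t; rewrite gauss_pdfC.
rewrite /joint_measure ge0_integral_bigcup//=; first last.
- by move=> t _; rewrite lee_fin gauss_pdf_ge0.
- exact: measurable_funTS.
by apply: is_cvg_ereal_nneg_natsum_cond => k _ _; exact: joint_ge0.
Qed.

HB.instance Definition _ := isMeasure.Build _ _ _ joint_measure
  joint0 joint_ge0 joint_sigma_additive.

(** For a nonzero finite prior the total mass of [joint_measure] is nonzero and
    finite, so the default value [\d_x] plays no role. *)
Definition posterior : probability 'R^[R]_n R := mnormalize joint_measure \d_x.

End posterior.

Definition bayes_density (r : R) (prior : {measure set 'R^[R]_n -> \bar R}) x y : R :=
  \int[posterior prior x]_theta gauss_pdf theta r y.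

End predictive_model.

Section bigrid.
Context {R : realType}.
Variables (r eta : R).

Definition vpar : R := (1 + r^-1)^-1.

Definition bpar : R := Num.min (4 * r * (1 + r) * (1 + 2 * r)^-1) 1.

Definition Kpar : nat := (1 + `|Num.ceil (2 * bpar `^ (- (3 / 2)))|)%N.

Definition lambda : R := Num.sqrt (2 * ln (eta `^ (- vpar))).

(** The indices of both grids are shifted to start at 0. *)
Definition nu_pt (k : nat) : R := lambda + k%:R * bpar * lambda.

Definition mu_pt (j : nat) : R := nu_pt Kpar.-1 + j.+1%:R * lambda.

Definition atom (w : R) (a : measurableTypeR R) : {measure set (measurableTypeR R) -> \bar R} :=
  mscale (NngNum (powR_ge0 eta w)) \d_a.

Definition grid_measure : {measure set (measurableTypeR R) -> \bar R} :=
  measure_add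
    (msum (fun k => atom (k%:R * vpar * bpar ^+ 2) (nu_pt k)) Kpar)
    (mscale (NngNum (powR_ge0 eta (Kpar.-1%:R * vpar * bpar ^+ 2)))
       (mseries (fun j => atom (j.+1%:R * vpar) (mu_pt j)) 0)).

(** For [0 < eta < 1] the total mass of [grid_measure] is nonzero and finite, so
    the default value [\d_0] plays no role. *)
Definition nuB : probability (measurableTypeR R) R :=
  mnormalize grid_measure \d_(0 : measurableTypeR R).

(** The prior is meant for [0 < eta < 1]; the [else] branch only makes it a
    probability measure for every [eta]. *)
Definition bigrid_prior (A : set (measurableTypeR R)) : \bar R :=
  if 0 <= eta <= 1 then
    ((1 - eta)%:E * \d_(0%R : measurableTypeR R) A
     + (eta / 2)%:E * (nuB A + nuB (-%R @^-1` A)))%E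
  else \d_(0%R : measurableTypeR R) A.

Let measurable_opp (A : set (measurableTypeR R)) :
  measurable A -> measurable (-%R @^-1` A : set (measurableTypeR R)).
Proof.
move=> mA; rewrite -[X in measurable X]setTI.
have mopp : measurable_fun [set: measurableTypeR R] (-%R : _ -> measurableTypeR R).
  exact: oppr_measurable.
exact: mopp.
Qed.

Let bigrid_prior0 : bigrid_prior set0 = 0%E.
Proof.
by rewrite /bigrid_prior preimage_set0 !measure0 adde0 !mule0 adde0; case: ifP.
Qed.

Let bigrid_prior_ge0 A : (0 <= bigrid_prior A)%E.
Proof.
rewrite /bigrid_prior; case: ifPn => // /andP[eta0 eta1].
by rewrite adde_ge0// mule_ge0// ?lee_fin ?subr_ge0 ?divr_ge0// adde_ge0.
Qed.

Let bigrid_prior_sigma_additive : semi_sigma_additive bigrid_prior.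
Proof.
rewrite /bigrid_prior; case: (0 <= eta <= 1) / andP => [[eta0 eta1]|_]; last first.
  exact: measure_semi_sigma_additive.
move=> F mF tF mUF.
have tF' : trivIset setT (fun n => (-%R @^-1` F n : set (measurableTypeR R))).
  apply/trivIsetP => i j _ _ ij; rewrite -preimage_setI.
  by move/trivIsetP : tF => /(_ _ _ Logic.I Logic.I ij) ->; rewrite preimage_set0.
have H1 := @measure_semi_sigma_additive _ _ _ nuB F mF tF mUF.
have H2 := @measure_semi_sigma_additive _ _ _ nuB _
  (fun n => measurable_opp (mF n)) tF'.
rewrite -preimage_bigcup in H2; have {}H2 := H2 (measurable_opp mUF).
rewrite (_ : (fun n => _) = (fun n =>
    (1 - eta)%:E * (\sum_(0 <= i < n) \d_(0%R : measurableTypeR R) (F i)) +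
    (eta / 2)%:E * ((\sum_(0 <= i < n) nuB (F i)) +
      (\sum_(0 <= i < n) nuB (-%R @^-1` F i))))%E); last first.
  apply/funext => n; rewrite big_split/= -!ge0_sume_distrr//=.
    by rewrite big_split.
  by move=> i _; exact: adde_ge0.
have nuBfin A : measurable A -> nuB A \is a fin_num by move=> ?; exact: fin_num_measure.
apply: cvgeD; first last.
- apply: cvgeZl => //; apply: cvgeD => //.
  by rewrite fin_num_adde_defr// nuBfin//; exact: measurable_opp.
- by apply: cvgeZl => //; exact: measure_semi_sigma_additive.
- by rewrite ge0_adde_def// inE ?mule_ge0 ?lee_fin ?subr_ge0 ?divr_ge0// adde_ge0.
Qed.

HB.instance Definition _ := isMeasure.Build _ _ _ bigrid_prior
  bigrid_prior0 bigrid_prior_ge0 bigrid_prior_sigma_additive.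

Let bigrid_prior_setT : bigrid_prior setT = 1%E.
Proof.
rewrite /bigrid_prior preimage_setT !probability_setT.
case: ifP => // _; rewrite mule1.
have -> : (1 + 1 = 2%:E :> \bar R)%E by [].
by rewrite -EFinM -EFinD divfK ?pnatr_eq0// subrK.
Qed.

HB.instance Definition _ :=
  Measure_isProbability.Build _ _ _ bigrid_prior bigrid_prior_setT.

End bigrid.

Definition bigrid_density {R : realType} (r eta : R) (n : nat) :
    'R^[R]_n -> 'R^[R]_n -> R :=
  bayes_density r (mpow (bigrid_prior r eta) n).

(* Main.v *)
Require Import Defs.
From mathcomp Require Import all_boot all_order all_algebra.
From mathcomp Require Import ring lra.
From mathcomp Require Import all_classical all_reals all_analysis.
From mathcomp Require Import measurable_realfun.

Set Implicit Arguments.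
Unset Strict Implicit.
Unset Printing Implicit Defensive.

Import Order.TTheory GRing.Theory Num.Theory.
Import numFieldNormedType.Exports.

Local Open Scope classical_set_scope.
Local Open Scope ring_scope.

(** Write [L = ln (1 / eta)], so that [lambda^2 = 2 v L]. Both sides equal
    [s (lambda^2 / (2 r) + O(lambda))], where [lambda^2 / (2 r) = L / (1 + r)].

    Upper bound. Under a product prior the log-likelihood ratio is a sum over
    the coordinates. At a null coordinate it is bounded by a nonnegative
    function with mean [eta / (1 - eta)]. At a spike [theta] the
    prior mixture of the joint density of (x, y) is bounded below by a single
    atom [a], and that of the density of x is bounded above by its dominating
    atom [us]. With [t = theta / lambda] and positions in units of lambda, this
    leaves the deterministic inequality
    [(1 + 1/r) (t - a)^2 - (t - us)^2 + cost a - cost us <= 1 / r] and errors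
    of order lambda.

    Lower bound. Split the coordinates into [s] blocks of size [m = n / s] and
    put one spike [tau = sqrt (2 v ln m)] uniformly in each block. For every
    estimator [p], Gibbs' inequality for the density [p(y|x) p_0(x)] against the
    mixture bounds the average risk below by [s tau^2 / (2 r)] minus the
    divergence of the mixture from the null, which is [O(s (tau + 1))] because
    the spikes are just undetectable from [(X, Y)].

    All error terms are nonnegative, so Tonelli's theorem suffices throughout. *)

(** * Integration against densities and product measures *)

(** The two spacings of the prior come from the deterministic inequality. From x alone, 0 keeps
    dominating the posterior on an interval to the right of lambda, although an atom there would
    already be preferred given both x and y. Where a grid point dominates, one may take [a = us];
    the left side collapses to [(t - a)^2 / r] and spacing 1 suffices. Where [us = 0] while [t > 1],
    this cancellation is lost and the spacing [b] is used; [K] is large enough for the inner grid to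
    cover that interval. The cost increments [b^2] and [1] are the squares of the spacings, which
    makes the best grid point the one just below t.

    In the lower bound the risk itself, possibly infinite, is never averaged. Only the nonnegative
    ratio of p(y|x) p_0(x) to the mixture is: its mean under the mixture is 1, so some placement of
    the spikes, depending on [p], has mean at most 1, and the other error bounds hold for every
    placement. *)

Lemma le_of_eq d (T : porderType d) (x y : T) : x = y -> (x <= y)%O.
Proof. by move=> ->. Qed.

Section integral_facts.
Context d (T : measurableType d) (R : realType).
Implicit Types (mu : {measure set T -> \bar R}) (f g : T -> \bar R).
Local Open Scope ereal_scope.
Import HBNNSimple.

(** The integral is a supremum over simple functions below the positive part minus the same for the
    negative part. Both suprema are monotone for arbitrary functions, and [+oo - +oo] is [-oo], so
    the bound applies to losses of varying sign with possibly infinite integral. *)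
Lemma le_integralT (mu : set T -> \bar R) f g :
  (forall x, f x <= g x) -> \int[mu]_x f x <= \int[mu]_x g x.
Proof.
move=> fg; rewrite /integral !patch_setT; apply: leeB; apply: le_ereal_sup.
- move=> _ [h /= hf <-]; exists h => // x; apply: (le_trans (hf x)).
  by rewrite !funeposE ge_max !le_max fg lexx orbT.
- move=> _ [h /= hf <-]; exists h => // x; apply: (le_trans (hf x)).
  by rewrite !funenegE ge_max !le_max leeN2 fg lexx orbT.
Qed.

(** Meant for the unnormalised posterior, whose density with respect to the prior is the likelihood.
    The hypothesis on [nu] is the case of indicators; linearity and monotone convergence do the
    rest. *)
Lemma ge0_integral_density mu (nu : {measure set T -> \bar R}) (w : T -> R) f :
    measurable_fun setT w -> (forall x, (0 <= w x)%R) ->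
    (forall A, measurable A -> nu A = \int[mu]_(x in A) (w x)%:E) ->
    measurable_fun setT f -> (forall x, 0 <= f x) ->
  \int[nu]_x f x = \int[mu]_x (f x * (w x)%:E).
Proof.
move=> mw w0 nuE mf f0; pose h := nnsfun_approx measurableT mf.
have mwE : measurable_fun setT (EFin \o w) by exact/measurable_EFinP.
have fE x : f x = limn (fun n => (h n x)%:E).
  by apply/esym/cvg_lim => //; exact: cvg_nnsfun_approx.
have nnE (g : {nnsfun T >-> R}) :
    \int[nu]_x (g x)%:E = \int[mu]_x ((g x)%:E * (w x)%:E).
  under [LHS]eq_integral do rewrite fimfunE -fsumEFin//.
  rewrite ge0_integral_fsum//; last 2 first.
  - by move=> r; exact/measurable_EFinP/measurableT_comp.
  - by move=> n x _; rewrite EFinM nnfun_muleindic_ge0.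
  under [RHS]eq_integral.
    move=> x _; rewrite fimfunE -fsumEFin// ge0_mule_fsuml; last first.
      by move=> r; rewrite EFinM nnfun_muleindic_ge0.
    over.
  rewrite [RHS]ge0_integral_fsum//; last 2 first.
  - move=> r; apply: emeasurable_funM => //.
    by apply/measurable_EFinP; apply/measurable_funM => //.
  - move=> n x _; apply: mule_ge0; last by rewrite lee_fin.
    by rewrite EFinM nnfun_muleindic_ge0.
  apply: eq_fsbigr => r _.
  have [r0|r0] := ltP r 0%R.
    rewrite !integral0_eq// => x _; rewrite preimage_nnfun0// ?indicE ?in_set0 ?mulr0 ?mul0e//.
  under [LHS]eq_integral do rewrite EFinM.
  rewrite ge0_integralZl//; last exact/measurable_EFinP.
  under [RHS]eq_integral do rewrite EFinM -muleA.
  rewrite [RHS]ge0_integralZl//; last 2 first.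
    by apply: emeasurable_funM => //; apply/measurable_EFinP.
    by move=> x _; rewrite mule_ge0 ?lee_fin.
  congr (_ * _); rewrite integral_indic// setIT nuE//.
  rewrite integral_mkcond; apply: eq_integral => x _.
  by rewrite patchE indicE; case: ifPn => _; rewrite ?mul1e ?mul0e.
rewrite [LHS](_ : _ = limn (fun n => \int[nu]_x (h n x)%:E)); last first.
  rewrite -monotone_convergence//.
  - by apply: eq_integral.
  - by move=> n; exact/measurable_EFinP.
  - by move=> n x _; rewrite lee_fin.
  - by move=> x _ a b ab; rewrite lee_fin; exact/lefP/nd_nnsfun_approx.
rewrite [RHS](_ : _ = limn (fun n => \int[mu]_x ((h n x)%:E * (w x)%:E))).
  by congr (limn _); apply/funext => n; exact: nnE.
rewrite -monotone_convergence//.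
- apply: eq_integral => x _.
  apply/esym/cvg_lim => //; apply: cvgeZr => //.
  exact: cvg_nnsfun_approx.
- by move=> n; apply: emeasurable_funM => //; exact/measurable_EFinP.
- by move=> n x _; rewrite mule_ge0 ?lee_fin.
- move=> x _ a b ab; rewrite lee_wpmul2r ?lee_fin//.
  exact/lefP/nd_nnsfun_approx.
Qed.

Lemma ge0_integral_mnormalize mu (P : probability T R) f :
    0 < mu setT < +oo -> measurable_fun setT f -> (forall x, 0 <= f x) ->
  \int[mnormalize mu P]_x f x = (fine (mu setT))^-1%:E * \int[mu]_x f x.
Proof.
move=> /andP[mu0 muoo] mf f0.
have c0 : (0 <= (fine (mu setT))^-1)%R by rewrite invr_ge0 fine_ge0.
rewrite -(ge0_integral_mscale _ measurableT (NngNum c0))//.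
apply: eq_measure_integral => A _ _.
by rewrite /= /mnormalize/= gt_eqF//= lt_eqF//= /mscale/= muleC.
Qed.

(* When [f] is not integrable the left-hand side is [-oo], so the bound applies
   to the possibly infinite losses of an arbitrary estimator. *)
Lemma integral_density_cstB mu (w : T -> R) (c : R) f :
    measurable_fun setT w -> (forall x, (0 <= w x)%R) ->
    \int[mu]_x (w x)%:E = 1 ->
    (0 <= c)%R ->
    measurable_fun setT f -> (forall x, 0 <= f x) ->
  c%:E - \int[mu]_x (f x * (w x)%:E) <= \int[mu]_x ((c%:E - f x) * (w x)%:E).
Proof.
move=> mw w0 w1 c0 mf f0.
have mwE : measurable_fun setT (EFin \o w) by exact/measurable_EFinP.
have [->|foo] := eqVneq (\int[mu]_x (f x * (w x)%:E)) +oo.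
  by rewrite /= leNye.
have fw0 x : 0 <= f x * (w x)%:E by rewrite mule_ge0 ?lee_fin.
have mfw : measurable_fun setT (fun x => f x * (w x)%:E) by exact: emeasurable_funM.
have ifw : mu.-integrable setT (fun x => f x * (w x)%:E).
  apply/integrableP; split => //.
  under eq_integral do rewrite gee0_abs//.
  by rewrite ltey.
have iw : mu.-integrable setT (EFin \o w).
  apply/integrableP; split => //.
  under eq_integral do rewrite gee0_abs//= ?lee_fin//.
  by rewrite w1 ltry.
have icw : mu.-integrable setT (fun x => c%:E * (w x)%:E).
  exact: integrableZl.
rewrite [leRHS](_ : _ = \int[mu]_x (c%:E * (w x)%:E - f x * (w x)%:E)); last first.
  by apply: eq_integral => x _; rewrite muleBl//.
by rewrite integralB// integralZl// w1 mule1.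
Qed.

End integral_facts.

Section mpow_facts.
Context d (T : measurableType d) (R : realType).
Variable mu : {sigma_finite_measure set T -> \bar R}.
Local Open Scope ereal_scope.

Lemma ge0_integral_mpowS n (f : n.+1.-tuple T -> \bar R) :
    measurable_fun setT f -> (forall t, 0 <= f t) ->
  \int[mpow mu n.+1]_t f t = \int[mu]_a \int[mpow mu n]_t f [tuple of a :: t].
Proof.
move=> mf f0.
have mc : measurable_fun [set: T * n.-tuple T]
    (fun p => [tuple of p.1 :: p.2]) by exact: measurable_cons.
rewrite /= /cons_measure.
rewrite (ge0_integral_pushforward mc)//= preimage_setT.
by rewrite fubini_tonelli1//; exact: measurableT_comp.
Qed.

Lemma measurable_eprod n (F : 'I_n -> T -> \bar R) :
    (forall i, measurable_fun setT (F i)) ->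
  measurable_fun setT (fun t : n.-tuple T => \prod_(i < n) F i (tnth t i)).
Proof.
elim: n F => [|n IH] F mF.
  rewrite (_ : (fun _ => _) = cst 1)//.
  by apply/funext => t; rewrite big_ord0.
rewrite (_ : (fun _ => _) = (fun t : n.+1.-tuple T => F ord0 (tnth t ord0) *
   (\prod_(i < n) F (lift ord0 i) (tnth [tuple of behead t] i)))); last first.
  apply/funext => t; rewrite big_ord_recl; congr (_ * _).
  by apply: eq_bigr => i _; rewrite [in LHS](tuple_eta t) tnthS.
apply: emeasurable_funM; first by apply: measurableT_comp => //; exact: measurable_tnth.
apply: (measurableT_comp (IH (fun i => F (lift ord0 i)) _)) => //.
exact: measurable_behead.
Qed.

Lemma ge0_integral_mpow_prod n (F : 'I_n -> T -> \bar R) :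
    (forall i, measurable_fun setT (F i)) -> (forall i x, 0 <= F i x) ->
  \int[mpow mu n]_t \prod_(i < n) F i (tnth t i) = \prod_(i < n) \int[mu]_x F i x.
Proof.
elim: n F => [|n IH] F mF F0.
  rewrite big_ord0 /=; under eq_integral do rewrite big_ord0.
  by rewrite integral_dirac// mule1 diracT.
rewrite ge0_integral_mpowS//; [|exact: measurable_eprod|by move=> t; apply: prode_ge0].
rewrite big_ord_recl -(IH (fun i => F (lift ord0 i)))//.
have mP : measurable_fun setT (fun t : n.-tuple T => \prod_(i < n) F (lift ord0 i) (tnth t i)).
  exact: (measurable_eprod (F := fun i => F (lift ord0 i))).
under eq_integral => a _.
  under eq_integral => t _.
    rewrite big_ord_recl tnth0.
    under eq_bigr do rewrite tnthS.
    over.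
  rewrite ge0_integralZl//; last by move=> t _; apply: prode_ge0.
  over.
by rewrite ge0_integralZr//; apply: integral_ge0 => t _; apply: prode_ge0.
Qed.

End mpow_facts.

Lemma ln_prod {R : realType} (I : Type) (t : seq I) (f : I -> R) :
  (forall i, 0 < f i) -> ln (\prod_(i <- t) f i) = \sum_(i <- t) ln (f i).
Proof.
move=> f0; elim: t => [|a t IH]; first by rewrite !big_nil ln1.
by rewrite !big_cons lnM ?posrE ?prodr_gt0// IH.
Qed.

(** * Gaussian densities: positivity, measurability, integrals *)

Section gaussian_facts.
Context {R : realType}.
Implicit Types (m s x : R).

Lemma normal_pdf_gt0 m s x : s != 0 -> 0 < normal_pdf m s x.
Proof. by move=> s0; rewrite normal_pdfE// mulr_gt0 ?expR_gt0// normal_peak_gt0. Qed.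

Lemma normal_pdf_shift m s x : s != 0 -> normal_pdf m s x = normal_pdf 0 s (x - m).
Proof. by move=> s0; rewrite !normal_pdfE//= /normal_fun subr0. Qed.

Lemma measurable_normal_pdf_mean s x : s != 0 ->
  measurable_fun setT (fun m : R => normal_pdf m s x).
Proof.
move=> s0; rewrite (_ : (fun m => _) = normal_pdf x s); first exact: measurable_normal_pdf.
by apply/funext => m; rewrite normal_pdfC.
Qed.

Lemma measurable_normal_pdf2 s d (T : measurableType d) (f g : T -> R) : s != 0 ->
  measurable_fun setT f -> measurable_fun setT g ->
  measurable_fun setT (fun t => normal_pdf (f t) s (g t)).
Proof.
move=> s0 mf mg.
rewrite (_ : (fun t => _) = normal_pdf 0 s \o (g \- f)); last first.
  by apply/funext => t /=; rewrite normal_pdf_shift.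
apply: measurableT_comp; first exact: measurable_normal_pdf.
exact: measurable_funB.
Qed.

(** On positive reals the inverse is [exp (- ln t)], a composition of measurable functions. *)
Lemma measurable_fun_invr_gt0 d (T : measurableType d) (f : T -> R) :
  (forall t, 0 < f t) -> measurable_fun setT f ->
  measurable_fun setT (fun t => (f t)^-1).
Proof.
move=> f0 mf; rewrite (_ : (fun t => _) = expR \o (-%R \o (@ln R \o f))).
  apply: measurableT_comp; first exact: measurable_expR.
  apply: measurableT_comp; first exact: oppr_measurable.
  by apply: measurableT_comp => //; exact: measurable_ln.
by apply/funext => t /=; rewrite -lnV ?lnK ?posrE ?invr_gt0.
Qed.

Section multivariate.
Variable n : nat.
Implicit Types (theta y : 'R^[R]_n).

Lemma gauss_pdf_gt0 theta s y : 0 < s -> 0 < gauss_pdf theta s y.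
Proof. by move=> s0; apply: prodr_gt0 => i _; rewrite normal_pdf_gt0// gt_eqF// sqrtr_gt0. Qed.

Local Open Scope ereal_scope.

Lemma integral_gauss_pdf_coord theta s (j : 'I_n) (h : R -> \bar R) :
    measurable_fun setT h -> (forall x, 0 <= h x) ->
  \int[leb]_y (h (tnth y j) * (gauss_pdf theta s y)%:E) =
  \int[lebesgue_measure]_x (h x * (normal_pdf (tnth theta j) (Num.sqrt s) x)%:E).
Proof.
move=> mh h0.
pose F i x := (if i == j then h x else 1) * (normal_pdf (tnth theta i) (Num.sqrt s) x)%:E.
have mF i : measurable_fun setT (F i).
  apply: emeasurable_funM; first by case: (i == j).
  by apply/measurable_EFinP; exact: measurable_normal_pdf.
have F0 i x : 0 <= F i x.
  by apply: mule_ge0; [case: ifP|rewrite lee_fin normal_pdf_ge0].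
rewrite [LHS](_ : _ = \int[leb]_y \prod_(i < n) F i (tnth y i)); last first.
  apply: eq_integral => y _; rewrite big_split/= prodEFin; congr (_ * _).
  by rewrite -big_mkcond/= big_pred1_eq.
rewrite ge0_integral_mpow_prod// (bigD1 j)//= /F eqxx big1 ?mule1// => i ij.
rewrite (negbTE ij); under eq_integral do rewrite mul1e.
exact: integral_normal_pdf.
Qed.

Lemma integral_gauss_pdf theta s : \int[leb]_y (gauss_pdf theta s y)%:E = 1.
Proof.
pose F i x := (normal_pdf (tnth theta i) (Num.sqrt s) x)%:E.
rewrite [LHS](_ : _ = \int[leb]_y \prod_(i < n) F i (tnth y i)); last first.
  by apply: eq_integral => y _; rewrite -prodEFin.
rewrite ge0_integral_mpow_prod//=.
- by rewrite big1// => i _; exact: integral_normal_pdf.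
- by move=> i; apply/measurable_EFinP; exact: measurable_normal_pdf.
- by move=> i x; rewrite lee_fin normal_pdf_ge0.
Qed.

End multivariate.
End gaussian_facts.

(** * Expectations over (x, y) and bounds for the risk *)

Section expectation.
Context {R : realType}.
Variables (n : nat) (r : R).
Implicit Types (theta x y : 'R^[R]_n) (p : 'R^[R]_n -> 'R^[R]_n -> R).
Implicit Types F G : 'R^[R]_n -> 'R^[R]_n -> \bar R.
Local Open Scope ereal_scope.

(** The nesting and the weights copy [risk], so that pointwise bounds on the log ratio carry over by
    monotonicity alone. *)
Definition expect2 theta F : \bar R :=
  \int[leb]_x ((\int[leb]_y (F x y * (gauss_pdf theta r y)%:E)) * (gauss_pdf theta 1 x)%:E).

Let jointly_measurable F :=
  measurable_fun [set: 'R^[R]_n * 'R^[R]_n] (fun xy => F xy.1 xy.2).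

Let mF1 F x : jointly_measurable F -> measurable_fun setT (F x).
Proof.
by move=> mF; exact: (measurableT_comp mF (measurable_pair1 x)).
Qed.

Let mg theta s : measurable_fun setT (EFin \o gauss_pdf theta s).
Proof. by apply/measurable_EFinP; exact: measurable_gauss_pdf. Qed.

Let g0 theta s y : 0 <= (gauss_pdf theta s y)%:E.
Proof. by rewrite lee_fin gauss_pdf_ge0. Qed.

Lemma measurable_inner theta F : (forall x y, 0 <= F x y) -> jointly_measurable F ->
  measurable_fun setT (fun x => \int[leb]_y (F x y * (gauss_pdf theta r y)%:E)).
Proof.
move=> F0 mF.
apply: (measurable_fun_fubini_tonelli_F
  (fun xy => F xy.1 xy.2 * (gauss_pdf theta r xy.2)%:E)).
- apply: emeasurable_funM => //.
  exact: (measurableT_comp (mg theta r) measurable_snd).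
- by move=> xy; exact: mule_ge0.
Qed.

Let inner0 theta F x : (forall x y, 0 <= F x y) ->
  0 <= \int[leb]_y (F x y * (gauss_pdf theta r y)%:E).
Proof. by move=> F0; apply: integral_ge0 => y _; exact: mule_ge0. Qed.

Lemma expect2_ge0 theta F : (forall x y, 0 <= F x y) -> 0 <= expect2 theta F.
Proof.
by move=> F0; apply: integral_ge0 => x _; apply: mule_ge0 => //; exact: inner0.
Qed.

Lemma expect2_sum theta (I : Type) (s : seq I) (P : pred I)
    (F : I -> 'R^[R]_n -> 'R^[R]_n -> \bar R) :
    (forall i x y, 0 <= F i x y) -> (forall i, jointly_measurable (F i)) ->
  expect2 theta (fun x y => \sum_(i <- s | P i) F i x y) =
  \sum_(i <- s | P i) expect2 theta (F i).
Proof.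
move=> F0 mF; rewrite !(big_mkcond P)/=.
pose F' i x y := if P i then F i x y else 0.
have F'0 i x y : 0 <= F' i x y by rewrite /F'; case: ifP.
have mF' i : jointly_measurable (F' i).
  by rewrite /jointly_measurable /F'; case: (P i) => //; exact: mF.
transitivity (\sum_(i <- s) expect2 theta (F' i)); last first.
  apply: eq_bigr => i _; rewrite /F' /expect2; case: (P i) => //.
  rewrite integral0_eq// => x _; rewrite integral0_eq ?mul0e// => y _.
  by rewrite mul0e.
rewrite /expect2 -ge0_integral_sum//; last 2 first.
- move=> i; apply: emeasurable_funM; last exact: mg.
  exact: (measurable_inner _ (F'0 i) (mF' i)).
- by move=> i x _; apply: mule_ge0 => //; exact: inner0.
apply: eq_integral => x _; rewrite -ge0_sume_distrl; last by move=> i _; exact: inner0.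
congr (_ * _); rewrite -ge0_integral_sum//; last 2 first.
- by move=> i; apply: emeasurable_funM; [exact: mF1 _ (mF' i)|exact: mg].
- by move=> i y _; exact: mule_ge0.
apply: eq_integral => y _; rewrite -ge0_sume_distrl//.
by rewrite big_mkcond.
Qed.

Lemma expect2D theta F G :
    (forall x y, 0 <= F x y) -> (forall x y, 0 <= G x y) ->
    jointly_measurable F -> jointly_measurable G ->
  expect2 theta (fun x y => F x y + G x y) = expect2 theta F + expect2 theta G.
Proof.
move=> F0 G0 mF mG.
have := @expect2_sum theta bool [:: true; false] xpredT (fun b => if b then F else G).
rewrite !big_cons !big_nil !adde0 => <-; last 2 first.
- by case.
- by case.
by congr (expect2 _ _); apply/funext => x; apply/funext => y; rewrite !big_cons big_nil adde0.
Qed.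

Lemma expect2_coord theta (j : 'I_n) (h : R -> R -> \bar R) :
    (forall a b, 0 <= h a b) -> measurable_fun setT (fun ab => h ab.1 ab.2) ->
  expect2 theta (fun x y => h (tnth x j) (tnth y j)) =
  \int[lebesgue_measure]_a ((\int[lebesgue_measure]_b
    (h a b * (normal_pdf (tnth theta j) (Num.sqrt r) b)%:E)) *
     (normal_pdf (tnth theta j) 1 a)%:E).
Proof.
move=> h0 mh.
pose H a := \int[lebesgue_measure]_b
  (h a b * (normal_pdf (tnth theta j) (Num.sqrt r) b)%:E).
have H0 a : 0 <= H a.
  by apply: integral_ge0 => b _; rewrite mule_ge0// lee_fin normal_pdf_ge0.
have mH : measurable_fun setT H.
  apply: (@measurable_fun_fubini_tonelli_F _ _ (measurableTypeR R)
    (measurableTypeR R) R (@lebesgue_measure R)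
    (fun ab => h ab.1 ab.2 * (normal_pdf (tnth theta j) (Num.sqrt r) ab.2)%:E)).
    apply: emeasurable_funM; first exact: mh.
    apply/measurable_EFinP.
    exact: (measurableT_comp (measurable_normal_pdf _ _) measurable_snd).
  by move=> ab; rewrite mule_ge0// lee_fin normal_pdf_ge0.
transitivity (\int[leb]_x (H (tnth x j) * (gauss_pdf theta 1 x)%:E)).
  apply: eq_integral => x _; congr (_ * _).
  apply: (integral_gauss_pdf_coord theta r j (h := h (tnth x j))).
    exact: (measurableT_comp mh (measurable_pair1 (tnth x j))).
  exact: h0.
by rewrite (integral_gauss_pdf_coord theta 1 j mH H0) sqrtr1.
Qed.

Lemma risk_le theta p F :
    (forall x y, lne ((gauss_pdf theta r y)%:E / (p x y)%:E) <= F x y) ->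
  risk r theta p <= expect2 theta F.
Proof.
move=> pF; apply: le_integralT => x; apply: lee_wpmul2r => //.
by apply: le_integralT => y; rewrite muleC; apply: lee_wpmul2r.
Qed.

(** The bound on the log ratio is a constant minus a nonnegative [F] whose mean may be infinite;
    [integral_density_cstB] handles the subtraction, once for y and once for x. *)
Lemma risk_ge theta p (c : R) F : (0 <= c)%R ->
    (forall x y, 0 <= F x y) -> jointly_measurable F ->
    (forall x y, c%:E - F x y <= lne ((gauss_pdf theta r y)%:E / (p x y)%:E)) ->
  c%:E - expect2 theta F <= risk r theta p.
Proof.
move=> c0 F0 mF pF; apply: le_trans (le_integralT _ _).
  apply: (integral_density_cstB (w := gauss_pdf theta 1) (c := c)
    (f := fun x => \int[leb]_y (F x y * (gauss_pdf theta r y)%:E))) => //.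
  - exact: measurable_gauss_pdf.
  - exact: gauss_pdf_ge0.
  - exact: integral_gauss_pdf.
  - exact: measurable_inner.
  - by move=> x; exact: inner0.
move=> x /=; apply: lee_wpmul2r => //; apply: le_trans (le_integralT _ _).
  apply: (integral_density_cstB (w := gauss_pdf theta r) (c := c) (f := F x)) => //.
  - exact: measurable_gauss_pdf.
  - exact: gauss_pdf_ge0.
  - exact: integral_gauss_pdf.
  - exact: mF1.
by move=> y /=; rewrite [leRHS]muleC; exact: lee_wpmul2r.
Qed.

End expectation.

(** * Bayes predictive densities of product priors *)

Section product_prior.
Context {R : realType}.
Variables (P : {sigma_finite_measure set (measurableTypeR R) -> \bar R}) (r : R).
Local Open Scope ereal_scope.

(** The density of one coordinate of X under the prior; [marginal2] is the joint one of X and Y, and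
    the Bayes predictive density is built from their quotients. *)
Definition marginal1 (a : R) : \bar R := \int[P]_u (normal_pdf u 1 a)%:E.

Definition marginal2 (a b : R) : \bar R :=
  \int[P]_u (normal_pdf u (Num.sqrt r) b * normal_pdf u 1 a)%:E.

Hypothesis r_gt0 : (0 < r)%R.
Hypothesis P1 : P setT = 1.
Hypothesis marginal2_gt0 : forall a b, 0 < marginal2 a b.

Let sr0 : Num.sqrt r != 0%R. Proof. by rewrite gt_eqF// sqrtr_gt0. Qed.
Let one0 : (1%R : R) != 0%R. Proof. exact: oner_neq0. Qed.

Let mN (s a : R) : s != 0%R -> measurable_fun [set: measurableTypeR R]
  (fun u => normal_pdf u s a).
Proof. exact: measurable_normal_pdf_mean. Qed.

Let marginal1_le a : marginal1 a <= (normal_peak 1)%:E.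
Proof.
rewrite /marginal1 (_ : _%:E = \int[P]_u (cst (normal_peak 1)%:E u)); last first.
  by rewrite integral_cst// [X in _ * X]P1 mule1.
apply: ge0_le_integral => //.
- by move=> u _; rewrite lee_fin normal_pdf_ge0.
- by apply/measurable_EFinP; exact: mN.
- by move=> u _; rewrite lee_fin normal_pdf_ub.
Qed.

Let marginal1_ge0 a : 0 <= marginal1 a.
Proof. by apply: integral_ge0 => u _; rewrite lee_fin normal_pdf_ge0. Qed.

(** The density of y is at most its peak. This yields both the finiteness of [marginal2] and the
    positivity of [marginal1]. *)
Let marginal2_le a b : marginal2 a b <= (normal_peak (Num.sqrt r))%:E * marginal1 a.
Proof.
rewrite /marginal1 /marginal2 -ge0_integralZl//.
- apply: ge0_le_integral => //.
  + by move=> u _; rewrite lee_fin mulr_ge0// normal_pdf_ge0.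
  + by apply/measurable_EFinP; apply: measurable_funM; exact: mN.
  + by apply: measurable_funeM; apply/measurable_EFinP; exact: mN.
  + by move=> u _; rewrite lee_fin ler_wpM2r// ?normal_pdf_ge0// normal_pdf_ub.
- by apply/measurable_EFinP; exact: mN.
- by move=> u _; rewrite lee_fin normal_pdf_ge0.
- by rewrite lee_fin normal_peak_ge0.
Qed.

Lemma marginal1_fin a : marginal1 a \is a fin_num.
Proof. by rewrite ge0_fin_numE// (le_lt_trans (marginal1_le a))// ltry. Qed.

Lemma marginal1_gt0 a : 0 < marginal1 a.
Proof.
rewrite lt_neqAle marginal1_ge0 andbT eq_sym; apply/negP => /eqP m0.
by have := lt_le_trans (marginal2_gt0 a 0) (marginal2_le a 0); rewrite m0 mule0 ltxx.
Qed.

Lemma marginal2_fin a b : marginal2 a b \is a fin_num.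
Proof.
rewrite ge0_fin_numE ?ltW// (le_lt_trans (marginal2_le a b))//.
by rewrite -(fineK (marginal1_fin a)) -EFinM ltry.
Qed.

Let mN2 s (d : measure_display) (T : measurableType d) (f : T -> R) : s != 0%R ->
  measurable_fun setT f ->
  measurable_fun [set: T * measurableTypeR R] (fun p => normal_pdf p.2 s (f p.1)).
Proof.
move=> s0 mf; apply: measurable_normal_pdf2 => //.
exact: (measurableT_comp mf measurable_fst).
Qed.

Lemma measurable_marginal1 : measurable_fun [set: measurableTypeR R] marginal1.
Proof.
apply: (measurable_fun_fubini_tonelli_F (m2 := P)
   (fun p : measurableTypeR R * measurableTypeR R => (normal_pdf p.2 1 p.1)%:E)).
- by apply/measurable_EFinP; exact: (mN2 (f := id)).
- by move=> p; rewrite lee_fin normal_pdf_ge0.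
Qed.

Lemma measurable_marginal2 :
  measurable_fun [set: measurableTypeR R * measurableTypeR R]
    (fun ab => marginal2 ab.1 ab.2).
Proof.
apply: (measurable_fun_fubini_tonelli_F (m2 := P)
   (fun p : (measurableTypeR R * measurableTypeR R) * measurableTypeR R =>
      (normal_pdf p.2 (Num.sqrt r) p.1.2 * normal_pdf p.2 1 p.1.1)%:E)).
- apply/measurable_EFinP; apply: measurable_funM.
    exact: (mN2 (f := snd)).
  exact: (mN2 (f := fst)).
- by move=> p; rewrite lee_fin mulr_ge0// normal_pdf_ge0.
Qed.

Lemma integral_marginal2 a :
  \int[lebesgue_measure]_b marginal2 a b = marginal1 a.
Proof.
have := @fubini_tonelli _ _ (measurableTypeR R) (measurableTypeR R) R
  (@lebesgue_measure R) P
  (fun p => (normal_pdf p.2 (Num.sqrt r) p.1 * normal_pdf p.2 1 a)%:E).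
move=> -> /=; last 2 first.
- apply/measurable_EFinP; apply: measurable_funM.
    exact: (mN2 (f := id)).
  exact: (measurableT_comp (mN a one0) measurable_snd).
- by move=> p; rewrite lee_fin mulr_ge0// normal_pdf_ge0.
apply: eq_integral => u _; under eq_integral do rewrite EFinM.
rewrite ge0_integralZr//.
- by rewrite integral_normal_pdf mul1e.
- by apply/measurable_EFinP; exact: measurable_normal_pdf.
- by move=> b _; rewrite lee_fin normal_pdf_ge0.
- by rewrite lee_fin normal_pdf_ge0.
Qed.

Section density.
Variable n : nat.
Implicit Types x y theta : 'R^[R]_n.

Let mgauss s x : (0 < s)%R ->
  measurable_fun setT (fun theta => gauss_pdf theta s x).
Proof.
move=> s0; rewrite (_ : (fun _ => _) = gauss_pdf x s); first exact: measurable_gauss_pdf.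
by apply/funext => t; rewrite gauss_pdfC.
Qed.

(** Prior and likelihood are products, so the numerator and the normalising mass of the posterior
    factor by Tonelli. The mass is positive and finite, hence [mnormalize] does not fall back on its
    default measure. *)
Lemma bayes_density_prod x y :
  bayes_density r (mpow P n) x y =
  (\prod_(i < n) (fine (marginal2 (tnth x i) (tnth y i)) / fine (marginal1 (tnth x i))))%R.
Proof.
have massE : joint_measure (mpow P n) x setT = (\prod_(i < n) fine (marginal1 (tnth x i)))%:E.
  rewrite /joint_measure -prodEFin.
  pose F i u := (normal_pdf u 1 (tnth x i))%:E.
  rewrite [LHS](_ : _ = \int[mpow P n]_t \prod_(i < n) F i (tnth t i)); last first.
    by apply: eq_integral => t _; rewrite /gauss_pdf sqrtr1 -prodEFin.
  rewrite ge0_integral_mpow_prod.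
  - by apply: eq_bigr => i _; rewrite fineK// marginal1_fin.
  - by move=> i; apply/measurable_EFinP; exact: mN.
  - by move=> i u; rewrite lee_fin normal_pdf_ge0.
have mass0 : (0 < \prod_(i < n) fine (marginal1 (tnth x i)))%R.
  by apply: prodr_gt0 => i _; rewrite fine_gt0// marginal1_gt0 ltey_eq marginal1_fin.
rewrite /bayes_density /Rintegral /posterior.
rewrite ge0_integral_mnormalize/=; last 3 first.
- by rewrite massE ltry lte_fin mass0.
- by apply/measurable_EFinP; exact: mgauss.
- by move=> t; rewrite lee_fin gauss_pdf_ge0.
rewrite massE/= (ge0_integral_density (mu := mpow P n) (w := fun t => gauss_pdf t 1 x))//; last 4 first.
- exact: mgauss.
- by move=> t; exact: gauss_pdf_ge0.
- by apply/measurable_EFinP; exact: mgauss.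
- by move=> t; rewrite lee_fin gauss_pdf_ge0.
pose F i u := (normal_pdf u (Num.sqrt r) (tnth y i) * normal_pdf u 1 (tnth x i))%:E.
rewrite (_ : \int[_]_t _ = \int[mpow P n]_t \prod_(i < n) F i (tnth t i)); last first.
  by apply: eq_integral => t _; rewrite /gauss_pdf sqrtr1 -EFinM -big_split -prodEFin.
rewrite ge0_integral_mpow_prod.
- rewrite (_ : \prod_(i < n) _ =
      (\prod_(i < n) fine (marginal2 (tnth x i) (tnth y i)))%:E).
    by rewrite /= mulrC prodf_div.
  rewrite -prodEFin; apply: eq_bigr => i _; rewrite fineK//.
  exact: marginal2_fin.
- move=> i; apply/measurable_EFinP; apply: measurable_funM; exact: mN.
- by move=> i u; rewrite lee_fin mulr_ge0// normal_pdf_ge0.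
Qed.

Lemma bayes_density_predictive : predictive_density (bayes_density r (mpow P n)).
Proof.
have fine2 a b : (0 < fine (marginal2 a b))%R.
  by rewrite fine_gt0// marginal2_gt0 ltey_eq marginal2_fin.
have fine1 a : (0 < fine (marginal1 a))%R.
  by rewrite fine_gt0// marginal1_gt0 ltey_eq marginal1_fin.
split.
- rewrite (_ : (fun _ => _) = (fun xy => \prod_(i < n)
   (fine (marginal2 (tnth xy.1 i) (tnth xy.2 i)) / fine (marginal1 (tnth xy.1 i))))%R); last first.
    by apply/funext => xy; rewrite bayes_density_prod.
  apply: measurable_prod => i _.
  have m1 : measurable_fun [set: 'R^[R]_n * 'R^[R]_n] (fun xy => tnth xy.1 i).
    exact: (measurableT_comp (measurable_tnth i) measurable_fst).
  have m2 : measurable_fun [set: 'R^[R]_n * 'R^[R]_n] (fun xy => tnth xy.2 i).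
    exact: (measurableT_comp (measurable_tnth i) measurable_snd).
  apply: measurable_funM.
    apply: (measurableT_comp (fine_measurable measurableT)).
    exact: (measurableT_comp measurable_marginal2 (measurable_fun_pair m1 m2)).
  apply: measurable_fun_invr_gt0 => //.
  apply: (measurableT_comp (fine_measurable measurableT)).
  exact: (measurableT_comp measurable_marginal1 m1).
- move=> x y; rewrite bayes_density_prod; apply: prodr_ge0 => i _.
  by rewrite divr_ge0 ?ltW.
- move=> x.
  pose F i b := marginal2 (tnth x i) b * ((fine (marginal1 (tnth x i)))^-1)%:E.
  rewrite [LHS](_ : _ = \int[leb]_y \prod_(i < n) F i (tnth y i)); last first.
    apply: eq_integral => y _; rewrite bayes_density_prod -prodEFin.
    by apply: eq_bigr => i _; rewrite /F EFinM fineK// marginal2_fin.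
  have mm i : measurable_fun [set: measurableTypeR R] (marginal2 (tnth x i)).
    exact: (measurableT_comp measurable_marginal2 (measurable_pair1 (tnth x i))).
  rewrite ge0_integral_mpow_prod.
  + rewrite big1// => i _; rewrite ge0_integralZr//=.
    * rewrite integral_marginal2 -{1}(fineK (marginal1_fin (tnth x i))).
      by rewrite -EFinM divff// gt_eqF.
    * by move=> b _; rewrite ltW.
    * by rewrite lee_fin invr_ge0 ltW.
  + by move=> i; apply: emeasurable_funM => //; exact: measurable_cst.
  + by move=> i b; rewrite mule_ge0 ?lee_fin ?invr_ge0 ?ltW.
Qed.

(** The predictive density is positive, so the extended logarithm is a real one and splits into a
    sum over the coordinates. *)
Lemma lne_bayes_density_le theta x y (g : 'I_n -> R) :
    (forall i, ln (normal_pdf (tnth theta i) (Num.sqrt r) (tnth y i) *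
       fine (marginal1 (tnth x i)) / fine (marginal2 (tnth x i) (tnth y i))) <= g i)%R ->
  lne ((gauss_pdf theta r y)%:E / (bayes_density r (mpow P n) x y)%:E) <=
  \sum_(i < n) (g i)%:E.
Proof.
move=> hg.
have fine2 a b : (0 < fine (marginal2 a b))%R.
  by rewrite fine_gt0// marginal2_gt0 ltey_eq marginal2_fin.
have fine1 a : (0 < fine (marginal1 a))%R.
  by rewrite fine_gt0// marginal1_gt0 ltey_eq marginal1_fin.
have b0 : (0 < bayes_density r (mpow P n) x y)%R.
  by rewrite bayes_density_prod; apply: prodr_gt0 => i _; rewrite divr_gt0.
rewrite inver gt_eqF// -EFinM lne_EFin ?divr_gt0 ?gauss_pdf_gt0//.
rewrite sumEFin lee_fin bayes_density_prod /gauss_pdf.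
rewrite -prodfV -big_split/=.
rewrite (_ : ln _ = \sum_(i < n) ln (normal_pdf (tnth theta i) (Num.sqrt r) (tnth y i) *
       fine (marginal1 (tnth x i)) / fine (marginal2 (tnth x i) (tnth y i))))%R.
  by apply: ler_sum => i _.
rewrite ln_prod.
  by apply: eq_bigr => i _; rewrite invf_div mulrA.
by move=> i; rewrite mulr_gt0 ?invr_gt0 ?divr_gt0// normal_pdf_gt0.
Qed.

End density.
End product_prior.

(** * The grid in units of lambda *)

Lemma sum_geometric_dist (R : realFieldType) (m N : nat) :
  \sum_(j < N) (2^-1) ^+ ((j - m) + (m - j)) <= 3 :> R.
Proof.
have h n : 0 <= (2^-1 : R) ^+ n by rewrite exprn_ge0.
have hS n : (2^-1 : R) ^+ n.+1 = (2^-1) ^+ n / 2 by rewrite exprSr.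
(* In [nat] the sum of the two truncated differences is the distance from [j] to [m]. These bounds
   are sharp enough for induction: terms double up to [m] and halve afterwards, and both bounds
   equal 1 at [N = m]. *)
suff [H1 H2] : ((N <= m)%N -> \sum_(j < N) (2^-1 : R) ^+ ((j - m) + (m - j)) <= (2^-1) ^+ (m - N)) /\
    ((m <= N)%N -> \sum_(j < N) (2^-1 : R) ^+ ((j - m) + (m - j)) <= 3 - 2 * (2^-1) ^+ (N - m)).
  have [/H1|/ltnW/H2] := leqP N m; move=> /le_trans; apply.
    by rewrite (le_trans (_ : _ <= 1)) ?exprn_ile1//; lra.
  by have := h (N - m)%N; lra.
elim: N => [|N [IH1 IH2]].
  rewrite big_ord0; split => [_|]; first exact: h.
  by rewrite leqn0 => /eqP ->; rewrite subn0 expr0; lra.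
rewrite big_ord_recr/=; split => [Nm|mN].
  have {}IH1 := IH1 (ltnW Nm).
  rewrite (eqP (_ : N - m == 0)%N) ?subn_eq0 1?ltnW// add0n.
  have : (m - N = (m - N.+1).+1)%N by rewrite subnSK.
  by move=> E; move: IH1; rewrite E hS; lra.
move: mN; rewrite leq_eqVlt => /predU1P[mE|mN].
  have Nm : (N <= m)%N by rewrite mE.
  have {}IH1 := IH1 Nm; move: IH1; rewrite mE subSnn subnn.
  rewrite (eqP (_ : N - N.+1 == 0)%N) ?subn_eq0// add0n expr1 expr0; lra.
rewrite ltnS in mN; have {}IH2 := IH2 mN.
rewrite (eqP (_ : m - N == 0)%N) ?subn_eq0// addn0 subSn// hS; lra.
Qed.

Section grid.
Context {R : realType}.
Variables (r rv b : R) (k0 : nat).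
Implicit Types (k j : nat) (t u c : R).

(* Positions are measured in units of lambda. A point of weight w has cost
   [-2 ln w / lambda^2] up to a bounded factor; since
   [eta = exp (- lambda^2 / (2 v))] and [1 / v = 1 + rv] with [rv = 1 / r], the points of the
   inner grid have [j = 0] and those of the outer one have [k = k0]. *)
Definition grid_pos k j : R := 1 + k%:R * b + j%:R.
Definition grid_cost k j : R := 1 + rv + k%:R * b ^+ 2 + j%:R.
Definition grid_index k j := (k <= k0)%N /\ (j = 0%N \/ k = k0).

Definition grid_point (u c : R) :=
  (u = 0 /\ c = 0) \/
  exists k j, [/\ grid_index k j, u = grid_pos k j & c = grid_cost k j].

Hypothesis r_gt0 : 0 < r.
Hypothesis rvr : rv * r = 1.
Hypothesis b_gt0 : 0 < b.
Hypothesis b_le1 : b <= 1.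
Hypothesis b_le : b * (1 + 2 * r) <= 4 * r * (1 + r).
Hypothesis k0_gt0 : (0 < k0)%N.
Hypothesis k0_large : rv <= k0%:R ^+ 2 * b ^+ 2.

Let rV_gt0 : 0 < rv.
Proof. by rewrite -(pmulr_lgt0 _ r_gt0) rvr. Qed.

Let natr_mulB1 (p : nat) : 0 <= p%:R * (p%:R - 1) :> R.
Proof.
by case: p => [|p]; rewrite ?mul0r// mulr_ge0// subr_ge0 ler1n.
Qed.

(* Up to the factor [lambda^2 / 2], the log posterior weight of [u] relative to
   0 at the noiseless observation [lambda t]. *)
Let gain t u c := 2 * t * u - u ^+ 2 - c.

(** A step of length [h] whose cost increment is [h^2] changes the gain by [2 h (tau - h)]. The
    switch between neighbours therefore happens at the upper one rather than at the midpoint, and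
    the grid point just below [t] is the best one. *)
Lemma grid_gain_max t tau k j k' j' :
    grid_index k j -> grid_index k' j' ->
    t = grid_pos k j + tau -> 0 <= tau ->
    ((k < k0)%N -> tau <= b) -> (k = k0 -> tau <= 1) ->
  gain t (grid_pos k' j') (grid_cost k' j') <= gain t (grid_pos k j) (grid_cost k j).
Proof.
move=> [kk0 jk] [kk0' jk'] -> tau0 taub tau1.
rewrite /gain /grid_pos /grid_cost.
have J0 : 0 <= j%:R :> R by [].
have J0' : 0 <= j'%:R :> R by [].
have b0 := ltW b_gt0.
have [kltk0|] := ltnP k k0.
  case: jk => [j0|kE]; last by rewrite kE ltnn in kltk0.
  have {}taub := taub kltk0; subst j.
  have [k'k|kk'] := leqP k' k.
    have j'0 : j' = 0%N.
      by case: jk' => // k'E; move: (leq_ltn_trans k'k kltk0); rewrite k'E ltnn.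
    subst j'; rewrite -(subnK k'k) natrD; set P := (k - k')%:R.
    have P1 : 0 <= P * (P - 1) := natr_mulB1 _.
    have P0 : 0 <= P by rewrite /P.
    have h1 : 0 <= P * (P - 1) * b ^+ 2 by rewrite mulr_ge0// sqr_ge0.
    have h2 : 0 <= P * b * tau by rewrite !mulr_ge0.
    by lra.
  rewrite -(subnK (ltnW kk')) natrD; set P := (k' - k)%:R.
  have P1 : 0 <= P * (P - 1) := natr_mulB1 _.
  have P0 : 1 <= P by rewrite /P ler1n subn_gt0.
  have h1 : 0 <= P * (P - 1) * b ^+ 2 by rewrite mulr_ge0// sqr_ge0.
  have h2 : 0 <= (P - 1) * b * j'%:R by rewrite !mulr_ge0// subr_ge0.
  have h3 : 0 <= j'%:R ^+ 2 :> R by exact: sqr_ge0.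
  have h4 : 0 <= (P * b + j'%:R) * (b - tau).
    rewrite mulr_ge0 ?subr_ge0// addr_ge0// mulr_ge0//; lra.
  by lra.
move=> k0k; have kE : k = k0 by apply/eqP; rewrite eqn_leq kk0.
have {}tau1 := tau1 kE; subst k.
have [k'lt|] := ltnP k' k0.
  case: jk' => [j0|k'E]; last by rewrite k'E ltnn in k'lt.
  subst j'; rewrite -(subnK (ltnW k'lt)) natrD; set P := (k0 - k')%:R.
  have P1 : 0 <= P * (P - 1) := natr_mulB1 _.
  have P0 : 0 <= P by rewrite /P.
  have h1 : 0 <= P * (P - 1) * b ^+ 2 by rewrite mulr_ge0// sqr_ge0.
  have h2 : 0 <= P * b * tau by rewrite !mulr_ge0.
  have h3 : 0 <= P * b * j%:R by rewrite !mulr_ge0.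
  have h4 : 0 <= j%:R * tau by rewrite !mulr_ge0.
  have h5 := natr_mulB1 j.
  by lra.
move=> k0k'; have k'E : k' = k0 by apply/eqP; rewrite eqn_leq kk0'.
subst k'.
have [j'j|jj'] := leqP j' j.
  rewrite -(subnK j'j) natrD; set P := (j - j')%:R.
  have P1 : 0 <= P * (P - 1) := natr_mulB1 _.
  have P0 : 0 <= P by rewrite /P.
  have h2 : 0 <= P * tau by rewrite !mulr_ge0.
  by lra.
rewrite -(subnK (ltnW jj')) natrD; set P := (j' - j)%:R.
have P1 : 0 <= P * (P - 1) := natr_mulB1 _.
have P0 : 0 <= P by rewrite /P.
have h2 : 0 <= P * (1 - tau) by rewrite !mulr_ge0// subr_ge0.
by lra.
Qed.

Lemma grid_floor t : 1 <= t -> exists k j tau,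
  [/\ grid_index k j, t = grid_pos k j + tau, 0 <= tau,
      ((k < k0)%N -> tau <= b) & (k = k0 -> tau <= 1)].
Proof.
move=> t1; have [tK|Kt] := ltP ((t - 1) / b) k0%:R.
  have q0 : 0 <= (t - 1) / b by rewrite divr_ge0 ?subr_ge0// ltW.
  have /andP[tr1 tr2] := truncn_itv q0.
  exists (Num.truncn ((t - 1) / b)), 0%N, (t - grid_pos (Num.truncn ((t - 1) / b)) 0).
  set m := Num.truncn _ in tr1 tr2 *.
  have mk : (m < k0)%N by rewrite -(ltr_nat R) (le_lt_trans tr1).
  rewrite ler_pdivlMr// in tr1; rewrite ltr_pdivrMr// -natr1 in tr2.
  split.
  - by split; [exact: ltnW|left].
  - by rewrite addrC subrK.
  - by rewrite /grid_pos; lra.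
  - by move=> _; rewrite /grid_pos; lra.
  - by move=> mE; rewrite mE ltnn in mk.
rewrite ler_pdivlMr// in Kt.
have q0 : 0 <= t - 1 - k0%:R * b by lra.
have /andP[tr1 tr2] := truncn_itv q0.
exists k0, (Num.truncn (t - 1 - k0%:R * b)), (t - grid_pos k0 (Num.truncn (t - 1 - k0%:R * b))).
set m := Num.truncn _ in tr1 tr2 *.
rewrite -natr1 in tr2.
split.
- by split; [|right].
- by rewrite addrC subrK.
- by rewrite /grid_pos; lra.
- by rewrite ltnn.
- by move=> _; rewrite /grid_pos; lra.
Qed.

(* At the last inner point the posterior already prefers the grid to 0; this
   is what fixes the size of the inner grid. *)
Lemma grid_gain_outer t j : grid_pos k0 j <= t ->
  0 <= gain t (grid_pos k0 j) (grid_cost k0 j).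
Proof.
rewrite /gain /grid_cost => tg.
have J0 : 0 <= j%:R :> R by [].
have K0 : 1 <= k0%:R :> R by rewrite ler1n.
have b0 := ltW b_gt0.
have g0 : 0 <= grid_pos k0 j by rewrite /grid_pos !addr_ge0// mulr_ge0.
have h1 : 0 <= (t - grid_pos k0 j) * grid_pos k0 j by rewrite mulr_ge0// subr_ge0.
(* When the square is expanded, [k0_large] covers [rv], while [2 k0 b] and [2 j] are at least
   [k0 b^2] and [j] because [b] is at most 1. *)
suff : 1 + rv + k0%:R * b ^+ 2 + j%:R <= grid_pos k0 j ^+ 2 by lra.
rewrite /grid_pos.
have h2 : 0 <= j%:R ^+ 2 :> R by exact: sqr_ge0.
have h3 : 0 <= k0%:R * b * j%:R by rewrite !mulr_ge0.
have h4 : 0 <= k0%:R * b * (1 - b) by rewrite !mulr_ge0// subr_ge0.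
have h5 : 0 <= k0%:R * b by rewrite !mulr_ge0.
by have := k0_large; lra.
Qed.

(* [a] is the point whose predictive density is used, [us] the point
   dominating the posterior. When the latter is 0 while [1 <= t], the bounds on
   [b] make one of the two neighbouring grid points a good enough [a]; the
   worst case [t - 1 = 2 r] is an equality for the maximal [b]. *)
Lemma grid_choice t : 0 <= t -> exists a ca us cs,
  [/\ grid_point a ca, grid_point us cs,
      (1 + rv) * (t - a) ^+ 2 - (t - us) ^+ 2 + ca - cs <= rv,
      `|t - a| <= k0%:R + 2 /\ 0 <= t - us <= k0%:R + 2 &
      forall u c, grid_point u c \/ grid_point (- u) c ->
        cs + (t - us) ^+ 2 <= c + (t - u) ^+ 2].
Proof.
move=> t0; have b0 := ltW b_gt0; have b1 := b_le1; have r0 := r_gt0.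
have rV0 := rV_gt0; have bl := b_le.
have K0 : 1 <= k0%:R :> R by rewrite ler1n.
suff [a [ca [us [cs [pa ps main bd max]]]]] : exists a ca us cs,
  [/\ grid_point a ca, grid_point us cs,
      (1 + rv) * (t - a) ^+ 2 - (t - us) ^+ 2 + ca - cs <= rv,
      `|t - a| <= k0%:R + 2 /\ 0 <= t - us <= k0%:R + 2 &
      0 <= gain t us cs /\ forall k j, grid_index k j ->
        gain t (grid_pos k j) (grid_cost k j) <= gain t us cs].
  exists a, ca, us, cs; split => // u c.
  have H u' c' : grid_point u' c' -> 0 <= u' /\ cs + (t - us) ^+ 2 <= c' + (t - u') ^+ 2.
    move=> [[-> ->]|[k [j [ikj -> ->]]]].
      by split => //; have := max.1; rewrite /gain; lra.
    split; first by rewrite /grid_pos !addr_ge0// mulr_ge0.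
    by have := max.2 _ _ ikj; rewrite /gain; lra.
  (* If [- u] is the grid point, [u] lies on the other side of 0 and is at least as far from
     [t >= 0] as [- u] is. *)
  move=> [/H[]//|/H[u0 h]].
  have : 0 <= t * - u by rewrite mulr_ge0.
  by lra.
have pt0 : grid_point 0 0 by left.
have [t1|t1] := leP t 1.
  exists 0, 0, 0, 0; split => //.
  - rewrite subr0; have : rv * t ^+ 2 <= rv * 1.
      by rewrite ler_wpM2l ?(ltW rV_gt0)// expr_le1.
    by lra.
  - rewrite subr0 ger0_norm// t0; split => //; lra.
  - split; first by rewrite /gain; lra.
    move=> k j _; rewrite {2}/gain /gain /grid_pos /grid_cost.
    have J0 : 0 <= j%:R :> R by [].
    have h0 : 0 <= k%:R * b by rewrite mulr_ge0.
    have h1 : 0 <= (1 - t) * (1 + k%:R * b + j%:R).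
      by rewrite mulr_ge0 ?subr_ge0// !addr_ge0.
    have h2 : 0 <= k%:R * b ^+ 2 by rewrite mulr_ge0// sqr_ge0.
    have h3 : 0 <= (k%:R * b + j%:R) ^+ 2 by exact: sqr_ge0.
    by lra.
have [k [j [tau [ikj tE tau0 taub tau1]]]] := grid_floor (ltW t1).
have maxg k' j' i := grid_gain_max (k' := k') (j' := j') ikj i tE tau0 taub tau1.
have pg : grid_point (grid_pos k j) (grid_cost k j) by right; exists k, j.
have tau_le1 : tau <= 1.
  have [kk0|k0k] := ltnP k k0; first by rewrite (le_trans (taub kk0)).
  by apply: tau1; apply/eqP; rewrite eqn_leq k0k ikj.1.
have tB : t - grid_pos k j = tau by rewrite tE addrC addKr.
have tauB : 0 <= tau <= k0%:R + 2 by rewrite tau0; lra.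
(* If the floor point beats 0, then with [a = us] only [rv tau^2] is left, which is at most [rv]. *)
have [gn0|gneg] := leP 0 (gain t (grid_pos k j) (grid_cost k j)).
  exists (grid_pos k j), (grid_cost k j), (grid_pos k j), (grid_cost k j).
  split => //; rewrite tB//.
  - have : rv * tau ^+ 2 <= rv * 1.
      by rewrite ler_wpM2l ?(ltW rV_gt0)// expr_le1.
    by lra.
    by rewrite ger0_norm//; split => //; case/andP: tauB.
(* From here on 0 dominates. By [grid_gain_outer] the floor point is then strictly inside the inner
   grid, so [tau] is at most [b]. *)
have kk0 : (k < k0)%N.
  case: ikj => kk0 _; rewrite ltn_neqAle kk0 andbT; apply/negP => /eqP kE.
  by move: gneg; rewrite kE ltNge grid_gain_outer// -kE tE lerDl.
have jE : j = 0%N by case: ikj => _ [//|kE]; rewrite kE ltnn in kk0.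
have {}taub := taub kk0; subst j.
have kR : k%:R + 1 <= k0%:R :> R by rewrite natr1 ler_nat.
have k_ge0 : 0 <= k%:R :> R by [].
have kb : k%:R * b <= k%:R by rewrite ler_piMr.
have t_ub : t <= k0%:R + 2 by rewrite tE /grid_pos; lra.
have max0 : 0 <= gain t 0 0 /\ forall k' j', grid_index k' j' ->
    gain t (grid_pos k' j') (grid_cost k' j') <= gain t 0 0.
  have g0 : gain t 0 0 = 0 by rewrite /gain; lra.
  rewrite g0; split => // k' j' i.
  by apply: le_trans (ltW gneg); exact: maxg.
have bd0 : 0 <= t - 0 <= k0%:R + 2 by rewrite subr0 t0.
have [kpos|] := ltnP 0 k.
  exists (grid_pos k 0), (grid_cost k 0), 0, 0; split => //; last first.
    by rewrite tB ger0_norm//; case/andP: tauB.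
  rewrite tB tE /grid_pos /grid_cost.
  have k1 : 1 <= k%:R :> R by rewrite ler1n.
  (* The cross terms in the expansion of [t^2] have to absorb [rv tau^2]. The bound on [b] gives
     [rv b <= 4], hence [rv tau^2 <= 4 tau], and [tau <= b]. *)
  have h1 : rv * tau ^+ 2 <= 2 * b + 2 * tau.
    have e1 : rv * tau ^+ 2 <= rv * (b * tau).
      by rewrite ler_wpM2l ?(ltW rV_gt0)// expr2 ler_wpM2r.
    have e2 : rv * b <= 4.
      rewrite -(ler_pM2r r_gt0) mulrAC rvr mul1r.
            have : 0 < 1 + 2 * r by lra.
      move=> r12; rewrite -(ler_pM2r r12).
      apply: (le_trans b_le); have := sqr_ge0 r; lra.
    have e3 : rv * b * tau <= 4 * tau by rewrite ler_wpM2r.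
    by lra.
  have h2 : 0 <= (k%:R - 1) * b by rewrite mulr_ge0// subr_ge0.
  have h3 : 0 <= k%:R * (k%:R - 1) * b ^+ 2.
    by rewrite mulr_ge0 ?sqr_ge0// natr_mulB1.
  have h4 : 0 <= k%:R * b * tau by rewrite !mulr_ge0.
  by lra.
rewrite leqn0 => /eqP k0E; subst k.
rewrite /grid_pos /= mul0r !addr0 in tE tB.
(* For [a = 1] the inequality reduces to [rv tau^2 <= 2 tau], that is [tau <= 2 r]; beyond this the
   next grid point [1 + b] takes over. *)
have [tau2r|tau2r] := leP tau (2 * r).
  exists (grid_pos 0 0), (grid_cost 0 0), 0, 0; split => //; last first.
    by rewrite /grid_pos mul0r !addr0 tB ger0_norm//; case/andP: tauB.
  rewrite /grid_pos /grid_cost !mul0r !addr0 tB tE.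
  have : rv * tau ^+ 2 <= rv * (2 * r * tau).
    by rewrite ler_wpM2l ?(ltW rV_gt0)// expr2 ler_wpM2r.
  have -> : rv * (2 * r * tau) = 2 * tau * (rv * r) by ring.
  by rewrite rvr; lra.
exists (grid_pos 1 0), (grid_cost 1 0), 0, 0; split => //; last first.
- split => //; rewrite /grid_pos mul1r addr0 tE ler_norml; apply/andP; split; lra.
- rewrite /grid_pos /grid_cost !mul1r !addr0 tE.
  (* At [tau = 2 r] this reads [b (1 + 2 r) <= 4 r (1 + r)], the origin of the first argument of the
     minimum defining [b]. *)
  have h1 : rv * (b - tau) ^+ 2 + 2 * b ^+ 2 - 2 * b * tau <= 2 * tau.
    have d0 : 0 <= b - tau by lra.
    have d1 : (b - tau) * (1 + 2 * r) <= 2 * r.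
      have : 0 <= (tau - 2 * r) * (1 + 2 * r) by rewrite mulr_ge0//; lra.
      by lra.
    have rr : 0 < r * (1 + 2 * r) by rewrite mulr_gt0//; lra.
    rewrite -(ler_pM2l rr).
    have -> : r * (1 + 2 * r) * (rv * (b - tau) ^+ 2 + 2 * b ^+ 2 - 2 * b * tau) =
      (rv * r) * (1 + 2 * r) * (b - tau) ^+ 2 + r * (1 + 2 * r) * 2 * b * (b - tau) by ring.
    rewrite rvr mul1r.
    have e1 : (1 + 2 * r) * (b - tau) ^+ 2 <= 2 * r * (b - tau).
      by rewrite expr2 mulrA ler_wpM2r// mulrC.
    have e2 : (1 + 2 * r) * b * (2 * r * (b - tau)) <= 4 * r * (1 + r) * (2 * r * (b - tau)).
      rewrite ler_wpM2r// ?[X in X * b]mulrC//.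
        by rewrite !mulr_ge0//; lra.
      by rewrite mulrC.
    suff : 2 * r * (b - tau) + 4 * r * (1 + r) * (2 * r * (b - tau)) <= r * (1 + 2 * r) * (2 * tau).
      by lra.
    have -> : 2 * r * (b - tau) + 4 * r * (1 + r) * (2 * r * (b - tau)) =
       2 * r * ((b - tau) * (1 + 2 * r)) * (1 + 2 * r) by ring.
    have e3 : (b - tau) * (1 + 2 * r) * (1 + 2 * r) <= 2 * r * (1 + 2 * r).
      by rewrite ler_wpM2r//; lra.
    have e4 : 2 * r * ((b - tau) * (1 + 2 * r) * (1 + 2 * r)) <= 2 * r * (2 * r * (1 + 2 * r)).
      by rewrite ler_wpM2l//; lra.
    have e5 : 2 * r * (2 * r * (1 + 2 * r)) <= tau * (2 * r * (1 + 2 * r)).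
      by rewrite ler_wpM2r//; lra.
    by lra.
  by lra.
- by right; exists 1%N, 0%N; split => //; split => //; left.
Qed.

Lemma grid_cost_ge0 u c : grid_point u c -> 0 <= c.
Proof.
have rV0 := rV_gt0; move=> [[_ ->]//|[k [j [_ _ ->]]]].
have h2 : 0 <= k%:R * b ^+ 2 by rewrite mulr_ge0// sqr_ge0.
by rewrite /grid_cost !addr_ge0// ltW.
Qed.

(** Between grid points the cost grows by at most the distance, as [b^2 <= b]. Only the jump from 0
    to the first point, of cost [1 + rv] at distance 1, needs the factor [1 + rv]. Reflecting a grid
    point moves it away from [us]. *)
Lemma grid_cost_lipschitz us cs u c :
  grid_point us cs -> grid_point u c \/ grid_point (- u) c ->
  cs - c <= (1 + rv) * `|us - u|.
Proof.
have rV0 := rV_gt0; have b1 := b_le1; have b0 := ltW b_gt0.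
have rle (z : R) : `|z| <= (1 + rv) * `|z| by rewrite ler_peMl//; lra.
move=> [[-> ->]|[k [j [ikj -> ->]]]] uc.
  have : 0 <= c by case: uc => /grid_cost_ge0.
  have : 0 <= (1 + rv) * `|0 - u| by rewrite mulr_ge0//; lra.
  by lra.
have k_ge0 : 0 <= k%:R :> R by [].
have j_ge0 : 0 <= j%:R :> R by [].
have kb0 : 0 <= k%:R * b by rewrite mulr_ge0.
have kb : 0 <= k%:R * b * (1 - b) by rewrite !mulr_ge0// subr_ge0.
have uc' : (u = 0 /\ c = 0) \/ (exists k' j', [/\ grid_index k' j',
    u = grid_pos k' j' \/ - u = grid_pos k' j' & c = grid_cost k' j']).
  case: uc => [[?|[k' [j' [? ? ?]]]]|[[/eqP + ?]|[k' [j' [? ? ?]]]]].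
  - by left.
  - by right; exists k', j'; split => //; left.
  - by rewrite oppr_eq0 => /eqP ?; left.
  - by right; exists k', j'; split => //; right.
case: uc' => [[-> ->]|[k' [j' [ikj' [->|uE] ->]]]].
- rewrite !subr0 /grid_cost /grid_pos ger0_norm ?addr_ge0//.
  have h1 : 0 <= rv * (k%:R * b) by rewrite mulr_ge0// ltW.
  have h2 : 0 <= rv * j%:R by rewrite mulr_ge0// ltW.
  by lra.
- apply: (le_trans _ (rle _)); rewrite /grid_cost /grid_pos.
  have [kk'|k'k] := leqP k' k.
    apply: (le_trans _ (ler_norm _)).
    have : 0 <= (k%:R - k'%:R) * b * (1 - b).
      by rewrite !mulr_ge0// subr_ge0// ler_nat.
    by lra.
  have -> : j = 0%N.
    case: ikj => _ [//|kE]; case: ikj' => k'k0 _.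
    by rewrite kE ltnNge k'k0 in k'k.
  have j'0 : 0 <= j'%:R :> R by [].
  have : 0 <= (k'%:R - k%:R) * b ^+ 2.
    by rewrite mulr_ge0 ?sqr_ge0// subr_ge0 ler_nat ltnW.
  by move=> ?; apply: (@le_trans _ _ 0); [lra|exact: normr_ge0].
- apply: (le_trans _ (rle _)); apply: (le_trans _ (ler_norm _)).
  rewrite uE /grid_cost /grid_pos.
  have h2 : 0 <= k'%:R * b ^+ 2 by rewrite mulr_ge0// sqr_ge0.
  have h3 : 0 <= k'%:R * b by rewrite mulr_ge0.
  have j'0 : 0 <= j'%:R :> R by [].
  by lra.
Qed.

Lemma grid_point_ge0 u c : grid_point u c -> 0 <= u.
Proof.
move=> [[-> _]//|[k [j [_ -> _]]]].
by rewrite /grid_pos !addr_ge0// mulr_ge0// ltW.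
Qed.

(** The outer points are one unit apart, which produces the geometric decay summed in
    [sum_geometric_dist]. The centre [m] is the outer index of [us], or 0 when [us] lies to the left
    of the outer grid. *)
Lemma grid_outer_dist us cs : grid_point us cs ->
  exists m : nat, forall j, ((j - m) + (m - j))%:R <= `|us - grid_pos k0 j|.
Proof.
have b0 := ltW b_gt0; move=> [[-> _]|[k [j [[kk0 jk] -> _]]]].
  exists 0%N => j; rewrite subn0 sub0n addn0 sub0r normrN ger0_norm /grid_pos.
    by rewrite lerDr addr_ge0// mulr_ge0.
  by rewrite !addr_ge0// mulr_ge0.
have [klt|k0k] := ltnP k k0.
  have -> : j = 0%N by case: jk => [//|kE]; rewrite kE ltnn in klt.
  exists 0%N => j'; rewrite subn0 sub0n addn0 distrC.
  apply: (le_trans _ (ler_norm _)); rewrite /grid_pos.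
  have : 0 <= (k0%:R - k%:R) * b by rewrite mulr_ge0// subr_ge0 ler_nat ltnW.
  by lra.
have -> : k = k0 by apply/eqP; rewrite eqn_leq kk0.
exists j => j'; rewrite /grid_pos.
have -> : 1 + k0%:R * b + j%:R - (1 + k0%:R * b + j'%:R) = j%:R - j'%:R by ring.
have [jj'|j'j] := leqP j j'.
  rewrite (eqP (_ : j - j' == 0)%N) ?subn_eq0// addn0 natrB// distrC.
  exact: ler_norm.
rewrite (eqP (_ : j' - j == 0)%N) ?subn_eq0 1?ltnW// add0n natrB 1?ltnW//.
exact: ler_norm.
Qed.

(** * Comparison of every atom with the dominating one *)

Section dominating_point.
Variables (t a us cs : R).
Hypothesis us_grid : grid_point us cs.
Hypothesis t_us : 0 <= t - us <= k0%:R + 2.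
Hypothesis us_max : forall u c, grid_point u c \/ grid_point (- u) c ->
  cs + (t - us) ^+ 2 <= c + (t - u) ^+ 2.

(** The coefficient of the linear loss in [D >= d^2 - grid_slack d] below: [2 (k0 + 2)] bounds
    [2 (t - us)], and [1 + rv] is the Lipschitz constant of the cost. *)
Definition grid_slack : R := 2 * (k0%:R + 2) + (1 + rv).

Lemma grid_slack_ge0 : 0 <= grid_slack.
Proof. by have rV0 := rV_gt0; have : 0 <= k0%:R :> R by []; rewrite /grid_slack; lra. Qed.

(* The decay in [us - u] makes the sum over the infinite grid cost no more than
   the dominating point, up to [exp (O(lambda |z| + z^2))]. *)
Lemma grid_term_le lam z u c : 2 <= lam ^+ 2 -> 0 <= lam ->
    grid_point u c \/ grid_point (- u) c ->
  - (lam ^+ 2 * c / 2) - (lam * t + z - lam * u) ^+ 2 / 2 <=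
  - (lam ^+ 2 * cs / 2) - (lam * t + z - lam * us) ^+ 2 / 2 +
    (2 * grid_slack * lam * `|z| + 2 * z ^+ 2 + grid_slack ^+ 2) - (us - u) ^+ 2 / 4.
Proof.
move=> lam2 lam0 uc; set C := grid_slack; have C0 := grid_slack_ge0; rewrite -/C in C0.
set d := `|us - u|; have d0 : 0 <= d by exact: normr_ge0.
have dE : (us - u) ^+ 2 = d ^+ 2 by rewrite /d -normrX ger0_norm// sqr_ge0.
have zE : z ^+ 2 = `|z| ^+ 2 by rewrite -normrX ger0_norm// sqr_ge0.
set D := c + (t - u) ^+ 2 - (cs + (t - us) ^+ 2).
have D0 : 0 <= D by rewrite subr_ge0 us_max.
have DC : d ^+ 2 - C * d <= D.
  have /andP[ts0 tsB] := t_us.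
  have h1 := grid_cost_lipschitz us_grid uc; rewrite -/d in h1.
  have h2 : - (2 * (k0%:R + 2) * d) <= 2 * (us - u) * (t - us).
    rewrite -[leRHS]opprK lerN2 (le_trans (ler_norm _))// normrN !normrM -/d.
    rewrite (ger0_norm ts0) ger0_norm//.
    by have := ler_wpM2l d0 tsB; lra.
  have -> : D = c - cs + (us - u) ^+ 2 + 2 * (us - u) * (t - us) by rewrite /D; ring.
  by rewrite dE /C /grid_slack; lra.
have lz : lam * (u - us) * z <= lam * d * `|z|.
  by rewrite (le_trans (ler_norm _))// !normrM (ger0_norm lam0) distrC.
have z0 : 0 <= `|z| by [].
suff : - (lam ^+ 2 / 2 * D) + lam * d * `|z| <=
  2 * C * lam * `|z| + 2 * z ^+ 2 + C ^+ 2 - d ^+ 2 / 4.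
  by rewrite dE /D; lra.
rewrite zE.
(* Near [us] the crude [D >= 0] suffices, [C^2] making up for [d^2 / 4]. Far away [D >= d^2 / 2],
   which absorbs the noise term and still leaves [d^2 / 4] because [lam^2 >= 2]. *)
have [dC|Cd] := leP d (2 * C).
  have h1 : 0 <= lam ^+ 2 * D by rewrite mulr_ge0// sqr_ge0.
  have h2 : 0 <= (2 * C - d) * (lam * `|z|) by rewrite mulr_ge0 ?subr_ge0// mulr_ge0.
  have h3 : d ^+ 2 <= (2 * C) ^+ 2 by rewrite lerXn2r// nnegrE; lra.
  have h4 := sqr_ge0 `|z|.
  by lra.
have h1 : lam ^+ 2 * (d ^+ 2 / 2) <= lam ^+ 2 * D.
  rewrite ler_wpM2l ?sqr_ge0//.
  have : 0 <= (d - 2 * C) * d by rewrite mulr_ge0// subr_ge0 ltW.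
  by lra.
have h2 : 0 <= (lam * d / 4 - `|z|) ^+ 2 by exact: sqr_ge0.
have h3 : 0 <= (lam ^+ 2 - 2) * d ^+ 2 by rewrite mulr_ge0 ?sqr_ge0// subr_ge0.
have h4 : 0 <= C * lam * `|z| by rewrite !mulr_ge0.
have h5 := sqr_ge0 C.
by lra.
Qed.

End dominating_point.
End grid.

(** * Integration against the bi-grid prior *)

Section bigrid_parameters.
Context {R : realType}.
Variable r : R.
Hypothesis r_gt0 : 0 < r.

Lemma vpar_gt0 : 0 < vpar r.
Proof. by rewrite invr_gt0 addr_gt0// invr_gt0. Qed.

Lemma vpar_inv : (1 + r^-1) * vpar r = 1.
Proof. by rewrite mulfV// gt_eqF// addr_gt0// invr_gt0. Qed.

Lemma bpar_gt0 : 0 < bpar r.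
Proof.
by rewrite lt_min ltr01 andbT !mulr_gt0// ?invr_gt0 ?addr_gt0 ?mulr_gt0.
Qed.

Lemma bpar_le1 : bpar r <= 1.
Proof. by rewrite ge_min lexx orbT. Qed.

Lemma bpar_le : bpar r * (1 + 2 * r) <= 4 * r * (1 + r).
Proof.
have h : 0 < 1 + 2 * r by rewrite addr_gt0 ?mulr_gt0.
by rewrite -ler_pdivlMr// ge_min lexx.
Qed.

Let k0_ge : 2 * bpar r `^ (- (3 / 2)) <= (Kpar r).-1%:R.
Proof.
rewrite /Kpar add1n /= natr_absz ger0_norm ?ceil_ge//.
by rewrite -(ler_int R) (le_trans _ (ceil_ge _))// mulr_ge0// powR_ge0.
Qed.

Lemma Kpar_prednK : ((Kpar r).-1.+1 = Kpar r)%N.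
Proof. by rewrite /Kpar add1n. Qed.

Lemma Kpar_pred_gt0 : (0 < (Kpar r).-1)%N.
Proof.
rewrite -(ltr_nat R); apply: lt_le_trans k0_ge.
by rewrite mulr_gt0// powR_gt0// bpar_gt0.
Qed.

(** Origin of the exponent in [K]: from [K - 1 >= 2 b^(-3/2)] follows [(K - 1)^2 b^2 >= 4 / b], and
    [4 / b >= 1 / r] because the bound on [b] implies [b <= 4 r]. *)
Lemma Kpar_pred_large : r^-1 <= (Kpar r).-1%:R ^+ 2 * bpar r ^+ 2.
Proof.
have b0 := bpar_gt0.
have p0 : 0 <= 2 * bpar r `^ (- (3 / 2)) by rewrite mulr_ge0// powR_ge0.
apply: (@le_trans _ _ (4 / bpar r)).
  rewrite ler_pdivlMr// mulrC ler_pdivrMr//.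
  have h : 0 < 1 + 2 * r by rewrite addr_gt0 ?mulr_gt0.
  rewrite -(ler_pM2r h); apply: (le_trans bpar_le).
  by have := sqr_ge0 r; have := r_gt0; lra.
apply: (@le_trans _ _ ((2 * bpar r `^ (- (3 / 2))) ^+ 2 * bpar r ^+ 2)).
  rewrite exprMn -!powR_mulrn ?powR_ge0 ?(ltW b0)// -powRrM -mulrA -powRD; last first.
    by rewrite (gt_eqF b0) implybT.
  rewrite (_ : - (3 / 2) * 2%:R + 2%:R = -1); last by field.
  rewrite powR_inv1 ?(ltW b0)// powR_mulrn// ler_wpM2r ?invr_ge0 ?(ltW b0)//; lra.
by rewrite ler_wpM2r ?sqr_ge0// lerXn2r// nnegrE.
Qed.

End bigrid_parameters.

Section bigrid_integral.
Context {R : realType}.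
Variables (r eta : R).
Hypothesis r_gt0 : 0 < r.
Hypothesis eta01 : 0 < eta < 1.

Let lam := lambda r eta.
Let b := bpar r.
Let k0 := (Kpar r).-1.
Let gpos := grid_pos b.
Let gcost := grid_cost r^-1 b.

Let eta_gt0 : 0 < eta. Proof. by case/andP: eta01. Qed.
Let eta_lt1 : eta < 1. Proof. by case/andP: eta01. Qed.

Lemma lambda_ge0 : 0 <= lam. Proof. exact: sqrtr_ge0. Qed.

Lemma lambda_sqr : lam ^+ 2 = - (2 * vpar r * ln eta).
Proof.
have h : 2 * ln (eta `^ (- vpar r)) = - (2 * vpar r * ln eta).
  by rewrite ln_powR; ring.
rewrite /lam /lambda h sqr_sqrtr// oppr_ge0 mulr_ge0_le0//.
  by rewrite mulr_ge0// ltW// vpar_gt0.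
by rewrite ln_le0// ltW.
Qed.

Lemma powR_lambda w : eta `^ (w * vpar r) = expR (- (lam ^+ 2 * w / 2)).
Proof.
rewrite /powR gt_eqF// lambda_sqr; congr expR.
by field.
Qed.

Lemma eta_lambda : eta = expR (- (lam ^+ 2 * (1 + r^-1) / 2)).
Proof.
rewrite lambda_sqr (_ : - _ = (1 + r^-1) * vpar r * ln eta); last by field; rewrite gt_eqF.
by rewrite vpar_inv// mul1r lnK.
Qed.

Let weightE k j : expR (- (lam ^+ 2 * gcost k j / 2)) =
  eta * expR (- (lam ^+ 2 * (k%:R * b ^+ 2 + j%:R) / 2)).
Proof.
rewrite [in RHS]eta_lambda -expRD; congr expR; rewrite /gcost /grid_cost; ring.
Qed.

Implicit Types f : measurableTypeR R -> \bar R.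
Local Open Scope ereal_scope.

(** The factor [eta] of the prior is included so that every weight has the form
    [exp (- lambda^2 cost / 2)]; the normalisation is treated separately. *)
Lemma ge0_integral_grid_measure f :
    measurable_fun setT f -> (forall u, 0 <= f u) ->
  eta%:E * \int[grid_measure r eta]_u f u =
  \sum_(k < Kpar r) (expR (- (lam ^+ 2 * gcost k 0 / 2)))%:E * f (lam * gpos k 0)%R +
  \sum_(j <oo) (expR (- (lam ^+ 2 * gcost k0 j.+1 / 2)))%:E * f (lam * gpos k0 j.+1)%R.
Proof.
move=> mf f0.
have int_atom w a : \int[atom eta w a]_u f u = (eta `^ w)%:E * f a.
  by rewrite ge0_integral_mscale// integral_dirac// diracT mul1e.
have e0 : 0 <= eta%:E by rewrite lee_fin ltW.
rewrite ge0_integral_measure_add// ge0_integral_measure_sum//.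
rewrite ge0_integral_mscale//= ge0_integral_measure_series//.
under eq_bigr do rewrite int_atom.
under eq_eseriesr do rewrite int_atom.
have s0 j : 0 <= (eta `^ (j.+1%:R * vpar r))%:E * f (mu_pt r eta j).
  by rewrite mule_ge0// lee_fin powR_ge0.
rewrite ge0_muleDr; last 2 first.
- by apply: sume_ge0 => k _; rewrite mule_ge0// lee_fin powR_ge0.
- by rewrite mule_ge0 ?lee_fin ?powR_ge0//; apply: nneseries_ge0 => j _ _.
congr (_ + _).
  rewrite ge0_sume_distrr; last by move=> k _; rewrite mule_ge0// lee_fin powR_ge0.
  apply: eq_bigr => k _; rewrite muleA -EFinM; congr (_%:E * f _).
    by rewrite weightE addr0 mulrAC powR_lambda.
  by rewrite /nu_pt /gpos /grid_pos -/lam -/b; ring.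
rewrite muleA -EFinM -nneseriesZl; last by move=> j _; exact: s0.
apply: eq_eseriesr => j _; rewrite muleA -EFinM; congr (_%:E * f _).
  rewrite weightE (mulrAC _ (vpar r)) !powR_lambda -mulrA -expRD.
  by congr (_ * expR _)%R; rewrite -/k0 -/b; ring.
by rewrite /mu_pt /nu_pt /gpos /grid_pos -/lam -/b -/k0; ring.
Qed.

(** On the finite inner grid a uniform bound [M] is enough; the outer grid needs decay away from an
    index [m]. The factor [expR 1] is the price of replacing a Gaussian decay by a geometric one. *)
Lemma grid_measure_integral_le f (M : R) (m : nat) :
    measurable_fun setT f -> (forall u, 0 <= f u) -> (0 <= M)%R ->
    (forall k, (k < Kpar r)%N ->
      (expR (- (lam ^+ 2 * gcost k 0 / 2)))%:E * f (lam * gpos k 0)%R <= M%:E) ->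
    (forall j, (expR (- (lam ^+ 2 * gcost k0 j.+1 / 2)))%:E * f (lam * gpos k0 j.+1)%R <=
      (M * expR 1 * 2^-1 ^+ ((j.+1 - m) + (m - j.+1)))%:E) ->
  eta%:E * \int[grid_measure r eta]_u f u <= (M * ((Kpar r)%:R + 3 * expR 1))%:E.
Proof.
move=> mf f0 M0 inner outer; rewrite ge0_integral_grid_measure//.
rewrite mulrDr EFinD; apply: leeD.
  rewrite (le_trans (lee_sum _ (fun (k : 'I_(Kpar r)) _ => inner k (ltn_ord k))))//.
  by rewrite sumEFin lee_fin sumr_const card_ord mulr_natr.
have t0 j : 0 <= (expR (- (lam ^+ 2 * gcost k0 j.+1 / 2)))%:E * f (lam * gpos k0 j.+1)%R.
  by rewrite mule_ge0// lee_fin expR_ge0.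
apply: lime_le; first by apply: is_cvg_nneseries => j _ _; exact: t0.
apply: nearW => N.
apply: (@le_trans _ _ (\sum_(0 <= j < N)
  (M * expR 1 * 2^-1 ^+ ((j.+1 - m) + (m - j.+1)))%:E)).
  by apply: lee_sum => j _; exact: outer.
rewrite sumEFin lee_fin -mulr_sumr (mulrC 3%R) mulrA.
rewrite ler_wpM2l ?mulr_ge0 ?expR_ge0//.
(* The outer terms start at index 1; adding the one at index 0 only enlarges the sum. *)
apply: (le_trans _ (sum_geometric_dist R m N.+1)).
rewrite big_mkord big_ord_recl/= lerDr exprn_ge0//.
Qed.

Lemma grid_measure_integral_ge f k j :
    measurable_fun setT f -> (forall u, 0 <= f u) -> grid_index k0 k j ->
  (expR (- (lam ^+ 2 * gcost k j / 2)))%:E * f (lam * gpos k j)%R <=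
  eta%:E * \int[grid_measure r eta]_u f u.
Proof.
move=> mf f0 [kk0 jk]; rewrite ge0_integral_grid_measure//.
have t0 k' j' : 0 <= (expR (- (lam ^+ 2 * gcost k' j' / 2)))%:E * f (lam * gpos k' j')%R.
  by rewrite mule_ge0// lee_fin expR_ge0.
case: j jk => [_|j].
  have kK : (k < Kpar r)%N by rewrite -Kpar_prednK.
  rewrite (bigD1 (Ordinal kK))//= -addeA leeDl// adde_ge0//.
    exact: sume_ge0.
  by apply: nneseries_ge0 => j _ _.
case=> // ->.
pose F j := (expR (- (lam ^+ 2 * gcost k0 j.+1 / 2)))%:E * f (lam * gpos k0 j.+1)%R.
apply: (@le_trans _ _ (\sum_(i <oo) F i)); last first.
  by rewrite leeDr//; apply: sume_ge0 => i _; exact: t0.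
apply: (@le_trans _ _ (\sum_(0 <= i < j.+1) F i)).
  by rewrite big_nat_recr//= leeDr//; apply: sume_ge0 => i _; exact: t0.
by apply: (nneseries_lim_ge (u_ := F)) => i _ _; exact: t0.
Qed.

End bigrid_integral.

Lemma expRN_le_half {R : realType} (n : nat) (x : R) :
  n%:R <= x -> expR (- x) <= 2^-1 ^+ n.
Proof.
move=> nx; apply: (@le_trans _ _ (expR (- n%:R))); first by rewrite ler_expR lerN2.
rewrite expRN -[n%:R]mulr1 expRM_natl -exprVn.
rewrite lerXn2r ?nnegrE ?invr_ge0 ?expR_ge0// lef_pV2 ?posrE ?expR_gt0//.
by have := expR_ge1Dx (1 : R); lra.
Qed.

(** * Normalisation, symmetry and one-atom bounds of the prior *)

Section bigrid_prior_integral.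
Context {R : realType}.
Variables (r eta : R).
Hypothesis r_gt0 : 0 < r.
Hypothesis eta01 : 0 < eta < 1.

Let lam := lambda r eta.
Let b := bpar r.
Let k0 := (Kpar r).-1.
Let gpos := grid_pos b.
Let gcost := grid_cost r^-1 b.

Hypothesis lam2 : 2 <= lam ^+ 2.

Let eta_gt0 : 0 < eta. Proof. by case/andP: eta01. Qed.
Let eta_lt1 : eta < 1. Proof. by case/andP: eta01. Qed.

(** Together with the lower bound 1, this controls the normalising constant uniformly in [eta], so
    normalisation changes log weights by a bounded amount only. *)
Definition grid_mass_ub : R := (Kpar r)%:R + 3 * expR 1.

Local Open Scope ereal_scope.
Implicit Types f : measurableTypeR R -> \bar R.

Let mass := grid_measure r eta setT.

Let massE : mass = \int[grid_measure r eta]_u (cst 1 u).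
Proof. by rewrite integral_cst// mul1e. Qed.

Lemma grid_mass_ge1 : 1 <= mass.
Proof.
have i00 : grid_index k0 0 0 by split; [|left].
have := @grid_measure_integral_ge R r eta r_gt0 eta01 (cst 1) 0 0 (measurable_cst _)
  (fun=> lee01) i00.
rewrite -massE mule1 (_ : grid_cost _ _ _ _ = 1 + r^-1)%R; last first.
  by rewrite /grid_cost mul0r !addr0.
by rewrite -eta_lambda// -{1}(mule1 eta%:E) lee_pmul2l// lte_fin.
Qed.

Lemma grid_mass_le : mass <= grid_mass_ub%:E.
Proof.
have e0 : (0 < eta%:E) by rewrite lte_fin.
have b2 k : (0 <= k%:R * b ^+ 2)%R by rewrite mulr_ge0// sqr_ge0.
rewrite -(@lee_pmul2l _ eta%:E)// massE.
apply: (@grid_measure_integral_le R r eta r_gt0 eta01 (cst 1) eta 0) => //.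
- exact: ltW.
- move=> k _; rewrite mule1 lee_fin [leRHS](eta_lambda r_gt0 eta01) ler_expR lerN2.
  rewrite -/lam ler_wpM2r// ler_wpM2l ?sqr_ge0// /grid_cost addr0 lerDl.
  exact: b2.
- move=> j; rewrite mule1 lee_fin subn0 sub0n addn0.
  apply: (@le_trans _ _ (eta * 2^-1 ^+ j.+1)%R).
    rewrite {2}(eta_lambda r_gt0 eta01) -/lam.
    have -> : (expR (- (lam ^+ 2 * grid_cost r^-1 (bpar r) (Kpar r).-1 j.+1 / 2)) =
       expR (- (lam ^+ 2 * (1 + r^-1) / 2)) *
       expR (- (lam ^+ 2 / 2 * ((Kpar r).-1%:R * b ^+ 2 + j.+1%:R))))%R.
      by rewrite -expRD; congr expR; rewrite /grid_cost -/b; ring.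
    rewrite ler_wpM2l ?expR_ge0//; apply: expRN_le_half.
    have l1 : (1 <= lam ^+ 2 / 2)%R by rewrite ler_pdivlMr// mul1r.
    rewrite (@le_trans _ _ ((Kpar r).-1%:R * b ^+ 2 + j.+1%:R)%R)// ?lerDr//.
    by rewrite ler_peMl// addr_ge0.
  rewrite ler_wpM2r ?exprn_ge0// ler_peMr ?ltW//.
  by have := expR_ge1Dx (1 : R); lra.
Qed.

Let mass_fin : mass \is a fin_num.
Proof.
rewrite ge0_fin_numE; last exact: le_trans grid_mass_ge1.
by rewrite (le_lt_trans grid_mass_le)// ltry.
Qed.

Let mass_bounds : (1 <= fine mass <= grid_mass_ub)%R.
Proof. by rewrite -!lee_fin fineK// grid_mass_ge1 grid_mass_le. Qed.

Let integral_nuB f : measurable_fun setT f -> (forall u, 0 <= f u) ->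
  \int[nuB r eta]_u f u = (fine mass)^-1%:E * \int[grid_measure r eta]_u f u.
Proof.
move=> mf f0; rewrite ge0_integral_mnormalize//.
by rewrite (lt_le_trans _ grid_mass_ge1)//= (le_lt_trans grid_mass_le)// ltry.
Qed.

Let mopp : measurable_fun [set: measurableTypeR R] (-%R : _ -> measurableTypeR R).
Proof. exact: oppr_measurable. Qed.

Lemma ge0_integral_bigrid_prior f : measurable_fun setT f -> (forall u, 0 <= f u) ->
  \int[bigrid_prior r eta]_u f u = (1 - eta)%:E * f 0%R +
   (eta / 2)%:E * (\int[nuB r eta]_u f u + \int[nuB r eta]_u f (- u)%R).
Proof.
move=> mf f0.
have e1 : (0 <= 1 - eta)%R by rewrite subr_ge0 ltW.
have e2 : (0 <= eta / 2)%R by rewrite divr_ge0// ltW.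
pose nuBN : {measure set (measurableTypeR R) -> \bar R} :=
  measure_function_pushforward__canonical__measure_function_Measure (nuB r eta) mopp.
transitivity (\int[measure_add (mscale (NngNum e1) \d_(0%R : measurableTypeR R))
    (mscale (NngNum e2) (measure_add (nuB r eta) nuBN))]_u f u).
  apply: eq_measure_integral => A mA _.
  rewrite [RHS]measure_addE [X in _ + X](_ : _ =
    (eta / 2)%:E * measure_add (nuB r eta) nuBN A)// measure_addE.
  by rewrite /= /bigrid_prior (ltW eta_gt0) (ltW eta_lt1).
rewrite ge0_integral_measure_add//.
rewrite ge0_integral_mscale//= integral_dirac// diracT mul1e.
rewrite ge0_integral_mscale//= ge0_integral_measure_add//.
by rewrite (ge0_integral_pushforward mopp)// preimage_setT.
Qed.

Lemma bigrid_prior_symmetric f : measurable_fun setT f -> (forall u, 0 <= f u) ->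
  \int[bigrid_prior r eta]_u f (- u)%R = \int[bigrid_prior r eta]_u f u.
Proof.
move=> mf f0; rewrite !ge0_integral_bigrid_prior//; last exact: (measurableT_comp mf mopp).
rewrite oppr0; congr (_ + _ * _); rewrite addeC; congr (_ + _).
by apply: eq_integral => u _; rewrite opprK.
Qed.

Lemma bigrid_prior_ge0 f : measurable_fun setT f -> (forall u, 0 <= f u) ->
  (1 - eta)%:E * f 0%R <= \int[bigrid_prior r eta]_u f u.
Proof.
move=> mf f0; rewrite ge0_integral_bigrid_prior// leeDl//.
apply: mule_ge0; first by rewrite lee_fin divr_ge0// (ltW eta_gt0).
by apply: adde_ge0; apply: integral_ge0.
Qed.

(** A single atom is kept. The factor 2 is the split between the grid and its reflection, and
    [grid_mass_ub] bounds the normalisation. *)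
Lemma bigrid_prior_ge_grid f k j :
    measurable_fun setT f -> (forall u, 0 <= f u) -> grid_index k0 k j ->
  ((2 * grid_mass_ub)^-1 * expR (- (lam ^+ 2 * gcost k j / 2)))%:E * f (lam * gpos k j)%R
  <= \int[bigrid_prior r eta]_u f u.
Proof.
move=> mf f0 ikj; rewrite ge0_integral_bigrid_prior//.
have /andP[m1 mK] := mass_bounds.
have I0 : 0 <= \int[grid_measure r eta]_u f u by apply: integral_ge0.
apply: (@le_trans _ _ ((eta / 2)%:E * \int[nuB r eta]_u f u)); last first.
  rewrite [X in _ <= _ + X]ge0_muleDr; [|by apply: integral_ge0|by apply: integral_ge0].
  rewrite addeCA leeDl//; apply: adde_ge0; apply: mule_ge0 => //.
  - by rewrite lee_fin subr_ge0 (ltW eta_lt1).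
  - by rewrite lee_fin divr_ge0// (ltW eta_gt0).
  - by apply: integral_ge0.
rewrite integral_nuB//.
have gK : (0 < grid_mass_ub)%R by apply: lt_le_trans mK; apply: lt_le_trans m1.
have := @grid_measure_integral_ge R r eta r_gt0 eta01 f k j mf f0 ikj.
rewrite -/lam -/gcost -/gpos => h.
apply: (@le_trans _ _ ((2 * grid_mass_ub)^-1%:E * (eta%:E * \int[grid_measure r eta]_u f u))).
  by rewrite EFinM -muleA lee_wpmul2l// lee_fin invr_ge0 mulr_ge0// (ltW gK).
rewrite !muleA -!EFinM lee_wpmul2r// lee_fin.
rewrite invfM mulrC -mulrA ler_wpM2l ?(ltW eta_gt0)// ler_wpM2l//.
by rewrite lef_pV2// posrE (lt_le_trans ltr01).
Qed.

(** [m1] and [m2] are the centres of decay for the outer grid and its reflection. Each half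
    contributes at most [M grid_mass_ub / 2], the atom at 0 at most [M]. *)
Lemma bigrid_prior_le f (M : R) (m1 m2 : nat) :
    measurable_fun setT f -> (forall u, 0 <= f u) -> (0 <= M)%R ->
    f 0%R <= M%:E ->
    (forall k, (k < Kpar r)%N ->
      (expR (- (lam ^+ 2 * gcost k 0 / 2)))%:E * f (lam * gpos k 0)%R <= M%:E) ->
    (forall k, (k < Kpar r)%N ->
      (expR (- (lam ^+ 2 * gcost k 0 / 2)))%:E * f (- (lam * gpos k 0))%R <= M%:E) ->
    (forall j, (expR (- (lam ^+ 2 * gcost k0 j.+1 / 2)))%:E * f (lam * gpos k0 j.+1)%R <=
      (M * expR 1 * 2^-1 ^+ ((j.+1 - m1) + (m1 - j.+1)))%:E) ->
    (forall j, (expR (- (lam ^+ 2 * gcost k0 j.+1 / 2)))%:E * f (- (lam * gpos k0 j.+1))%R <=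
      (M * expR 1 * 2^-1 ^+ ((j.+1 - m2) + (m2 - j.+1)))%:E) ->
  \int[bigrid_prior r eta]_u f u <= (M * (1 + grid_mass_ub))%:E.
Proof.
move=> mf f0 M0 hz hi1 hi2 ho1 ho2; rewrite ge0_integral_bigrid_prior//.
have /andP[mass1 mK] := mass_bounds.
have half g m : measurable_fun setT g -> (forall u, 0 <= g u) ->
    (forall k, (k < Kpar r)%N ->
      (expR (- (lam ^+ 2 * gcost k 0 / 2)))%:E * g (lam * gpos k 0)%R <= M%:E) ->
    (forall j, (expR (- (lam ^+ 2 * gcost k0 j.+1 / 2)))%:E * g (lam * gpos k0 j.+1)%R <=
      (M * expR 1 * 2^-1 ^+ ((j.+1 - m) + (m - j.+1)))%:E) ->
    (eta / 2)%:E * \int[nuB r eta]_u g u <= (M * grid_mass_ub / 2)%:E.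
  move=> mg g0 hi ho; rewrite integral_nuB//.
  have I0 : 0 <= \int[grid_measure r eta]_u g u by apply: integral_ge0.
  have := @grid_measure_integral_le R r eta r_gt0 eta01 g M m mg g0 M0 hi ho.
  have h20 : (0 : \bar R) <= (2^-1)%:E by rewrite lee_fin.
  move=> /(lee_wpmul2l h20); rewrite -EFinM [X in _ <= X%:E]mulrC; apply: le_trans.
  rewrite !muleA -!EFinM lee_wpmul2r// lee_fin [leRHS]mulrC.
  rewrite ler_piMr ?divr_ge0 ?(ltW eta_gt0)//.
  by rewrite invf_le1// (lt_le_trans ltr01).
rewrite [X in _ + X <= _]ge0_muleDr; [|by apply: integral_ge0|by apply: integral_ge0].
rewrite [leRHS](_ : _ = M%:E + ((M * grid_mass_ub / 2)%:E + (M * grid_mass_ub / 2)%:E)); last first.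
  by rewrite -!EFinD; congr EFin; field.
apply: leeD; last apply: leeD.
- apply: le_trans hz; rewrite -[leRHS]mul1e lee_wpmul2r// lee_fin.
  by rewrite gerBl ltW.
- exact: half hi1 ho1.
- exact: (half (fun u => f (- u)%R) m2 (measurableT_comp mf mopp)).
Qed.

End bigrid_prior_integral.

(** * Coordinatewise bounds and the upper bound *)

Section normal_pdf_facts.
Context {R : realType}.

Lemma normr_le1DX2 (w : R) : `|w| <= 1 + w ^+ 2.
Proof.
have := sqr_ge0 (`|w| - 1); rewrite sqrrB expr1n real_normK ?num_real//.
by have := sqr_ge0 w; have := normr_ge0 w; lra.
Qed.

Lemma normal_pdf1E (m x : R) :
  normal_pdf m 1 x = normal_peak 1 * expR (- ((x - m) ^+ 2 / 2)).
Proof.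
rewrite normal_pdfE ?oner_neq0//= /normal_fun; congr (_ * expR _).
by rewrite expr1n mulNr.
Qed.

Lemma normal_pdf_sqrtE (r m x : R) : 0 < r ->
  normal_pdf m (Num.sqrt r) x =
  normal_peak (Num.sqrt r) * expR (- (r^-1 * (x - m) ^+ 2 / 2)).
Proof.
move=> r0; rewrite normal_pdfE ?gt_eqF ?sqrtr_gt0//= /normal_fun; congr (_ * expR _).
by rewrite sqr_sqrtr ?ltW// mulNr -mulr_natr invfM; ring.
Qed.

Lemma normal_pdfNN (m s x : R) : s != 0 -> normal_pdf (- m) s (- x) = normal_pdf m s x.
Proof.
move=> s0; rewrite !normal_pdfE//= /normal_fun.
by rewrite -(sqrrN (- x - - m)) opprB opprK addrC.
Qed.

End normal_pdf_facts.

Section coordinate_bounds.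
Context {R : realType}.
Variables (r : R).
Hypothesis r_gt0 : 0 < r.
Let k0 := (Kpar r).-1.
Let Kc : R := grid_mass_ub r.
Let slack : R := grid_slack r^-1 k0.

Let Kc_gt0 : 0 < Kc.
Proof. by rewrite /Kc /grid_mass_ub ltr_wpDl// mulr_gt0// expR_gt0. Qed.

Let Kc_ge1 : 1 <= Kc.
Proof.
have : 1 <= expR 1 :> R by rewrite (le_trans _ (expR_ge1Dx _))// lerDl.
by rewrite /Kc /grid_mass_ub; have : 0 <= (Kpar r)%:R :> R by []; lra.
Qed.

Let ln_const_ge0 : 0 <= ln ((1 + Kc) * (2 * Kc)).
Proof.
have K1 := Kc_ge1.
by rewrite ln_ge0// -[leLHS]mulr1 ler_pM//; lra.
Qed.

Section fixed_eta.
Variable eta : R.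
Hypothesis eta01 : 0 < eta < 1.
Let lam := lambda r eta.
Hypothesis lam2 : 2 <= lam ^+ 2.
Let P := bigrid_prior r eta.

Let lam_ge0 : 0 <= lam. Proof. exact: lambda_ge0. Qed.

Let lam_ge1 : 1 <= lam.
Proof. by rewrite -(expr_ge1 (n := 2))//; apply: le_trans lam2; rewrite ler1n. Qed.

Let sr0 : Num.sqrt r != 0. Proof. by rewrite gt_eqF// sqrtr_gt0. Qed.

Let m1f (a : R) : measurable_fun [set: measurableTypeR R] (fun u => (normal_pdf u 1 a)%:E).
Proof. by apply/measurable_EFinP; exact: measurable_normal_pdf_mean. Qed.

Let m2f (a b : R) : measurable_fun [set: measurableTypeR R]
  (fun u => (normal_pdf u (Num.sqrt r) b * normal_pdf u 1 a)%:E).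
Proof.
by apply/measurable_EFinP; apply: measurable_funM; exact: measurable_normal_pdf_mean.
Qed.

Let n1_ge0 (a u : R) : (0 <= (normal_pdf u 1 a)%:E)%E.
Proof. by rewrite lee_fin normal_pdf_ge0. Qed.

Let n2_ge0 (a b u : R) : (0 <= (normal_pdf u (Num.sqrt r) b * normal_pdf u 1 a)%:E)%E.
Proof. by rewrite lee_fin mulr_ge0// normal_pdf_ge0. Qed.

Lemma eta_le_half : eta <= 2^-1.
Proof.
rewrite (eta_lambda r_gt0 eta01) -/lam -[leRHS]expr1; apply: expRN_le_half.
have h : 1 <= lam ^+ 2 / 2 by rewrite ler_pdivlMr// mul1r.
rewrite mulrAC (le_trans h)// ler_peMr ?(le_trans ler01)// lerDl invr_ge0 ltW//.
Qed.

Lemma marginal2_ge_grid (a b u c : R) :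
    grid_point r^-1 (bpar r) k0 u c ->
  (((2 * Kc)^-1 * expR (- (lam ^+ 2 * c / 2)) *
     (normal_pdf (lam * u) (Num.sqrt r) b * normal_pdf (lam * u) 1 a))%:E
   <= marginal2 P r a b)%E.
Proof.
move=> [[-> ->]|[k [j [ikj -> ->]]]].
  apply: (le_trans _ (bigrid_prior_ge0 r eta01 (m2f a b) (n2_ge0 a b))).
  rewrite mulr0 !mulr0 mul0r oppr0 expR0 mulr1 -EFinM lee_fin ler_wpM2r//.
    by rewrite mulr_ge0// normal_pdf_ge0.
  apply: (@le_trans _ _ 2^-1); last by have := eta_le_half; lra.
  by rewrite lef_pV2 ?posrE ?mulr_gt0// ler_peMr.
rewrite EFinM.
exact: (bigrid_prior_ge_grid r_gt0 eta01 lam2 (m2f a b) (n2_ge0 a b) ikj).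
Qed.

Lemma marginal2_bigrid_gt0 (a b : R) : (0 < marginal2 P r a b)%E.
Proof.
apply: lt_le_trans (@marginal2_ge_grid a b 0 0 _); last by left.
by rewrite lte_fin mulr_gt0// ?mulr_gt0 ?normal_pdf_gt0 ?expR_gt0 ?invr_gt0 ?mulr_gt0.
Qed.

Let P1 : P setT = 1%E. Proof. exact: probability_setT. Qed.

Let marginal2_fineK a b : ((fine (marginal2 P r a b))%:E = marginal2 P r a b)%E.
Proof. by rewrite fineK//; apply: marginal2_fin => //; exact: marginal2_bigrid_gt0. Qed.

Let marginal1_fineK a : ((fine (marginal1 P a))%:E = marginal1 P a)%E.
Proof. by rewrite fineK//; apply: marginal1_fin. Qed.

Let fine_marginal2_gt0 a b : 0 < fine (marginal2 P r a b).
Proof. by rewrite -lte_fin marginal2_fineK marginal2_bigrid_gt0. Qed.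

Let fine_marginal1_gt0 a : 0 < fine (marginal1 P a).
Proof.
rewrite -lte_fin marginal1_fineK.
exact: (marginal1_gt0 r_gt0 marginal2_bigrid_gt0).
Qed.

Lemma marginal1N a : marginal1 P (- a) = marginal1 P a.
Proof.
apply: (etrans _ (bigrid_prior_symmetric r eta01 (m1f a) (n1_ge0 a))).
by apply: eq_integral => u _; rewrite -(opprK u) normal_pdfNN ?oner_neq0// opprK.
Qed.

Lemma marginal2N a b : marginal2 P r (- a) (- b) = marginal2 P r a b.
Proof.
apply: (etrans _ (bigrid_prior_symmetric r eta01 (m2f a b) (n2_ge0 a b))).
by apply: eq_integral => u _; rewrite -{1 2}(opprK u) !normal_pdfNN ?oner_neq0// opprK.
Qed.

Let marginal1_le_dominating (t z us cs : R) :
    grid_point r^-1 (bpar r) k0 us cs -> 0 <= t - us <= k0%:R + 2 ->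
    (forall u c, grid_point r^-1 (bpar r) k0 u c \/ grid_point r^-1 (bpar r) k0 (- u) c ->
       cs + (t - us) ^+ 2 <= c + (t - u) ^+ 2) ->
  (marginal1 P (lam * t + z) <=
   (expR (- (lam ^+ 2 * cs / 2)) * normal_pdf (lam * us) 1 (lam * t + z) *
    expR (2 * slack * lam * `|z| + 2 * z ^+ 2 + slack ^+ 2) * (1 + Kc))%:E)%E.
Proof.
move=> gus tus max; set a := lam * t + z.
set M := _ * expR (_ + _).
have rv0 : r^-1 * r = 1 by rewrite mulVf// gt_eqF.
have b0 := bpar_gt0 r_gt0; have b1 := bpar_le1 r.
have M0 : 0 <= M by rewrite !mulr_ge0 ?expR_ge0// normal_pdf_ge0.
have term u c : grid_point r^-1 (bpar r) k0 u c \/ grid_point r^-1 (bpar r) k0 (- u) c ->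
    expR (- (lam ^+ 2 * c / 2)) * normal_pdf (lam * u) 1 a <=
    M * expR (- ((us - u) ^+ 2 / 4)).
  move=> uc; have := @grid_term_le R r r^-1 (bpar r) k0 r_gt0 rv0 b0 b1 t us cs gus tus
    max lam z u c lam2 lam_ge0 uc.
  rewrite /M !normal_pdf1E => h.
  rewrite mulrCA [leRHS](_ : _ = normal_peak 1 *
    expR (- (lam ^+ 2 * cs / 2) - (a - lam * us) ^+ 2 / 2 +
    (2 * slack * lam * `|z| + 2 * z ^+ 2 + slack ^+ 2) - (us - u) ^+ 2 / 4)); last first.
    by rewrite !expRD; ring.
  by rewrite ler_wpM2l ?normal_peak_ge0// -expRD ler_expR.
have termM u c : grid_point r^-1 (bpar r) k0 u c \/ grid_point r^-1 (bpar r) k0 (- u) c ->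
    expR (- (lam ^+ 2 * c / 2)) * normal_pdf (lam * u) 1 a <= M.
  move=> /term /le_trans; apply; rewrite ler_piMr//.
  by rewrite -[leRHS]expR0 ler_expR oppr_le0 divr_ge0// sqr_ge0.
have termD u c n : grid_point r^-1 (bpar r) k0 u c \/ grid_point r^-1 (bpar r) k0 (- u) c ->
    n%:R <= `|us - u| ->
    expR (- (lam ^+ 2 * c / 2)) * normal_pdf (lam * u) 1 a <= M * expR 1 * 2^-1 ^+ n.
  move=> /term + nu => /le_trans; apply; rewrite -mulrA ler_wpM2l//.
  (* With [d] the distance, [d^2 / 4 >= d - 1] because [(d / 2 - 1)^2 >= 0]. *)
  apply: (@le_trans _ _ (expR 1 * expR (- `|us - u|))).
    rewrite -expRD ler_expR.
    have := sqr_ge0 (`|us - u| / 2 - 1); rewrite sqrrB exprMn.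
    by rewrite real_normK ?num_real//; lra.
  by rewrite ler_wpM2l ?expR_ge0// expRN_le_half.
have [m hm] := grid_outer_dist b0 gus.
have us0 : 0 <= us := grid_point_ge0 b0 gus.
have gp k j : grid_index k0 k j ->
    grid_point r^-1 (bpar r) k0 (grid_pos (bpar r) k j) (grid_cost r^-1 (bpar r) k j).
  by move=> ikj; right; exists k, j.
have ii k : (k < Kpar r)%N -> grid_index k0 k 0.
  by move=> kK; split; [rewrite -ltnS /k0 Kpar_prednK|left].
have io j : grid_index k0 k0 j.+1 by split; [|right].
rewrite /marginal1.
(* Since [us >= 0], the reflected outer point of index [j + 1] is at distance at least [j + 1];
   hence the centre 0 for that half. *)
apply: (@bigrid_prior_le R r eta r_gt0 eta01 lam2 _ M m 0 (m1f a)) => //.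
- have := termM 0 0; rewrite mulr0 !mul0r oppr0 expR0 mul1r mulr0 lee_fin; apply.
  by left; left.
- by move=> k kK; rewrite -EFinM lee_fin; apply: termM; left; exact: gp (ii _ kK).
- move=> k kK; rewrite -EFinM lee_fin -(mulrN lam); apply: termM; right.
  by rewrite opprK; exact: gp (ii _ kK).
- by move=> j; rewrite -EFinM lee_fin; apply: termD; [left; exact: gp|exact: hm].
- move=> j; rewrite -EFinM lee_fin -(mulrN lam); apply: termD.
    by right; rewrite opprK; exact: gp.
  rewrite subn0 sub0n addn0 opprK ger0_norm; last first.
    by rewrite addr_ge0// /grid_pos !addr_ge0// mulr_ge0// ltW.
  rewrite /grid_pos; have : 0 <= k0%:R * bpar r by rewrite mulr_ge0// ltW.
  by lra.
Qed.

Definition coordinate_const : R :=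
  r^-1 * (k0%:R + 2) + 2 * (k0%:R + 2) + 2 * slack + 2 +
  slack ^+ 2 + ln ((1 + Kc) * (2 * Kc)).

Lemma coordinate_const_ge0 : 0 <= coordinate_const.
Proof.
have s0 : 0 <= slack.
  by apply: grid_slack_ge0 r_gt0 _; rewrite mulVf// gt_eqF.
have K0 := ltW Kc_gt0.
have l0 := ln_const_ge0.
have k00 : 0 <= k0%:R :> R by [].
have rv : 0 <= r^-1 by rewrite invr_ge0 ltW.
have h : 0 <= r^-1 * (k0%:R + 2) by rewrite mulr_ge0//; lra.
have := sqr_ge0 slack.
by rewrite /coordinate_const; lra.
Qed.

Let spike_bound_nonneg (th a b : R) : 0 <= th ->
  ln (normal_pdf th (Num.sqrt r) b * fine (marginal1 P a) / fine (marginal2 P r a b)) <=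
  lam ^+ 2 / 2 * r^-1 + coordinate_const * lam * (1 + (a - th) ^+ 2 + (b - th) ^+ 2).
Proof.
move=> th0.
have lam0 : 0 < lam by exact: lt_le_trans lam_ge1.
have rv0 : r^-1 * r = 1 by rewrite mulVf// gt_eqF.
have b0 := bpar_gt0 r_gt0; have b1 := bpar_le1 r.
have t0 : 0 <= th / lam by rewrite divr_ge0.
have [a0 [ca [us [cs [ga gus main [ta tus] max]]]]] :=
  @grid_choice R r r^-1 (bpar r) k0 r_gt0 rv0 b0 b1 (bpar_le r_gt0) (Kpar_pred_gt0 r_gt0)
    (Kpar_pred_large r_gt0) _ t0.
move: main ta tus max; set t := th / lam => main ta tus max.
have thE : th = lam * t by rewrite /t mulrCA mulfV ?mulr1// gt_eqF.
pose z := a - th; pose y := b - th.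
have aE : a = lam * t + z by rewrite -thE /z addrC subrK.
have bE : b = lam * t + y by rewrite -thE /y addrC subrK.
have U := marginal1_le_dominating z gus tus max; rewrite -aE in U.
have L := marginal2_ge_grid a b ga.
rewrite -marginal1_fineK lee_fin in U; rewrite -marginal2_fineK lee_fin in L.
set L0 := (2 * Kc)^-1 * _ * _ in L; set U0 := _ * (1 + Kc) in U.
have L0_gt0 : 0 < L0.
  by rewrite /L0 mulr_gt0// ?mulr_gt0 ?normal_pdf_gt0 ?expR_gt0 ?invr_gt0 ?mulr_gt0.
have c0 : 0 < (1 + Kc) * (2 * Kc) by rewrite !mulr_gt0// addr_gt0.
pose E := - (r^-1 * y ^+ 2 / 2) - lam ^+ 2 * cs / 2 - (a - lam * us) ^+ 2 / 2 +
  (2 * slack * lam * `|z| + 2 * z ^+ 2 + slack ^+ 2) + lam ^+ 2 * ca / 2 +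
  r^-1 * (b - lam * a0) ^+ 2 / 2 + (a - lam * a0) ^+ 2 / 2.
have ratio : normal_pdf th (Num.sqrt r) b * fine (marginal1 P a) / fine (marginal2 P r a b)
    <= expR E * ((1 + Kc) * (2 * Kc)).
  apply: (@le_trans _ _ (normal_pdf th (Num.sqrt r) b * U0 / L0)).
    apply: ler_pM.
    - by rewrite mulr_ge0 ?normal_pdf_ge0// ltW.
    - by rewrite invr_ge0 ltW.
    - by rewrite ler_wpM2l// normal_pdf_ge0.
    - by rewrite lef_pV2 ?posrE//.
  rewrite ler_pdivrMr// /U0 /L0 !normal_pdf1E !normal_pdf_sqrtE// -/y.
  rewrite [leRHS](_ : _ = normal_peak (Num.sqrt r) * normal_peak 1 * (1 + Kc) *
    (expR E * expR (- (lam ^+ 2 * ca / 2)) *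
     expR (- (r^-1 * (b - lam * a0) ^+ 2 / 2)) *
     expR (- ((a - lam * a0) ^+ 2 / 2)))); last by field; rewrite gt_eqF.
  rewrite [leLHS](_ : _ = normal_peak (Num.sqrt r) * normal_peak 1 * (1 + Kc) *
    (expR (- (r^-1 * y ^+ 2 / 2)) * expR (- (lam ^+ 2 * cs / 2)) *
     expR (- ((a - lam * us) ^+ 2 / 2)) *
     expR (2 * slack * lam * `|z| + 2 * z ^+ 2 + slack ^+ 2))); last by ring.
  rewrite -!expRD; apply: le_of_eq; congr (_ * expR _); rewrite /E; ring.
apply: (@le_trans _ _ (ln (expR E * ((1 + Kc) * (2 * Kc))))).
  rewrite ler_ln ?posrE// ?(mulr_gt0 (expR_gt0 _))//.
  by rewrite divr_gt0// mulr_gt0// normal_pdf_gt0.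
rewrite lnM ?posrE ?expR_gt0// expRK -/z -/y.
have k00 : 0 <= k0%:R :> R by [].
have s0 : 0 <= slack by apply: grid_slack_ge0 r_gt0 rv0.
set B : R := k0%:R + 2; rewrite -/B in ta tus.
(* The coefficient of [lam^2 / 2] is the expression bounded in [grid_choice]; what remains is
   bounded, linear in the noise with factor [lam], or quadratic in the noise. *)
have EE : E = lam ^+ 2 / 2 * ((1 + r^-1) * (t - a0) ^+ 2 - (t - us) ^+ 2 + ca - cs) +
   r^-1 * (lam * ((t - a0) * y)) + lam * ((us - a0) * z) +
   (2 * slack * (lam * `|z|) + 2 * z ^+ 2 + slack ^+ 2).
  by rewrite /E aE bE; field; rewrite gt_eqF.
have e1 : lam ^+ 2 / 2 * ((1 + r^-1) * (t - a0) ^+ 2 - (t - us) ^+ 2 + ca - cs) <=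
    lam ^+ 2 / 2 * r^-1.
  by rewrite ler_wpM2l// divr_ge0// sqr_ge0.
set Q := 1 + z ^+ 2 + y ^+ 2.
have [zQ yQ] : `|z| <= Q /\ `|y| <= Q.
  have := normr_le1DX2 z; have := normr_le1DX2 y; have := sqr_ge0 z; have := sqr_ge0 y.
  by rewrite /Q; lra.
have Q1 : 1 <= Q by have := sqr_ge0 z; have := sqr_ge0 y; rewrite /Q; lra.
have lQ : Q <= lam * Q by rewrite ler_peMl//; lra.
have B0 : 0 <= B by rewrite /B; lra.
have e2 : r^-1 * (lam * ((t - a0) * y)) <= r^-1 * B * (lam * Q).
  rewrite -[leRHS]mulrA ler_wpM2l ?invr_ge0 ?(ltW r_gt0)// [leRHS]mulrCA ler_wpM2l//.
  rewrite (le_trans (ler_norm _))// normrM ler_pM//.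
have e3 : lam * ((us - a0) * z) <= 2 * B * (lam * Q).
  rewrite [leRHS]mulrCA ler_wpM2l// (le_trans (ler_norm _))// normrM ler_pM//.
  have -> : us - a0 = (t - a0) - (t - us) by ring.
  rewrite (le_trans (ler_normB _ _))//; case/andP: tus => tus1 tus2.
  by rewrite (ger0_norm tus1); lra.
have e4 : 2 * slack * (lam * `|z|) <= 2 * slack * (lam * Q).
  by rewrite ler_wpM2l ?mulr_ge0// ler_wpM2l.
have e5 : z ^+ 2 <= lam * Q.
  by apply: (le_trans _ lQ); have := sqr_ge0 y; rewrite /Q; lra.
have lQ1 : 1 <= lam * Q by lra.
have e6 : slack ^+ 2 <= slack ^+ 2 * (lam * Q) by rewrite ler_peMr// sqr_ge0.
have l0 := ln_const_ge0.
have e7 : ln ((1 + Kc) * (2 * Kc)) <= ln ((1 + Kc) * (2 * Kc)) * (lam * Q).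
  by rewrite ler_peMr.
rewrite EE /coordinate_const -/B -[X in _ <= _ + X]mulrA; lra.
Qed.

Lemma spike_coordinate_bound (th a b : R) :
  ln (normal_pdf th (Num.sqrt r) b * fine (marginal1 P a) / fine (marginal2 P r a b)) <=
  lam ^+ 2 / 2 * r^-1 + coordinate_const * lam * (1 + (a - th) ^+ 2 + (b - th) ^+ 2).
Proof.
have [th0|th0] := leP 0 th; first exact: spike_bound_nonneg.
have thN : 0 <= - th by rewrite oppr_ge0 ltW.
have := @spike_bound_nonneg (- th) (- a) (- b) thN.
rewrite normal_pdfNN// marginal1N marginal2N.
by rewrite -(sqrrN (- a - - th)) -(sqrrN (- b - - th)) !opprD !opprK.
Qed.

(** Keeping only the atom at 0 in [marginal2] cancels the density of y, and [ln x <= x - 1]. The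
    resulting bound is nonnegative and its mean under the null is explicit. *)
Lemma null_coordinate_bound (a b : R) :
  ln (normal_pdf 0 (Num.sqrt r) b * fine (marginal1 P a) / fine (marginal2 P r a b)) <=
  fine (marginal1 P a) / ((1 - eta) * normal_pdf 0 1 a) - 1.
Proof.
have /andP[eta_gt0 eta_lt1] := eta01.
have L := bigrid_prior_ge0 r eta01 (m2f a b) (n2_ge0 a b).
rewrite -/(marginal2 P r a b) -marginal2_fineK -EFinM lee_fin in L.
have e1 : 0 < 1 - eta by rewrite subr_gt0.
have Nr0 : 0 < normal_pdf 0 (Num.sqrt r) b by rewrite normal_pdf_gt0.
have N0 : 0 < normal_pdf 0 1 a by rewrite normal_pdf_gt0 ?oner_neq0.
have q0 : 0 < normal_pdf 0 (Num.sqrt r) b * fine (marginal1 P a) / fine (marginal2 P r a b).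
  by rewrite divr_gt0// mulr_gt0.
rewrite -[X in ln X](subrK 1) addrC.
apply: (le_trans (le_ln1Dx _)); first by rewrite ltrBrDr addrC subrr.
rewrite lerD2r.
rewrite ler_pdivrMr// mulrAC ler_pdivlMr ?mulr_gt0//.
have := ler_wpM2l (ltW (fine_marginal1_gt0 a)) L; lra.
Qed.

End fixed_eta.
End coordinate_bounds.

(** * Second moments of Gaussian densities *)

Section second_moment.
Context {R : realType}.

Lemma sqr_le_expR (z : R) : z ^+ 2 <= 4 * (expR z + expR (- z)).
Proof.
have h (w : R) : 0 <= w -> w ^+ 2 <= 4 * expR w.
  move=> w0; have e := expR_ge1Dx (w / 2).
  have -> : expR w = expR (w / 2) ^+ 2 by rewrite -expRM_natl; congr expR; field.
  have : (w / 2) ^+ 2 <= expR (w / 2) ^+ 2.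
    by rewrite lerXn2r ?nnegrE ?expR_ge0//; lra.
  by lra.
have := expR_ge0 z; have := expR_ge0 (- z).
have [/h|/ltW] := leP 0 z; first by lra.
by rewrite -oppr_ge0 => /h; rewrite sqrrN; lra.
Qed.

Lemma normal_pdf_tilt (m s t x : R) : s != 0 ->
  normal_pdf m s x * expR (t * (x - m) / s ^+ 2 - t ^+ 2 / (2 * s ^+ 2)) =
  normal_pdf (m + t) s x.
Proof.
move=> s0; rewrite !normal_pdfE//= /normal_fun -[LHS]mulrA -expRD; congr (_ * expR _).
by rewrite -mulr_natr; field.
Qed.

(** A bound for the variance from [z^2 <= 4 (e^z + e^(-z))] at [z = (x - m) / s]: by
    [normal_pdf_tilt] each exponential turns the density into a shifted one times [e^(1/2)]. *)
Definition second_moment_ub (s : R) : R := 8 * expR (2^-1) * s ^+ 2.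

Lemma second_moment_ub_ge0 s : 0 <= second_moment_ub s.
Proof. by rewrite mulr_ge0 ?sqr_ge0// mulr_ge0// expR_ge0. Qed.

Local Open Scope ereal_scope.

Lemma integral_normal_pdf_quadratic_le (m s K B : R) :
    s != 0%R -> (0 <= K)%R -> (0 <= B)%R ->
  \int[lebesgue_measure]_x ((K + B * (x - m) ^+ 2)%:E * (normal_pdf m s x)%:E) <=
  (K + B * second_moment_ub s)%:E.
Proof.
move=> s0 K0 B0.
pose c : R := (4 * B * s ^+ 2 * expR (2^-1))%R.
have c0 : (0 <= c)%R by rewrite /c mulr_ge0 ?expR_ge0// mulr_ge0 ?sqr_ge0// mulr_ge0.
have mN m' : measurable_fun setT (fun x => (normal_pdf m' s x)%:E).
  by apply/measurable_EFinP; exact: measurable_normal_pdf.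
have N0 m' x : 0 <= (normal_pdf m' s x)%:E by rewrite lee_fin normal_pdf_ge0.
apply: (@le_trans _ _ (\int[lebesgue_measure]_x (K%:E * (normal_pdf m s x)%:E +
   (c%:E * (normal_pdf (m + s) s x)%:E + c%:E * (normal_pdf (m - s) s x)%:E)))).
  apply: le_integralT => x; rewrite -!EFinM -!EFinD lee_fin mulrDl lerD2l.
  rewrite -!(normal_pdf_tilt _ _ _ s0).
  have -> : (s * (x - m) / s ^+ 2 - s ^+ 2 / (2 * s ^+ 2) = (x - m) / s - 2^-1)%R by field.
  have -> : (- s * (x - m) / s ^+ 2 - (- s) ^+ 2 / (2 * s ^+ 2) = - ((x - m) / s) - 2^-1)%R by field.
  set z := ((x - m) / s)%R.
  have -> : (x - m = s * z)%R by rewrite /z mulrCA mulfV// mulr1.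
  rewrite !expRD /c.
  have h : (expR (2^-1) * expR (- 2^-1) = 1 :> R)%R by rewrite -expRD subrr expR0.
  rewrite [leRHS](_ : _ = B * s ^+ 2 * (4 * (expR z + expR (- z))) *
     (expR (2^-1) * expR (- 2^-1)) * normal_pdf m s x)%R; last by ring.
  rewrite h mulr1 ler_wpM2r ?normal_pdf_ge0// exprMn [leLHS]mulrA.
  by rewrite ler_wpM2l ?sqr_le_expR// mulr_ge0// sqr_ge0.
have mc (k : R) m' : measurable_fun setT (fun x => k%:E * (normal_pdf m' s x)%:E).
  exact: measurable_funeM.
have p0 (k : R) m' : (0 <= k)%R -> forall x, 0 <= k%:E * (normal_pdf m' s x)%:E.
  by move=> k0 x; rewrite mule_ge0// lee_fin.
rewrite ge0_integralD; last 5 first.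
- exact: measurableT.
- by move=> x _; exact: p0.
- exact: mc.
- by move=> x _; apply: adde_ge0; exact: p0.
- by apply: emeasurable_funD; exact: mc.
rewrite ge0_integralD; last 5 first.
- exact: measurableT.
- by move=> x _; exact: p0.
- exact: mc.
- by move=> x _; exact: p0.
- exact: mc.
have int_c (k : R) m' : (0 <= k)%R ->
    \int[lebesgue_measure]_x (k%:E * (normal_pdf m' s x)%:E) = k%:E.
  move=> k0; rewrite ge0_integralZl ?lee_fin//; last exact: mN.
  by rewrite integral_normal_pdf mule1.
rewrite !int_c// -!EFinD lee_fin /c /second_moment_ub.
by apply: le_of_eq; ring.
Qed.

Lemma expect_quadratic_le (r m K B : R) : (0 < r)%R -> (0 <= K)%R -> (0 <= B)%R ->
  \int[lebesgue_measure]_a ((\int[lebesgue_measure]_b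
     ((K + B * ((a - m) ^+ 2 + (b - m) ^+ 2))%:E * (normal_pdf m (Num.sqrt r) b)%:E)) *
     (normal_pdf m 1 a)%:E) <=
  (K + B * (second_moment_ub 1 + second_moment_ub (Num.sqrt r)))%:E.
Proof.
move=> r0 K0 B0.
have sr0 : Num.sqrt r != 0%R by rewrite gt_eqF// sqrtr_gt0.
apply: (@le_trans _ _ (\int[lebesgue_measure]_a
    ((K + B * second_moment_ub (Num.sqrt r) + B * (a - m) ^+ 2)%:E * (normal_pdf m 1 a)%:E))).
  apply: le_integralT => a; rewrite lee_wpmul2r ?lee_fin ?normal_pdf_ge0//.
  have Ka : (0 <= K + B * (a - m) ^+ 2)%R by rewrite addr_ge0// mulr_ge0// sqr_ge0.
  have := integral_normal_pdf_quadratic_le m sr0 Ka B0.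
  rewrite -addrA (addrC (B * (a - m) ^+ 2)%R) addrA; apply: le_trans.
  by apply: le_integralT => b; rewrite mulrDr addrA.
have K1 : (0 <= K + B * second_moment_ub (Num.sqrt r))%R.
  by rewrite addr_ge0// mulr_ge0// second_moment_ub_ge0.
have := integral_normal_pdf_quadratic_le m (oner_neq0 R) K1 B0.
by move/le_trans; apply; rewrite lee_fin; apply: le_of_eq; ring.
Qed.

End second_moment.

(** * Risk of the bi-grid density at sparse means *)

Section upper_bound.
Context {R : realType}.
Variables (r eta : R) (n s : nat).
Hypothesis r_gt0 : 0 < r.
Hypothesis eta01 : 0 < eta < 1.
Let lam := lambda r eta.
Hypothesis lam2 : 2 <= lam ^+ 2.
Let P := bigrid_prior r eta.

Definition upper_const : R :=
  coordinate_const r * (1 + second_moment_ub 1 + second_moment_ub (Num.sqrt r)).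

Let P1 : P setT = 1%E. Proof. exact: probability_setT. Qed.
Let m2_gt0 a b : (0 < marginal2 P r a b)%E.
Proof. exact: marginal2_bigrid_gt0. Qed.

Lemma bigrid_density_predictive : predictive_density (bigrid_density r eta (n := n)).
Proof. exact: (bayes_density_predictive r_gt0 P1 m2_gt0). Qed.

Let null_risk (a : R) := fine (marginal1 P a) / ((1 - eta) * normal_pdf 0 1 a) - 1.

Let e1 : 0 < 1 - eta. Proof. by case/andP: eta01 => _; rewrite subr_gt0. Qed.

Let N0 (a : R) : 0 < normal_pdf 0 1 a. Proof. by rewrite normal_pdf_gt0 ?oner_neq0. Qed.

Let null_risk_ge0 a : 0 <= null_risk a.
Proof.
rewrite subr_ge0 ler_pdivlMr ?mulr_gt0// mul1r.
rewrite -lee_fin fineK; last exact: marginal1_fin.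
rewrite EFinM.
apply: (bigrid_prior_ge0 r eta01 (f := fun u => (normal_pdf u 1 a)%:E)).
  by apply/measurable_EFinP; exact: measurable_normal_pdf_mean.
by move=> u; rewrite lee_fin normal_pdf_ge0.
Qed.

Let measurable_m1 : measurable_fun setT (fun a : R => fine (marginal1 P a)).
Proof.
apply: (measurableT_comp (fine_measurable measurableT)).
exact: measurable_marginal1.
Qed.

Let measurable_null_risk : measurable_fun setT null_risk.
Proof.
apply: measurable_funB => //; apply: measurable_funM; first exact: measurable_m1.
apply: measurable_fun_invr_gt0; first by move=> t; rewrite mulr_gt0.
by apply: measurable_funM => //; exact: measurable_normal_pdf.
Qed.

Local Open Scope ereal_scope.

Let integral_marginal1 : \int[lebesgue_measure]_a marginal1 P a = 1.
Proof.
have := @fubini_tonelli _ _ (measurableTypeR R) (measurableTypeR R) R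
  (@lebesgue_measure R) P (fun p => (normal_pdf p.2 1 p.1)%:E).
move=> -> /=; last 2 first.
- apply/measurable_EFinP; apply: measurable_normal_pdf2; first exact: oner_neq0.
    exact: measurable_snd.
  exact: measurable_fst.
- by move=> p; rewrite lee_fin normal_pdf_ge0.
under eq_integral do rewrite integral_normal_pdf.
by rewrite integral_cst// mul1e.
Qed.

(** Adding 1 to [null_risk] turns the integrand into [marginal1 / (1 - eta)], and [marginal1] is a
    probability density; the Gaussian integral 1 is subtracted only at the end, between finite
    values. *)
Lemma expect_null_risk :
  \int[lebesgue_measure]_a ((null_risk a)%:E * (normal_pdf 0 1 a)%:E) =
  (eta / (1 - eta))%:E.
Proof.
have m1K a : (fine (marginal1 P a))%:E = marginal1 P a.
  by rewrite fineK//; exact: marginal1_fin.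
have : \int[lebesgue_measure]_a ((null_risk a)%:E * (normal_pdf 0 1 a)%:E) +
    \int[lebesgue_measure]_a (normal_pdf 0 1 a)%:E = ((1 - eta)^-1)%:E.
  rewrite -ge0_integralD//; last 4 first.
  - by move=> a _; rewrite -EFinM lee_fin mulr_ge0// ltW.
  - apply: emeasurable_funM; apply/measurable_EFinP => //; exact: measurable_normal_pdf.
  - by move=> a _; rewrite lee_fin ltW.
  - by apply/measurable_EFinP; exact: measurable_normal_pdf.
  transitivity (\int[lebesgue_measure]_a (((1 - eta)^-1)%:E * marginal1 P a)).
    apply: eq_integral => a _; rewrite -m1K -!EFinM -EFinD; congr EFin; rewrite /null_risk.
    by field; rewrite !gt_eqF.
  rewrite ge0_integralZl//.
  - by rewrite integral_marginal1 mule1.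
  - exact: measurable_marginal1.
  - by move=> a _; apply: integral_ge0 => u _; rewrite lee_fin normal_pdf_ge0.
  - by rewrite lee_fin invr_ge0 ltW.
rewrite integral_normal_pdf; case: (\int[_]_a _) => [x||]//= [h]; congr EFin.
by rewrite -[x](addrK 1%R) h; field; rewrite gt_eqF.
Qed.

Lemma bigrid_risk_le (theta : 'R^[R]_n) : sparse s theta ->
  risk r theta (bigrid_density r eta (n := n)) <=
  (n%:R * (eta / (1 - eta)) + s%:R * (lam ^+ 2 / 2 * r^-1 + upper_const * lam))%:E.
Proof.
move=> th_sparse.
have lam0 : (0 <= lam)%R by exact: lambda_ge0.
have C0 : (0 <= coordinate_const r)%R by apply: coordinate_const_ge0.
pose A := (lam ^+ 2 / 2 * r^-1 + coordinate_const r * lam)%R.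
have A0 : (0 <= A)%R.
  by rewrite addr_ge0// mulr_ge0// ?invr_ge0 ?(ltW r_gt0)// divr_ge0// sqr_ge0.
have B0 : (0 <= coordinate_const r * lam)%R by rewrite mulr_ge0.
pose g (i : 'I_n) (a b : R) : R := if tnth theta i == 0%R then null_risk a
  else (A + coordinate_const r * lam * ((a - tnth theta i) ^+ 2 + (b - tnth theta i) ^+ 2))%R.
have g0 i a b : (0 <= g i a b)%R.
  by rewrite /g; case: ifP => // _; rewrite addr_ge0// mulr_ge0// addr_ge0// sqr_ge0.
have mgi i : measurable_fun setT (fun ab => g i ab.1 ab.2).
  rewrite /g; case: (tnth theta i == 0%R).
    exact: (measurableT_comp measurable_null_risk measurable_fst).
  apply: measurable_funD => //; apply: measurable_funM => //.
  apply: measurable_funD; apply: measurable_funX; apply: measurable_funB => //.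
apply: (le_trans (@risk_le R n r theta _ (fun x y => \sum_(i < n) (g i (tnth x i) (tnth y i))%:E) _)).
  move=> x y; apply: (lne_bayes_density_le r_gt0 P1 m2_gt0) => i.
  rewrite /g; have [->|_] := eqVneq (tnth theta i) 0%R.
    exact: null_coordinate_bound.
  apply: (le_trans (spike_coordinate_bound r_gt0 eta01 lam2 _ _ _)).
  by rewrite /A -/lam; apply: le_of_eq; ring.
rewrite expect2_sum//; last 2 first.
- by move=> i x y; rewrite lee_fin.
- move=> i; apply/measurable_EFinP.
  have m1 : measurable_fun [set: 'R^[R]_n * 'R^[R]_n] (fun xy => tnth xy.1 i).
    exact: (measurableT_comp (measurable_tnth i) measurable_fst).
  have m2 : measurable_fun [set: 'R^[R]_n * 'R^[R]_n] (fun xy => tnth xy.2 i).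
    exact: (measurableT_comp (measurable_tnth i) measurable_snd).
  exact: (measurableT_comp (mgi i) (measurable_fun_pair m1 m2)).
pose S := (lam ^+ 2 / 2 * r^-1 + upper_const * lam)%R.
(* The null contribution is charged to the spikes as well, so that the total is [n eta / (1 - eta)],
   of order [s] when [eta = s / n]. *)
have E (i : 'I_n) : expect2 r theta (fun x y => (g i (tnth x i) (tnth y i))%:E) <=
    (eta / (1 - eta) + (if tnth theta i == 0%R then 0 else S))%:E.
  rewrite (expect2_coord r theta i (h := fun a b => (g i a b)%:E)); last 2 first.
  - by move=> a b; rewrite lee_fin.
  - by apply/measurable_EFinP; exact: mgi.
  have [t0|t0] := eqVneq (tnth theta i) 0%R.
    rewrite addr0 -expect_null_risk t0; apply: le_of_eq.
    apply: eq_integral => a _; congr (_ * _).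
    rewrite /g t0 eqxx ge0_integralZl//.
    - by rewrite integral_normal_pdf mule1.
    - by apply/measurable_EFinP; exact: measurable_normal_pdf.
    - by move=> b _; rewrite lee_fin normal_pdf_ge0.
    - by rewrite lee_fin.
  rewrite /g (negbTE t0).
  apply: (le_trans (expect_quadratic_le _ r_gt0 A0 B0)).
  have e0 : (0 <= eta / (1 - eta))%R.
    by case/andP: eta01 => *; rewrite divr_ge0// ltW.
  by rewrite lee_fin /S /A /upper_const; lra.
apply: (le_trans (lee_sum _ (fun i _ => E i))).
rewrite sumEFin lee_fin big_split/= sumr_const card_ord -[X in (X + _ <= _)%R]mulr_natl lerD2l.
have S0 : (0 <= S)%R.
  rewrite /S addr_ge0// mulr_ge0// ?invr_ge0 ?(ltW r_gt0) ?divr_ge0 ?sqr_ge0//.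
  by rewrite mulr_ge0// !addr_ge0 ?second_moment_ub_ge0.
rewrite (eq_bigr (fun i => if tnth theta i != 0%R then S else 0%R)); last first.
  by move=> i _; case: eqP.
rewrite -big_mkcond sumr_const -[leLHS]mulr_natl ler_wpM2r// ler_nat.
apply: leq_trans th_sparse; rewrite /l0norm.
by apply: eq_leq; apply: eq_card => i; rewrite inE.
Qed.

End upper_bound.

(** * The lower bound *)

Section block_prior.
Context {R : realType}.
Variables (r tau : R) (n s m : nat) (e : 'I_s -> 'I_m -> 'I_n).
Hypothesis r_gt0 : 0 < r.
Hypothesis m_gt0 : (0 < m)%N.
Hypothesis tau_ge0 : 0 <= tau.
(** The detection threshold among [m] coordinates: the mean log likelihood ratio of a spike against
    0, from X and Y together with precision [1 + 1/r], equals [ln m]. *)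
Hypothesis tauE : tau ^+ 2 * (1 + r^-1) / 2 = ln m%:R.
Hypothesis e_inj : forall b j b' j', e b j = e b' j' -> b = b' /\ j = j'.
Implicit Types (f : {ffun 'I_s -> 'I_m}) (x y : 'R^[R]_n).

Let sr0 : Num.sqrt r != 0. Proof. by rewrite gt_eqF// sqrtr_gt0. Qed.
Let srE : Num.sqrt r ^+ 2 = r. Proof. by rewrite sqr_sqrtr// ltW. Qed.
Let rV0 : 0 <= r^-1. Proof. by rewrite invr_ge0 ltW. Qed.
Let mR_gt0 : 0 < m%:R :> R. Proof. by rewrite ltr0n. Qed.

Definition spikes f : {set 'I_n} := [set e b (f b) | b : 'I_s].

Definition spike_mean f : 'R^[R]_n := [tuple if i \in spikes f then tau else 0 | i < n].

Lemma spike_mean_sparse f : sparse s (spike_mean f).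
Proof.
apply: (@leq_trans #|spikes f|).
  apply: subset_leq_card; apply/fintype.subsetP => i; rewrite inE tnth_mktuple.
  by case: ifP => //; rewrite eqxx.
by rewrite (leq_trans (leq_imset_card _ _))// cardT size_enum_ord.
Qed.

Lemma spikeP f b j : (e b j \in spikes f) = (j == f b).
Proof.
apply/imsetP/eqP => [[b' _ /e_inj[<- ->]]//|->]; by exists b.
Qed.

Lemma spike_prod f (F : 'I_n -> R) :
  \prod_(i < n) (if i \in spikes f then F i else 1) = \prod_(b < s) F (e b (f b)).
Proof.
rewrite -big_mkcond/= /spikes big_imset//=.
by move=> b b' _ _ /e_inj[].
Qed.

Let lik1 (a : R) : R := expR (tau * a - tau ^+ 2 / 2).
Let lik2 (b : R) : R := expR (r^-1 * tau * b - r^-1 * tau ^+ 2 / 2).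
Let lik a b := lik1 a * lik2 b.

Let lik_gt0 a b : 0 < lik a b. Proof. by rewrite mulr_gt0// expR_gt0. Qed.

Lemma normal_lik1 (a : R) : normal_pdf tau 1 a = normal_pdf 0 1 a * lik1 a.
Proof.
have := normal_pdf_tilt 0 tau a (oner_neq0 R); rewrite add0r => <-.
by congr (_ * expR _); rewrite subr0; field.
Qed.

Lemma normal_lik2 (b : R) :
  normal_pdf tau (Num.sqrt r) b = normal_pdf 0 (Num.sqrt r) b * lik2 b.
Proof.
have := normal_pdf_tilt 0 tau b sr0; rewrite add0r => <-.
by congr (_ * expR _); rewrite srE subr0; field; rewrite gt_eqF.
Qed.

Let zero_mean : 'R^[R]_n := [tuple 0 | i < n].

Lemma gauss_pdf_spike f s' (l : R -> R) (x : 'R^[R]_n) :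
    (forall a, normal_pdf tau (Num.sqrt s') a = normal_pdf 0 (Num.sqrt s') a * l a) ->
  gauss_pdf (spike_mean f) s' x =
  gauss_pdf zero_mean s' x * \prod_(b < s) l (tnth x (e b (f b))).
Proof.
move=> lE; rewrite -(spike_prod f (fun i => l (tnth x i))) -big_split/=.
apply: eq_bigr => i _; rewrite !tnth_mktuple.
by case: ifP => _; rewrite ?lE ?mulr1.
Qed.

(** Likelihood ratios against the zero mean: [Lf] for the placement [f], [block] for a uniform spike
    in one block, [mix] for independent uniform spikes in all blocks. *)
Let Lf f x y := \prod_(b < s) lik (tnth x (e b (f b))) (tnth y (e b (f b))).
Let block b x y := m%:R^-1 * \sum_(j < m) lik (tnth x (e b j)) (tnth y (e b j)).
Let mix x y := \prod_(b < s) block b x y.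

Let j0 : 'I_m := Ordinal m_gt0.

Let block_gt0 b x y : 0 < block b x y.
Proof.
rewrite mulr_gt0 ?invr_gt0// (bigD1 j0)//= ltr_pwDl//.
by apply: sumr_ge0 => j _; rewrite ltW.
Qed.

Let mix_gt0 x y : 0 < mix x y.
Proof. by apply: prodr_gt0 => b _; exact: block_gt0. Qed.

Lemma mixture_average x y :
  \sum_(f : {ffun 'I_s -> 'I_m}) Lf f x y = m%:R ^+ s * mix x y.
Proof.
rewrite /mix /block big_split/= prodr_const card_ord mulrA -exprMn mulfV ?gt_eqF//.
by rewrite expr1n mul1r bigA_distr_bigA.
Qed.

(** * Lower bound for an arbitrary predictive density *)

Section lower_bound.
Variable p : 'R^[R]_n -> 'R^[R]_n -> R.
Hypothesis p_pred : predictive_density p.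

Let pm : measurable_fun [set: 'R^[R]_n * 'R^[R]_n] (fun xy => p xy.1 xy.2).
Proof. by case: p_pred. Qed.
Let p_ge0 x y : 0 <= p x y. Proof. by case: p_pred. Qed.

(* The ratio of the density p(y|x) p_0(x) to the mixture density *)
Let ratio x y := p x y / (gauss_pdf zero_mean r y * mix x y).

Let g0y y : 0 < gauss_pdf zero_mean r y. Proof. exact: gauss_pdf_gt0. Qed.

Let ratio_ge0 x y : 0 <= ratio x y.
Proof. by rewrite divr_ge0// ltW// mulr_gt0. Qed.

Let mcoord1 i : measurable_fun [set: 'R^[R]_n * 'R^[R]_n] (fun xy => tnth xy.1 i).
Proof. exact: (measurableT_comp (measurable_tnth i) measurable_fst). Qed.

Let mcoord2 i : measurable_fun [set: 'R^[R]_n * 'R^[R]_n] (fun xy => tnth xy.2 i).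
Proof. exact: (measurableT_comp (measurable_tnth i) measurable_snd). Qed.

Let mlik1 : measurable_fun setT lik1.
Proof.
apply: measurableT_comp; first exact: measurable_expR.
by apply: measurable_funB => //; exact: measurable_funM.
Qed.

Let mlik2 : measurable_fun setT lik2.
Proof.
apply: measurableT_comp; first exact: measurable_expR.
by apply: measurable_funB => //; exact: measurable_funM.
Qed.

Let mlik i : measurable_fun [set: 'R^[R]_n * 'R^[R]_n]
  (fun xy => lik (tnth xy.1 i) (tnth xy.2 i)).
Proof.
apply: measurable_funM.
  exact: (measurableT_comp mlik1 (mcoord1 i)).
exact: (measurableT_comp mlik2 (mcoord2 i)).
Qed.

Let mLf f : measurable_fun [set: 'R^[R]_n * 'R^[R]_n] (fun xy => Lf f xy.1 xy.2).
Proof. by apply: measurable_prod => b _; exact: mlik. Qed.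

Let mmix : measurable_fun [set: 'R^[R]_n * 'R^[R]_n] (fun xy => mix xy.1 xy.2).
Proof.
apply: measurable_prod => b _; apply: measurable_funM => //.
by apply: measurable_sum => j; exact: mlik.
Qed.

Let mratio : measurable_fun [set: 'R^[R]_n * 'R^[R]_n] (fun xy => ratio xy.1 xy.2).
Proof.
apply: measurable_funM; first exact: pm.
apply: measurable_fun_invr_gt0; first by move=> xy; rewrite mulr_gt0.
apply: measurable_funM; last exact: mmix.
exact: (measurableT_comp (measurable_gauss_pdf _ _) measurable_snd).
Qed.

Local Open Scope ereal_scope.

Let mfst (F : 'R^[R]_n -> 'R^[R]_n -> R) x :
  measurable_fun [set: 'R^[R]_n * 'R^[R]_n] (fun xy => F xy.1 xy.2) ->
  measurable_fun setT (F x).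
Proof. by move=> mF; exact: (measurableT_comp mF (measurable_pair1 x)). Qed.

Lemma expect2_spike f (F : 'R^[R]_n -> 'R^[R]_n -> R) :
    (forall x y, (0 <= F x y)%R) ->
    measurable_fun [set: 'R^[R]_n * 'R^[R]_n] (fun xy => F xy.1 xy.2) ->
  expect2 r (spike_mean f) (fun x y => (F x y)%:E) =
  expect2 r zero_mean (fun x y => (F x y * Lf f x y)%:E).
Proof.
move=> F0 mF; apply: eq_integral => x _.
have E1 : gauss_pdf (spike_mean f) 1 x =
    (gauss_pdf zero_mean 1 x * \prod_(b < s) lik1 (tnth x (e b (f b))))%R.
  by apply: gauss_pdf_spike => a; rewrite sqrtr1 normal_lik1.
set Lx := (\prod_(b < s) _)%R in E1.
have Lx0 : (0 <= Lx)%R by apply: prodr_ge0 => b _; exact: expR_ge0.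
have -> : (gauss_pdf (spike_mean f) 1 x)%:E = Lx%:E * (gauss_pdf zero_mean 1 x)%:E.
  by rewrite E1 EFinM muleC.
rewrite [LHS]muleA; congr (_ * _).
rewrite -ge0_integralZr//; last 2 first.
- apply: emeasurable_funM; apply/measurable_EFinP; first exact: (@mfst F x mF).
  exact: measurable_gauss_pdf.
- by move=> y _; rewrite -EFinM lee_fin mulr_ge0// gauss_pdf_ge0.
apply: eq_integral => y _.
rewrite (gauss_pdf_spike f y normal_lik2) -!EFinM; congr EFin.
rewrite /Lf /lik big_split/= -/Lx; ring.
Qed.

(** Summing the likelihood ratios cancels [mix] in the denominator of [ratio] and leaves p(y|x)
    p_0(x), of integral 1; [m^s] counts the placements. *)
Lemma sum_expect2_ratio :
  \sum_(f : {ffun 'I_s -> 'I_m}) expect2 r (spike_mean f) (fun x y => (ratio x y)%:E) =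
  (m%:R ^+ s)%:E.
Proof.
under eq_bigr do rewrite expect2_spike//.
rewrite -expect2_sum; last 2 first.
- by move=> f x y; rewrite lee_fin mulr_ge0//; apply: prodr_ge0 => b _; rewrite ltW.
- by move=> f; apply/measurable_EFinP; apply: measurable_funM.
have ms0 : (0 <= m%:R ^+ s :> R)%R by rewrite exprn_ge0.
rewrite /expect2.
transitivity (\int[leb]_x ((m%:R ^+ s)%:E * (gauss_pdf zero_mean 1 x)%:E)); last first.
  rewrite ge0_integralZl//.
  - by rewrite integral_gauss_pdf mule1.
  - by apply/measurable_EFinP; exact: measurable_gauss_pdf.
  - by move=> x _; rewrite lee_fin gauss_pdf_ge0.
apply: eq_integral => x _; congr (_ * _).
transitivity (\int[leb]_y ((m%:R ^+ s)%:E * (p x y)%:E)).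
  apply: eq_integral => y _; rewrite sumEFin -mulr_sumr mixture_average -!EFinM.
  by congr EFin; rewrite /ratio; field; rewrite !gt_eqF.
rewrite ge0_integralZl//.
- by case: p_pred => _ _ ->; rewrite mule1.
- by apply/measurable_EFinP; exact: (@mfst p x pm).
- by move=> y _; rewrite lee_fin.
Qed.

Lemma exists_expect2_ratio_le1 :
  exists f, expect2 r (spike_mean f) (fun x y => (ratio x y)%:E) <= 1.
Proof.
pose a f := expect2 r (spike_mean f) (fun x y => (ratio x y)%:E).
have a0 f : 0 <= a f by apply: expect2_ge0 => x y; rewrite lee_fin.
apply: contrapT => /forallNP h.
have afin f : a f \is a fin_num.
  rewrite ge0_fin_numE// (@le_lt_trans _ _ (m%:R ^+ s)%:E) ?ltry//.
  rewrite -sum_expect2_ratio (bigD1 f)//= leeDl//.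
  by apply: sume_ge0 => g _; exact: a0.
have := sum_expect2_ratio; rewrite -/a.
under eq_bigr => f _ do rewrite -/(a f) -(fineK (afin f)).
rewrite sumEFin => -[] /eqP; apply/negP; rewrite gt_eqF//.
have -> : (m%:R ^+ s = \sum_(f : {ffun 'I_s -> 'I_m}) 1 :> R)%R.
  by rewrite sumr_const card_ffun !card_ord -natrX.
apply: ltr_sum.
  by apply/hasP; exists [ffun => j0]; rewrite ?mem_index_enum.
move=> f _; rewrite -lte_fin fineK// ltNge; apply/negP; exact: h.
Qed.

(** One [tau] for the noise in x, and [tau / r] twice for the noise in y, which enters both through
    the mixture and through the likelihood of y. *)
Let B : R := (tau * (1 + 2 * r^-1))%R.

Let noise_ub f x y : R :=
  (\sum_(b < s) (ln 2 + B + B * ((tnth x (e b (f b)) - tau) ^+ 2 + (tnth y (e b (f b)) - tau) ^+ 2)))%R.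

Let null_ub f x y : R :=
  (\sum_(b < s) \sum_(j < m | j != f b) m%:R^-1 * lik (tnth x (e b j)) (tnth y (e b j)))%R.

Let B_ge0 : (0 <= B)%R.
Proof. by rewrite mulr_ge0// addr_ge0// mulr_ge0. Qed.

(** By [tauE] the weight [1 / m] cancels the mean log likelihood ratio of the true spike, leaving
    [e^z] with [z] of mean 0. The null coordinates add [W], and [e^z + W <= (1 + e^z) (1 + W)]. *)
Let block_ln_le f b x y :
  (ln (block b x y) <= ln 2 + `|tau * ((tnth x (e b (f b)) - tau) + r^-1 * (tnth y (e b (f b)) - tau))| +
    \sum_(j < m | j != f b) m%:R^-1 * lik (tnth x (e b j)) (tnth y (e b j)))%R.
Proof.
set W := (\sum_(j < m | _) _)%R; set z := (tau * _)%R.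
have W0 : (0 <= W)%R by apply: sumr_ge0 => j _; rewrite mulr_ge0 ?invr_ge0// ltW.
have bE : block b x y = (expR z + W)%R.
  rewrite /block mulr_sumr (bigD1 (f b))//=; congr (_ + _)%R.
  have -> : (m%:R^-1 = expR (- (tau ^+ 2 * (1 + r^-1) / 2)))%R.
    by rewrite tauE expRN lnK.
  by rewrite /lik /lik1 /lik2 -!expRD; congr expR; rewrite /z; field; rewrite gt_eqF.
have z1 : (1 + expR z <= expR (ln 2 + `|z|))%R.
  rewrite expRD lnK ?posrE//.
  have : (1 <= expR `|z|)%R by rewrite -[leLHS]expR0 ler_expR.
  have : (expR z <= expR `|z|)%R by rewrite ler_expR ler_norm.
  by lra.
have ez := expR_gt0 z.
rewrite bE -[leRHS]expRK ler_ln ?posrE ?expR_gt0//; last by rewrite ltr_pwDl.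
rewrite [X in (_ <= X)%R]expRD.
apply: (@le_trans _ _ ((1 + expR z) * (1 + W))%R).
  have : (0 <= expR z * W)%R by rewrite mulr_ge0// expR_ge0.
  by lra.
by apply: ler_pM; [rewrite addr_ge0// ltW|rewrite addr_ge0| |exact: expR_ge1Dx].
Qed.

(** The log ratio is [ln L2 - ln ratio - ln mix]. The [1] in the constant comes from
    [ln ratio <= ratio - 1] and will offset the mean of [ratio]. *)
Let pointwise f x y :
  (s%:R * (r^-1 * tau ^+ 2 / 2) + 1)%:E -
    (noise_ub f x y + null_ub f x y + ratio x y)%:E <=
  lne ((gauss_pdf (spike_mean f) r y)%:E / (p x y)%:E).
Proof.
have gf0 : (0 < gauss_pdf (spike_mean f) r y)%R by exact: gauss_pdf_gt0.
(* Where [p] vanishes the log ratio is [+oo]. *)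
have := p_ge0 x y; rewrite le_eqVlt => /predU1P[<-|pxy0].
  by rewrite inver eqxx gt0_muley ?lte_fin//= leey.
rewrite inver gt_eqF// -EFinM lne_EFin ?divr_gt0// -EFinB lee_fin.
rewrite (gauss_pdf_spike f y normal_lik2).
set L2 := (\prod_(b < s) _)%R.
have L20 : (0 < L2)%R by apply: prodr_gt0 => b _; exact: expR_gt0.
have rat0 : (0 < ratio x y)%R by rewrite divr_gt0// mulr_gt0.
have -> : (gauss_pdf zero_mean r y * L2 / p x y = L2 / (ratio x y * mix x y))%R.
  by rewrite /ratio; field; rewrite !gt_eqF.
have -> : (ln (L2 / (ratio x y * mix x y)) = ln L2 - (ln (ratio x y) + ln (mix x y)))%R.
  by rewrite -lnM ?posrE// -ln_div ?posrE// mulr_gt0.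
have ln_ratio : (ln (ratio x y) <= ratio x y - 1)%R.
  rewrite -{1}(subrK 1%R (ratio x y)) addrC le_ln1Dx//.
  by rewrite ltrBrDr addrC subrr.
have ln_mix : (ln (mix x y) <= \sum_(b < s) (ln 2 +
    `|tau * ((tnth x (e b (f b)) - tau) + r^-1 * (tnth y (e b (f b)) - tau))|) + null_ub f x y)%R.
  rewrite /mix ln_prod; last by move=> b; exact: block_gt0.
  by rewrite /null_ub -big_split/=; apply: ler_sum => b _; exact: block_ln_le.
have lnL2 : ln L2 = (\sum_(b < s) (r^-1 * tau ^+ 2 / 2 + r^-1 * (tau * (tnth y (e b (f b)) - tau))))%R.
  rewrite /L2 ln_prod; last by move=> b; exact: expR_gt0.
  by apply: eq_bigr => b _; rewrite /lik2 expRK; field; rewrite gt_eqF.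
suff key : (\sum_(b < s) (ln 2 +
    `|tau * ((tnth x (e b (f b)) - tau) + r^-1 * (tnth y (e b (f b)) - tau))|) +
    s%:R * (r^-1 * tau ^+ 2 / 2) <= noise_ub f x y + ln L2)%R by lra.
rewrite lnL2 /noise_ub.
have -> : (s%:R * (r^-1 * tau ^+ 2 / 2) = \sum_(b < s) r^-1 * tau ^+ 2 / 2 :> R)%R.
  by rewrite sumr_const card_ord mulr_natl.
rewrite -!big_split/=; apply: ler_sum => b _.
set z := (tnth x _ - tau)%R; set w := (tnth y _ - tau)%R.
have h1 : (`|tau * (z + r^-1 * w)| <= tau * `|z| + tau * r^-1 * `|w|)%R.
  rewrite normrM (ger0_norm tau_ge0) -mulrA -mulrDr ler_wpM2l//.
  by rewrite (le_trans (ler_normD _ _))// normrM (ger0_norm rV0).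
have h2 : (- (tau * r^-1 * `|w|) <= r^-1 * (tau * w))%R.
  rewrite lerNl; apply: (le_trans (ler_norm _)).
  by rewrite normrN !normrM (ger0_norm tau_ge0) (ger0_norm rV0) mulrCA mulrA.
have h3 : (tau * `|z| <= tau * (1 + z ^+ 2))%R by rewrite ler_wpM2l// normr_le1DX2.
have h4 : (tau * r^-1 * `|w| <= tau * r^-1 * (1 + w ^+ 2))%R.
  by rewrite ler_wpM2l ?mulr_ge0// normr_le1DX2.
have h5 : (0 <= tau * w ^+ 2)%R by rewrite mulr_ge0// sqr_ge0.
have h6 : (0 <= tau * r^-1 * z ^+ 2)%R by rewrite mulr_ge0 ?sqr_ge0// mulr_ge0.
have h7 : (0 <= tau * r^-1 * w ^+ 2)%R by rewrite mulr_ge0 ?sqr_ge0// mulr_ge0.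
by rewrite /B; lra.
Qed.

Definition lower_slack : R :=
  (ln 2 + 1 + tau * (1 + 2 * r^-1) * (1 + second_moment_ub 1 + second_moment_ub (Num.sqrt r)))%R.

Lemma expect2_noise f :
  expect2 r (spike_mean f) (fun x y => (noise_ub f x y)%:E) <=
  (s%:R * (ln 2 + B + B * (second_moment_ub 1 + second_moment_ub (Num.sqrt r))))%:E.
Proof.
have l2 : (0 <= ln 2 :> R)%R by rewrite ln_ge0// ler1n.
have q0 (a b : R) : (0 <= ln 2 + B + B * ((a - tau) ^+ 2 + (b - tau) ^+ 2))%R.
  by rewrite !addr_ge0// mulr_ge0// addr_ge0// sqr_ge0.
have mq : measurable_fun [set: R * R]
    (fun ab => ln 2 + B + B * ((ab.1 - tau) ^+ 2 + (ab.2 - tau) ^+ 2))%R.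
  apply: measurable_funD => //; apply: measurable_funM => //.
  by apply: measurable_funD; apply: measurable_funX; apply: measurable_funB.
rewrite (_ : (fun x y => _) = (fun x y => \sum_(b < s)
   (ln 2 + B + B * ((tnth x (e b (f b)) - tau) ^+ 2 + (tnth y (e b (f b)) - tau) ^+ 2))%:E)); last first.
  by apply/funext => x; apply/funext => y; rewrite sumEFin.
rewrite expect2_sum; last 2 first.
- by move=> b x y; rewrite lee_fin.
- move=> b; apply/measurable_EFinP.
  exact: (measurableT_comp mq (measurable_fun_pair (mcoord1 (e b (f b))) (mcoord2 (e b (f b))))).
have -> : (s%:R * (ln 2 + B + B * (second_moment_ub 1 + second_moment_ub (Num.sqrt r))))%:E =
  \sum_(b < s) (ln 2 + B + B * (second_moment_ub 1 + second_moment_ub (Num.sqrt r)))%:E :> \bar R.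
  by rewrite sumEFin sumr_const card_ord mulr_natl.
apply: lee_sum => b _.
rewrite (expect2_coord r (spike_mean f) (e b (f b)) (h := fun a c =>
   (ln 2 + B + B * ((a - tau) ^+ 2 + (c - tau) ^+ 2))%:E)); last 2 first.
- by move=> a c; rewrite lee_fin.
- by apply/measurable_EFinP.
rewrite tnth_mktuple spikeP eqxx.
by apply: expect_quadratic_le => //; rewrite addr_ge0.
Qed.

(** At a null coordinate the likelihood ratio has mean 1, and each block has fewer than [m] of them,
    each with weight [1 / m]. *)
Lemma expect2_null f :
  expect2 r (spike_mean f) (fun x y => (null_ub f x y)%:E) <= s%:R%:E.
Proof.
have l0 i x y : 0 <= (m%:R^-1 * lik (tnth x i) (tnth y i))%:E.
  by rewrite lee_fin mulr_ge0 ?invr_ge0// ltW.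
have ml i : measurable_fun [set: 'R^[R]_n * 'R^[R]_n]
    (fun xy => (m%:R^-1 * lik (tnth xy.1 i) (tnth xy.2 i))%:E).
  by apply/measurable_EFinP; exact: measurable_funM.
rewrite (_ : (fun x y => _) = (fun x y => \sum_(b < s) \sum_(j < m | j != f b)
   (m%:R^-1 * lik (tnth x (e b j)) (tnth y (e b j)))%:E)); last first.
  apply/funext => x; apply/funext => y; rewrite -sumEFin.
  by apply: eq_bigr => b _; rewrite sumEFin.
rewrite expect2_sum; last 2 first.
- by move=> b x y; apply: sume_ge0.
- move=> b; under eq_fun do rewrite big_mkcond/=.
  apply: emeasurable_sum => j; case: (j != f b) => //; exact: ml.
have -> : s%:R%:E = \sum_(b < s) 1 :> \bar R.
  by rewrite sumEFin sumr_const card_ord.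
apply: lee_sum => b _.
rewrite expect2_sum//.
have E j : j != f b -> expect2 r (spike_mean f)
    (fun x y => (m%:R^-1 * lik (tnth x (e b j)) (tnth y (e b j)))%:E) = (m%:R^-1)%:E.
  move=> jf; rewrite (expect2_coord r (spike_mean f) (e b j)
    (h := fun a c => (m%:R^-1 * lik a c)%:E)); last 2 first.
  - by move=> a c; rewrite lee_fin mulr_ge0 ?invr_ge0// ltW.
  - apply/measurable_EFinP; apply: measurable_funM => //; apply: measurable_funM.
      exact: (measurableT_comp mlik1 measurable_fst).
    exact: (measurableT_comp mlik2 measurable_snd).
  rewrite tnth_mktuple spikeP (negbTE jf).
  have mi0 : (0 <= m%:R^-1 :> R)%R by rewrite invr_ge0.
  transitivity (\int[lebesgue_measure]_a ((m%:R^-1)%:E * (normal_pdf tau 1 a)%:E)).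
    apply: eq_integral => a _.
    rewrite normal_lik1 EFinM [in RHS]muleC -muleA muleC; congr (_ * _).
    transitivity (\int[lebesgue_measure]_c ((m%:R^-1 * lik1 a)%:E * (normal_pdf tau (Num.sqrt r) c)%:E)).
      apply: eq_integral => c _; rewrite normal_lik2 -!EFinM; congr EFin.
      by rewrite /lik; ring.
    rewrite ge0_integralZl//.
    - by rewrite integral_normal_pdf mule1 -EFinM mulrC.
    - by apply/measurable_EFinP; exact: measurable_normal_pdf.
    - by move=> c _; rewrite lee_fin normal_pdf_ge0.
    - by rewrite lee_fin mulr_ge0// expR_ge0.
  rewrite ge0_integralZl//.
  - by rewrite integral_normal_pdf mule1.
  - by apply/measurable_EFinP; exact: measurable_normal_pdf.
  - by move=> c _; rewrite lee_fin normal_pdf_ge0.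
rewrite (eq_bigr _ E) sumEFin lee_fin sumr_const -[leLHS]mulr_natr.
rewrite mulrC ler_pdivrMr// mul1r ler_nat.
by rewrite (leq_trans (max_card _))// card_ord.
Qed.

Lemma max_risk_ge :
  (s%:R * (r^-1 * tau ^+ 2 / 2 - lower_slack))%:E <= max_risk r (sparse s) p.
Proof.
have [f hf] := exists_expect2_ratio_le1.
apply: (@le_trans _ _ (risk r (spike_mean f) p)); last first.
  by apply: ereal_sup_ubound; exists (spike_mean f) => //; exact: spike_mean_sparse.
have l2 : (0 <= ln 2 :> R)%R by rewrite ln_ge0// ler1n.
have noise0 x y : (0 <= noise_ub f x y)%R.
  by apply: sumr_ge0 => b _; rewrite !addr_ge0// mulr_ge0// addr_ge0// sqr_ge0.
have null0 x y : (0 <= null_ub f x y)%R.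
  by apply: sumr_ge0 => b _; apply: sumr_ge0 => j _; rewrite mulr_ge0 ?invr_ge0// ltW.
have mnoise : measurable_fun [set: 'R^[R]_n * 'R^[R]_n] (fun xy => noise_ub f xy.1 xy.2).
  apply: measurable_sum => b; apply: measurable_funD => //; apply: measurable_funM => //.
  apply: measurable_funD; apply: measurable_funX; apply: measurable_funB => //.
    exact: mcoord1.
  exact: mcoord2.
have mnull : measurable_fun [set: 'R^[R]_n * 'R^[R]_n] (fun xy => null_ub f xy.1 xy.2).
  apply: measurable_sum => b; under eq_fun do rewrite big_mkcond/=.
  apply: measurable_sum => j; case: (j != f b) => //; exact: measurable_funM.
have c0 : (0 <= s%:R * (r^-1 * tau ^+ 2 / 2) + 1)%R.
  by rewrite addr_ge0// mulr_ge0// divr_ge0// mulr_ge0// sqr_ge0.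
pose H x y := (noise_ub f x y + null_ub f x y + ratio x y)%:E.
have := @risk_ge R n r (spike_mean f) p _ H c0.
move=> /(_ _ _ (pointwise f)) risk_f; apply: (le_trans _ (risk_f _ _)); last 2 first.
- by move=> x y; rewrite lee_fin !addr_ge0.
- by apply/measurable_EFinP; apply: measurable_funD => //; exact: measurable_funD.
have HE : expect2 r (spike_mean f) H =
    expect2 r (spike_mean f) (fun x y => (noise_ub f x y)%:E) +
    expect2 r (spike_mean f) (fun x y => (null_ub f x y)%:E) +
    expect2 r (spike_mean f) (fun x y => (ratio x y)%:E).
  rewrite -expect2D.
  - rewrite -expect2D//.
    + by move=> x y; rewrite -EFinD lee_fin addr_ge0.
    + by apply: emeasurable_funD; apply/measurable_EFinP.
    + exact/measurable_EFinP.
  - by move=> x y; rewrite lee_fin.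
  - by move=> x y; rewrite lee_fin.
  - exact/measurable_EFinP.
  - exact/measurable_EFinP.
have Hle : expect2 r (spike_mean f) H <=
    (s%:R * (ln 2 + B + B * (second_moment_ub 1 + second_moment_ub (Num.sqrt r))) + s%:R + 1)%:E.
  by rewrite HE !EFinD; apply: leeD => //; apply: leeD; [exact: expect2_noise|exact: expect2_null].
apply: (@le_trans _ _ ((s%:R * (r^-1 * tau ^+ 2 / 2) + 1)%:E -
   (s%:R * (ln 2 + B + B * (second_moment_ub 1 + second_moment_ub (Num.sqrt r))) + s%:R + 1)%:E)).
  by rewrite -EFinB lee_fin; apply: le_of_eq; rewrite /lower_slack /B; ring.
exact: leeB.
Qed.

End lower_bound.
End block_prior.

(** * Asymptotic minimaxity *)

Section minimax_bounds.
Context {R : realType}.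
Variables (r : R) (n s : nat).
Hypothesis r_gt0 : 0 < r.
Hypothesis s_gt0 : (0 < s)%N.
Hypothesis sn : (s.*2 <= n)%N.

Let eta : R := s%:R / n%:R.
Let lam := lambda r eta.

Let n_gt0 : (0 < n)%N.
Proof. by apply: leq_trans sn; rewrite double_gt0. Qed.
Let nR_gt0 : 0 < n%:R :> R. Proof. by rewrite ltr0n. Qed.
Let sR_gt0 : 0 < s%:R :> R. Proof. by rewrite ltr0n. Qed.

Let eta01 : 0 < eta < 1.
Proof.
rewrite divr_gt0//= ltr_pdivrMr// mul1r ltr_nat.
by apply: leq_trans sn; rewrite -addnn -[ltnLHS]addn0 ltn_add2l.
Qed.

Definition minimax_const : R :=
  ln 2 + 1 + (1 + r^-1) * ln 2 +
  (1 + 2 * r^-1) * (1 + second_moment_ub 1 + second_moment_ub (Num.sqrt r)).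

Lemma minimax_const_ge0 : 0 <= minimax_const.
Proof.
have l2 : 0 <= ln 2 :> R by rewrite ln_ge0// ler1n.
have rV : 0 <= r^-1 by rewrite invr_ge0 ltW.
by rewrite !addr_ge0// mulr_ge0// !addr_ge0 ?mulr_ge0// second_moment_ub_ge0.
Qed.

Let m := (n %/ s)%N.

Let m_gt0 : (0 < m)%N.
Proof. by rewrite divn_gt0// (leq_trans _ sn)// -addnn leq_addr. Qed.

Let spike_pos_subproof (b : 'I_s) (j : 'I_m) : (b * m + j < n)%N.
Proof.
apply: (@leq_trans (s * m)); last by rewrite mulnC leq_divM.
apply: (@leq_trans (b.+1 * m)); last by rewrite leq_mul2r ltn_ord orbT.
by rewrite mulSn addnC ltn_add2r.
Qed.

Let spike_pos (b : 'I_s) (j : 'I_m) : 'I_n := Ordinal (spike_pos_subproof b j).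

Let spike_pos_inj b j b' j' : spike_pos b j = spike_pos b' j' -> b = b' /\ j = j'.
Proof.
move=> /(congr1 val) /= h; split; apply: val_inj => /=.
  have := congr1 (fun x => x %/ m)%N h.
  by rewrite !divnMDl// !divn_small// !addn0.
by have := congr1 (fun x => x %% m)%N h; rewrite !modnMDl !modn_small.
Qed.

Lemma minimax_risk_ge : 1 <= lam ->
  ((s%:R * (lam ^+ 2 / 2 * r^-1 - minimax_const * lam))%:E <=
   minimax_risk r (sparse s : set 'R^[R]_n))%E.
Proof.
move=> lam1; have v0 := vpar_gt0 r_gt0; have v1 := vpar_inv r_gt0.
have w0 : 0 < 1 + r^-1 by rewrite addr_gt0// invr_gt0.
have l2 : 0 <= ln 2 :> R by rewrite ln_ge0// ler1n.
have rV : 0 <= r^-1 by rewrite invr_ge0 ltW.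
have lm0 : 0 <= ln m%:R :> R by rewrite ln_ge0// ler1n.
pose tau : R := Num.sqrt (2 * vpar r * ln m%:R).
have tau0 : 0 <= tau by exact: sqrtr_ge0.
have tau2 : tau ^+ 2 = 2 * vpar r * ln m%:R.
  by rewrite sqr_sqrtr// mulr_ge0// mulr_ge0// ltW.
have tauE : tau ^+ 2 * (1 + r^-1) / 2 = ln m%:R.
  rewrite tau2; have -> : 2 * vpar r * ln m%:R * (1 + r^-1) / 2 =
    ((1 + r^-1) * vpar r) * ln m%:R by field; rewrite gt_eqF.
  by rewrite v1 mul1r.
have lam2 : lam ^+ 2 = 2 * vpar r * - ln eta.
  by rewrite /lam lambda_sqr//; ring.
have eta0 : 0 < eta by case/andP: eta01.
have etaV : - ln eta = ln (n%:R / s%:R) by rewrite -lnV ?posrE// invf_div.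
have mle : ln m%:R <= - ln eta.
  rewrite etaV ler_ln ?posrE ?ltr0n// ?divr_gt0//.
  by rewrite ler_pdivlMr// -natrM ler_nat leq_divM.
(* Rounding [n / s] down loses at most a factor 2, as the remainder is below [s <= m s]; so [tau^2]
   falls short of [lambda^2] by a bounded amount. *)
have mge : - ln eta - ln 2 <= ln m%:R.
  rewrite etaV -ln_div ?posrE ?divr_gt0// ler_ln ?posrE ?ltr0n ?divr_gt0//.
  rewrite ler_pdivrMr// ler_pdivrMr// -!natrM ler_nat.
  have := divn_eq n s; rewrite -/m => ->.
  have : (n %% s < s)%N by rewrite ltn_mod.
  have : (s <= m * s)%N by rewrite leq_pmull.
  by rewrite muln2 -addnn mulnDl => h1 h2; rewrite leq_add2l (leq_trans (ltnW h2)).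
have taulam : tau <= lam.
  rewrite -(ler_pXn2r (n := 2))// ?nnegrE//; last exact: le_trans lam1.
  by rewrite tau2 lam2 ler_wpM2l// mulr_ge0// ltW.
apply: le_ereal_inf_tmp => _ [p p_pred <-].
apply: le_trans (max_risk_ge r_gt0 m_gt0 tau0 tauE spike_pos_inj p_pred).
rewrite lee_fin ler_wpM2l ?(ltW sR_gt0)//.
have h1 : r^-1 * tau ^+ 2 / 2 >= lam ^+ 2 / 2 * r^-1 - (1 + r^-1) * ln 2.
  rewrite lam2 tau2.
  have -> : r^-1 * (2 * vpar r * ln m%:R) / 2 = r^-1 * vpar r * ln m%:R by field; rewrite gt_eqF.
  have -> : 2 * vpar r * - ln eta / 2 * r^-1 = r^-1 * vpar r * - ln eta by field; rewrite gt_eqF.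
  have c0 : 0 <= r^-1 * vpar r by rewrite mulr_ge0// ltW.
  have c1 : r^-1 * vpar r <= 1 by rewrite -v1 ler_wpM2r ?(ltW v0)// lerDr.
  have := ler_wpM2l c0 mge.
  have : r^-1 * vpar r * ln 2 <= (1 + r^-1) * ln 2.
    by rewrite ler_wpM2r// (le_trans c1)// lerDl.
  lra.
have h2 : lower_slack r tau + (1 + r^-1) * ln 2 <= minimax_const * lam.
  set S : R := 1 + second_moment_ub 1 + second_moment_ub (Num.sqrt r).
  have S0 : 0 <= S by rewrite !addr_ge0 ?second_moment_ub_ge0.
  have q0 : 0 <= (1 + 2 * r^-1) * S by rewrite mulr_ge0// addr_ge0// mulr_ge0.
  have e1 : tau * ((1 + 2 * r^-1) * S) <= lam * ((1 + 2 * r^-1) * S) by rewrite ler_wpM2r.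
  have k0 : 0 <= ln 2 + 1 + (1 + r^-1) * ln 2 by rewrite !addr_ge0// mulr_ge0// ltW.
  have e2 : ln 2 + 1 + (1 + r^-1) * ln 2 <= (ln 2 + 1 + (1 + r^-1) * ln 2) * lam.
    by rewrite ler_peMr.
  rewrite /lower_slack /minimax_const -/S; lra.
by lra.
Qed.

Lemma minimax_risk_le : 2 <= lam ^+ 2 ->
  (minimax_risk r (sparse s : set 'R^[R]_n) <=
   max_risk r (sparse s) (bigrid_density r eta (n := n)))%E.
Proof.
move=> lam2; apply: ereal_inf_lbound; exists (bigrid_density r eta (n := n)) => //.
exact: bigrid_density_predictive.
Qed.

Lemma bigrid_max_risk_le : 2 <= lam ^+ 2 -> 1 <= lam ->
  (max_risk r (sparse s) (bigrid_density r eta (n := n)) <=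
   (s%:R * (lam ^+ 2 / 2 * r^-1 + (upper_const r + 2) * lam))%:E)%E.
Proof.
move=> lam2 lam1; apply: ge_ereal_sup => _ [theta th <-].
apply: (le_trans (bigrid_risk_le r_gt0 eta01 lam2 th)).
rewrite lee_fin -/lam.
have /andP[eta0 eta1] := eta01.
have etah := eta_le_half r_gt0 eta01 lam2.
have -> : n%:R * (eta / (1 - eta)) = s%:R * (1 - eta)^-1.
  by rewrite mulrA; congr (_ * _); rewrite mulrC divfK ?gt_eqF.
(* As [eta <= 1/2], the null coordinates cost at most [2 s]; [lam >= 1] lets this join the error
   terms, whence the [+ 2]. *)
have : (1 - eta)^-1 <= 2 * lam.
  apply: (@le_trans _ _ 2); last by rewrite ler_peMr.
  by rewrite -[leRHS]invrK lef_pV2 ?posrE ?invr_gt0 ?subr_gt0//; lra.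
by move=> /(ler_wpM2l (ltW sR_gt0)); lra.
Qed.

End minimax_bounds.

Theorem theorem1p2 (R : realType) (r : R) (s : nat -> nat)
    (r_gt0 : 0 < r)
    (s_bounds : forall n : nat, (0 < n)%N -> (1 <= s n <= n)%N)
    (eta_to0 : (fun n : nat => (s n)%:R / n%:R : R) @ \oo --> (0 : R)) :
  exists2 eps : nat -> R, eps @ \oo --> (0 : R) &
    \forall n \near \oo,
      (max_risk r (sparse (s n)) (bigrid_density r ((s n)%:R / n%:R) (n := n))
       = minimax_risk r (sparse (s n) : set 'R^[R]_n) * (1 + eps n)%:E)%E.
Proof.
pose eta n : R := (s n)%:R / n%:R.
pose lam n := lambda r (eta n).
pose maxr n := max_risk r (sparse (s n)) (bigrid_density r (eta n) (n := n)).
pose minr n := minimax_risk r (sparse (s n) : set 'R^[R]_n).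
have v0 := vpar_gt0 r_gt0.
(* [lambda >= M] amounts to [eta <= exp (- M^2 / (2 v))], and [eta < 1/2] gives blocks of size at
   least 2. *)
have lam_large (M : R) : 0 <= M ->
    \forall n \near \oo, [/\ (0 < s n)%N, ((s n).*2 <= n)%N & M <= lam n].
  move=> M0; have d0 : 0 < Num.min (2^-1) (expR (- (M ^+ 2 / (2 * vpar r)))) :> R.
    by rewrite lt_min invr_gt0 ltr0n expR_gt0.
  near=> n.
  have n0 : (0 < n)%N by near: n; exact: nbhs_infty_gt.
  have /andP[s1 _] := s_bounds n n0.
  have : eta n < Num.min (2^-1) (expR (- (M ^+ 2 / (2 * vpar r)))).
    by near: n; exact: (cvgr_lt _ eta_to0 _ d0).
  rewrite lt_min => /andP[eta_half eta_small].
  have nR : 0 < n%:R :> R by rewrite ltr0n.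
  have e0 : 0 < eta n by rewrite divr_gt0// ltr0n.
  have e01 : 0 < eta n < 1 by rewrite e0/=; lra.
  split => //.
    rewrite -muln2 -(ler_nat R) natrM.
    by move: eta_half; rewrite /eta ltr_pdivrMr//; lra.
  rewrite -(ler_pXn2r (n := 2))// ?nnegrE ?lambda_ge0// lambda_sqr//.
  have : ln (eta n) <= - (M ^+ 2 / (2 * vpar r)).
    by rewrite -[leRHS]expRK ler_ln ?posrE ?expR_gt0// ltW.
  have v20 : 0 < 2 * vpar r by rewrite mulr_gt0.
  by rewrite lerNr ler_pdivrMr// mulNr mulrC.
pose Cu := upper_const r + 2; pose Cl := minimax_const r.
(* The two bounds differ by [s (Cu + Cl) lam] and the minimax risk will be at least
   [s lam^2 / (4 r)]; their quotient is [A / lam]. *)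
pose A := 4 * r * (Cu + Cl).
have Cl0 : 0 <= Cl by exact: minimax_const_ge0.
(* From [lam >= 4 r Cl] on, the error [Cl lam] uses up at most half of the main term
   [lam^2 / (2 r)]; the summand 2 ensures [lam >= 1] and [lam^2 >= 2]. *)
have bounds n : (0 < s n)%N -> ((s n).*2 <= n)%N -> 2 + 4 * r * Cl <= lam n ->
    [/\ maxr n \is a fin_num, minr n \is a fin_num, 0 < fine (minr n) &
       `|fine (maxr n) / fine (minr n) - 1| <= A / lam n].
  move=> s0 sn laml.
  have rC : 0 <= 4 * r * Cl by rewrite !mulr_ge0// ltW.
  have lam0 : 0 < lam n by lra.
  have lam1 : 1 <= lam n by lra.
  have lam2 : 2 <= lam n ^+ 2.
    have := ler_pM (ler0n R 2) (ler0n R 2) (_ : 2 <= lam n) (_ : 2 <= lam n).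
    by rewrite -expr2 => h; apply: le_trans (h _ _); lra.
  have L := minimax_risk_ge r_gt0 s0 sn lam1.
  have I := minimax_risk_le r_gt0 s0 sn lam2.
  have U := bigrid_max_risk_le r_gt0 s0 sn lam2 lam1.
  rewrite -/(eta n) -/(lam n) -/(maxr n) -/(minr n) -/Cl -/Cu in L I U.
  set l := _%:E in L; set u := _%:E in U.
  have maxfin : maxr n \is a fin_num.
    rewrite fin_numElt (lt_le_trans _ (le_trans L I)) ?ltNyr//.
    by rewrite (le_lt_trans U)// ltry.
  have minfin : minr n \is a fin_num.
    rewrite fin_numElt (lt_le_trans _ L) ?ltNyr//.
    by rewrite (le_lt_trans (le_trans I U))// ltry.
  move: L I U; rewrite -(fineK maxfin) -(fineK minfin) /l /u !lee_fin.
  set mn := fine (minr n); set mx := fine (maxr n) => L I U.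
  have sR : 0 < (s n)%:R :> R by rewrite ltr0n.
  have X0 : 0 < lam n ^+ 2 / (4 * r) by rewrite divr_gt0 ?exprn_gt0// mulr_gt0.
  have Xl : Cl * lam n <= lam n ^+ 2 / (4 * r).
    rewrite ler_pdivlMr ?mulr_gt0// mulrAC expr2 ler_wpM2r ?(ltW lam0)//.
    by rewrite mulrC; lra.
  have Ls : (s n)%:R * (lam n ^+ 2 / (4 * r)) <= mn.
    apply: le_trans L; rewrite ler_wpM2l ?(ltW sR)//.
    have -> : lam n ^+ 2 / 2 * r^-1 = 2 * (lam n ^+ 2 / (4 * r)).
      by field; rewrite gt_eqF.
    by lra.
  have mn0 : 0 < mn by apply: lt_le_trans Ls; rewrite mulr_gt0.
  split => //.
  have -> : mx / mn - 1 = (mx - mn) / mn by field; rewrite gt_eqF.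
  rewrite ger0_norm; last by rewrite divr_ge0 ?subr_ge0// ltW.
  rewrite ler_pdivrMr//.
  have Al : 0 <= A / lam n.
    rewrite divr_ge0 ?(ltW lam0)// mulr_ge0 ?mulr_ge0 ?(ltW r_gt0)// addr_ge0//.
    rewrite addr_ge0// mulr_ge0 ?coordinate_const_ge0//.
    by rewrite !addr_ge0 ?second_moment_ub_ge0.
  apply: (le_trans _ (ler_wpM2l Al Ls)).
  have -> : A / lam n * ((s n)%:R * (lam n ^+ 2 / (4 * r))) = (s n)%:R * ((Cu + Cl) * lam n).
    by rewrite /A; field; rewrite !gt_eqF.
  by lra.
exists (fun n => fine (maxr n) / fine (minr n) - 1).
  apply/cvgr0Pnorm_lt => e e0.
  have M0 : 0 <= Num.max (2 + 4 * r * Cl) (A / e + 1).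
    by rewrite le_max addr_ge0// !mulr_ge0// ltW.
  have := lam_large _ M0; apply: filterS => n [s0 sn].
  rewrite ge_max => /andP[l1 l2].
  have [_ _ _ h] := bounds n s0 sn l1.
  apply: (le_lt_trans h).
  have rC : 0 <= 4 * r * Cl by rewrite !mulr_ge0// ltW.
  have lam0 : 0 < lam n by lra.
  by rewrite ltr_pdivrMr// mulrC -ltr_pdivrMr//; lra.
have M0 : 0 <= 2 + 4 * r * Cl by rewrite addr_ge0// !mulr_ge0// ltW.
have := lam_large _ M0; apply: filterS => n [s0 sn l1].
have [maxfin minfin mn0 _] := bounds n s0 sn l1.
rewrite -/(eta n) -/(maxr n) -/(minr n) -(fineK maxfin) -(fineK minfin) -EFinM.
by rewrite /= [in RHS]addrC subrK mulrCA mulfV ?mulr1// gt_eqF.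
Unshelve. all: by end_near.
Qed.
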